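(* Let $\mathbb K=\mathbb R$ or $\mathbb C$, let $1\leqslant k\leqslant d/2$, and let $(\Gamma,\mathcal P)$ be a relatively hyperbolic group. If a representation $\rho:\Gamma\to\mathsf{SL}(d,\mathbb K)$ is $P_k$-divergent and extended geometrically finite relative to $\mathcal P$, then $\rho$ is extended geometrically finite with a boundary extension $\zeta:\mathcal L(\rho)\to\partial(\Gamma,\mathcal P)$ in $\mathcal F_{k,d-k}$, where $\mathcal L(\rho)$ is the limit set of $\rho$, and $\zeta$ is defined such that: (a) if $(\gamma_n)_{n\in\mathbb N}\subset\Gamma$ is a sequence with $\gamma_n\to q\in\partial_{con}(\Gamma,\mathcal P)$, then $\zeta^{-1}(q)$ is the singleton $\lim_{n\to+\infty}(U_k(\rho(\gamma_n)),U_{d-k}(\rho(\gamma_n)))$; (b) for any $p\in\partial_{par}(\Gamma,\mathcal P)$ with stabilizer $P\in\mathcal P^\Gamma$, $$\zeta^{-1}(p)=\Big\{\lim_{n\to+\infty}(U_k(\rho(\gamma_n)),U_{d-k}(\rho(\gamma_n))):(\gamma_n)_{n\in\mathbb N}\subset P\text{ a sequence of pairwise distinct elements}\Big\}$$ (over all such sequences for which the limit exists).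
   Context: **Relatively hyperbolic groups.** A geodesic metric space $X$ is taut if there is $R\geqslant 0$ such that every point of $X$ lies in the $R$-neighborhood of some bi-infinite geodesic. Let $\Gamma$ be a finitely generated group, $\mathcal P$ a finite collection of finitely generated infinite subgroups, $\mathcal P^\Gamma=\{\gamma P\gamma^{-1}:\gamma\in\Gamma,P\in\mathcal P\}$. $(\Gamma,\mathcal P)$ is relatively hyperbolic if there is a taut, proper Gromov hyperbolic space $X$ with a properly discontinuous isometric $\Gamma$-action such that (i) there is a $\Gamma$-invariant collection $\{B_P:P\in\mathcal P^\Gamma\}$ of pairwise disjoint open horoballs, the stabilizer of $B_P$ being $P$; (ii) $\Gamma$ acts cocompactly on $X\setminus\bigcup_P B_P$. Such an $X$ is a Gromov model. The Bowditch boundary $\partial(\Gamma,\mathcal P)$ is the Gromov boundary of $X$ (independent of $X$). Every point of it is either a conical limit point or a bounded parabolic point for the $\Gamma$-action; the corresponding sets are $\partial_{con}(\Gamma,\mathcal P)$ and $\partial_{par}(\Gamma,\mathcal P)$. Parabolic points are the centers of the horoballs $B_P$; $P\in\mathcal P^\Gamma$ is the stabilizer of the center of $B_P$. For $(\gamma_n)\subset\Gamma$, $\gamma_n\to p\in\partial(\Gamma,\mathcal P)$ means $\gamma_n o\to p$ in $X\cup\partial X$ for $o\in X$. **Extended geometrically finite.** A boundary extension of $(\Gamma,\mathcal P)$ is a continuous $\Gamma$-equivariant surjection $\zeta:\Lambda\to\partial(\Gamma,\mathcal P)$, where $\Lambda$ is a compact metrizable Hausdorff $\Gamma$-space. $\mathcal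 F_{k,d-k}=\{(V,W)\in\mathrm{Gr}_k(\mathbb K^d)\times\mathrm{Gr}_{d-k}(\mathbb K^d):V\subset W\}$; $(V_1,W_1),(V_2,W_2)$ are transverse if $V_1\oplus W_2=V_2\oplus W_1=\mathbb K^d$; two subsets are transverse if all pairs of their elements are. A boundary extension is in $\mathcal F_{k,d-k}$ if $\Lambda$ is a closed $\rho(\Gamma)$-invariant subset of $\mathcal F_{k,d-k}$ on which $\Gamma$ acts via $\rho$; it is transverse if $\zeta^{-1}(p),\zeta^{-1}(q)$ are transverse for $p\ne q$. $\rho$ is extended geometrically finite with boundary extension $\zeta:\Lambda\to\partial(\Gamma,\mathcal P)$ if $\zeta$ is a transverse boundary extension in $\mathcal F_{k,d-k}$ and there are open sets $C_p\subset\mathcal F_{k,d-k}$, $p\in\partial(\Gamma,\mathcal P)$, with $\Lambda\setminus\zeta^{-1}(p)\subset C_p$, such that whenever $\gamma_n\to p$ and $\gamma_n^{-1}\to q$, for every compact $L\subset C_q$ and open $U\supset\zeta^{-1}(p)$ one has $\rho(\gamma_n)L\subset U$ for all large $n$. It is extended geometrically finite relative to $\mathcal P$ if this holds for some boundary extension. **Divergence and limit set.** $\sigma_i$ denotes the $i$-th largest singular value. $\rho$ is $P_k$-divergent if $\sigma_k(\rho(\gamma_n))/\sigma_{k+1}(\rho(\gamma_n))\to+\infty$ for every sequence of pairwise distinct $\gamma_n\in\Gamma$. For $g\in\mathsf{SL}(d,\mathbb K)$ with $\sigma_j(g)>\sigma_{j+1}(g)$, $U_j(g)$ is the $j$-dimensional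 sum of eigenspaces of $gg^*$ ($g^*$ the conjugate transpose) for its $j$ largest eigenvalues. If $\rho$ is $P_k$-divergent, then for pairwise distinct $\gamma_n$ both $U_k(\rho(\gamma_n))$ and $U_{d-k}(\rho(\gamma_n))$ are defined for large $n$, and $\mathcal L(\rho)\subset\mathcal F_{k,d-k}$ is the set of all limits $\lim_n(U_k(\rho(\gamma_n)),U_{d-k}(\rho(\gamma_n)))$ over sequences of pairwise distinct elements of $\Gamma$ for which the limit exists. *)

(* Defs.v *)
From HB Require Import structures.
From mathcomp Require Import all_boot all_order all_algebra.
From mathcomp Require Import all_classical all_reals.
From mathcomp Require Import topology normedtype sequences.
From mathcomp Require Import complex.

Set Implicit Arguments.
Unset Strict Implicit.
Unset Printing Implicit Defensive.

Import Order.TTheory GRing.Theory Num.Theory.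
Import numFieldTopology.Exports numFieldNormedType.Exports.

Local Open Scope classical_set_scope.
Local Open Scope ring_scope.

Section Groups.
Context {G : groupType}.
Implicit Types (H Q S : set G) (P : set (set G)).
Local Open Scope group_scope.

Definition is_subgroup H : Prop :=
  H 1 /\ forall x y, H x -> H y -> H (x * y^-1).

Definition finitely_generated H : Prop :=
  exists2 S, finite_set S & H = smallest is_subgroup S.

Definition conj_set (g : G) H : set G := [set g * h * g^-1 | h in H].

Definition conjugates P : set (set G) :=
  [set Q | exists g, exists2 H, P H & Q = conj_set g H].

Record peripheral_structure P : Prop := {
  ambient_fg : finitely_generated [set: G];
  peripheral_finite : finite_set P;
  peripheral_subgroup : forall H, P H -> is_subgroup H;
  peripheral_fg : forall H, P H -> finitely_generated H;
  peripheral_infinite : forall H, P H -> infinite_set H }.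

End Groups.

Section Metric.
Context {R : realType} {X : metricType R}.
Implicit Types (o x y : X) (u v : nat -> X) (c : R -> X).

Definition geodesic_on (I : set R) c : Prop :=
  forall s t, I s -> I t -> mdist (c s) (c t) = `|s - t|.

Definition geodesic_segment c x y : Prop :=
  [/\ c 0 = x, c (mdist x y) = y &
      geodesic_on [set t | 0 <= t <= mdist x y] c].

Definition geodesic_ray c : Prop := geodesic_on [set t | 0 <= t] c.
Definition geodesic_line c : Prop := geodesic_on setT c.

Definition gromov_product o x y : R :=
  (mdist o x + mdist o y - mdist x y) / 2.

Definition diverging_product u v : Prop :=
  forall o (A : R), \forall i & j \near \oo, A <= gromov_product o (u i) (v j).

Definition converges_at_infinity u : Prop := diverging_product u u.

Definition gromov_class u : set (nat -> X) :=
  [set v | converges_at_infinity v /\ diverging_product u v].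

End Metric.

Arguments geodesic_line {R X}.

Section MetricConditions.
Context {R : realType} (X : metricType R).

Definition geodesic_space : Prop :=
  forall x y : X, exists c, geodesic_segment c x y.

Definition taut : Prop :=
  exists2 r : R, 0 <= r &
    forall x : X, exists2 c, geodesic_line c & exists t, mdist x (c t) <= r.

Definition proper_space : Prop :=
  forall (x : X) (r : R), compact [set y | mdist x y <= r].

Definition gromov_hyperbolic : Prop :=
  exists delta : R, forall o x y z : X,
    Num.min (gromov_product o x y) (gromov_product o y z) - delta
      <= gromov_product o x z.

(** A boundary point is an equivalence class of sequences converging at
    infinity; a sequence [u] of points of [X] converges in [X \cup \partial X]
    to the boundary point [p] exactly when [u] belongs to the class [p]. *)
Record boundary := Boundary {
  bclass : set (nat -> X);
  bclassP : exists2 u, converges_at_infinity u & bclass = gromov_class u }.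

Definition shadow (o : X) (p : boundary) (A : R) : set boundary :=
  [set q | exists u v, [/\ bclass p u, bclass q v &
     \forall i & j \near \oo, A <= gromov_product o (u i) (v j)]].

(** For hyperbolic [X] the sets [shadow o p A], [A -> +oo], form a
    neighbourhood basis at [p], for any [o]. *)
Definition boundary_open (U : set boundary) : Prop :=
  forall p, U p -> forall o, exists A, shadow o p A `<=` U.

Lemma shadow_le o p A B : A <= B -> shadow o p B `<=` shadow o p A.
Proof.
move=> AB q [u [v [pu qv H]]]; exists u, v; split=> //.
by apply: filterS H => -[i j] /=; apply: le_trans.
Qed.

Lemma boundary_openT : boundary_open setT.
Proof. by move=> p _ o; exists 0. Qed.

Lemma boundary_openI : setI_closed boundary_open.
Proof.
move=> U V oU oV p [Up Vp] o.
have [A AU] := oU p Up o; have [B BV] := oV p Vp o.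
exists (Num.max A B) => q Hq; split.
- by apply: AU; apply: shadow_le Hq; rewrite le_max lexx.
- by apply: BV; apply: shadow_le Hq; rewrite le_max lexx orbT.
Qed.

Lemma boundary_open_bigU (I : Type) (f : I -> set boundary) :
  (forall i, boundary_open (f i)) -> boundary_open (\bigcup_i f i).
Proof.
move=> fo p [i _ fip] o; have [A AU] := fo i p fip o.
by exists A => q /AU fiq; exists i.
Qed.

HB.instance Definition _ := gen_eqMixin boundary.
HB.instance Definition _ := gen_choiceMixin boundary.
HB.instance Definition _ := isOpenTopological.Build boundary
  boundary_openT boundary_openI boundary_open_bigU.

End MetricConditions.

Section Horoballs.
Context {R : realType} {X : metricType R}.

Definition ray_to (c : R -> X) (p : boundary X) : Prop :=
  geodesic_ray c /\ bclass p (fun n => c n%:R).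

Definition busemann (c : R -> X) (x : X) : R :=
  lim ((mdist x (c t) - t) @[t --> +oo]).

(** Horoballs are understood coarsely, as is usual in hyperbolic spaces, where
    horofunctions are only defined up to a bounded error: [B] is open and
    squeezed between two sublevel sets of a Busemann function based at [p].
    Exact sublevel sets are a special case. *)
Definition open_horoball (p : boundary X) (B : set X) : Prop :=
  open B /\ exists c (M : R), [/\ ray_to c p,
    [set x | busemann c x < - M] `<=` B & B `<=` [set x | busemann c x < M]].

End Horoballs.

Section Actions.
Context {G : groupType} {R : realType} {X : metricType R}.

Record isometric_action := IsometricAction {
  act :> G -> X -> X;
  act1 : forall x, act 1%g x = x;
  actM : forall g h x, act (g * h)%g x = act g (act h x);
  act_mdist : forall g x y, mdist (act g x) (act g y) = mdist x y }.

Variable a : isometric_action.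

Lemma actK g : cancel (a g) (a g^-1%g).
Proof. by move=> x; rewrite -actM mulVg act1. Qed.

Lemma actVK g : cancel (a g^-1%g) (a g).
Proof. by move=> x; rewrite -actM mulgV act1. Qed.

Lemma gromov_product_act g o x y :
  gromov_product o (a g x) (a g y) = gromov_product (a g^-1%g o) x y.
Proof. by rewrite /gromov_product -{1 2}[o](actVK g) !act_mdist. Qed.

Lemma diverging_product_act g u v : diverging_product u v ->
  diverging_product (a g \o u) (a g \o v).
Proof.
move=> uv o A; have := uv (a g^-1%g o) A.
by apply: filterS => -[i j] /=; rewrite gromov_product_act.
Qed.

Lemma bclass_act g (p : boundary X) :
  exists2 u, converges_at_infinity u &
    [set a g \o v | v in bclass p] = gromov_class u.
Proof.
have [u ui ->] := bclassP p; exists (a g \o u).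
  exact: diverging_product_act.
apply/seteqP; split=> [_ [v [vi uv] <-]|v [vi uv]].
  by split; apply: diverging_product_act.
have gK (w : nat -> X) : a g^-1%g \o (a g \o w) = w by apply/funext => n /=; rewrite actK.
exists (a g^-1%g \o v); last by apply/funext => n /=; rewrite actVK.
split; first exact: diverging_product_act.
by rewrite -(gK u); apply: diverging_product_act.
Qed.

Definition boundary_act (g : G) (p : boundary X) : boundary X :=
  Boundary (bclass_act g p).

Definition boundary_stab (p : boundary X) : set G :=
  [set g | boundary_act g p = p].

(** Convergence [gamma_n o -> p] in [X \cup \partial X]. *)
Definition tends_to (gamma : nat -> G) (p : boundary X) : Prop :=
  forall o : X, bclass p (fun n => a (gamma n) o).

Definition conical_limit_point (q : boundary X) : Prop :=
  exists gamma : nat -> G, exists b c : boundary X, [/\ b <> c,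
    boundary_act (gamma n) q @[n --> \oo] --> b &
    forall x, x <> q -> boundary_act (gamma n) x @[n --> \oo] --> c].

Definition loxodromic (g : G) : Prop :=
  injective (fun n : nat => (g ^+ n)%g) /\
  exists b c : boundary X, b <> c /\
    [set x | boundary_act g x = x] = [set b; c].

Definition bounded_parabolic_point (p : boundary X) : Prop :=
  [/\ infinite_set (boundary_stab p),
      forall g, boundary_stab p g -> ~ loxodromic g &
      exists2 K : set (boundary X), compact K &
        \bigcup_(g in boundary_stab p) (boundary_act g @` K) = ~` [set p]].

Record gromov_model (P : set (set G)) (B : set G -> set X) : Prop := {
  model_nonempty : [set: X] !=set0;
  model_geodesic : geodesic_space X;
  model_taut : taut X;
  model_proper : proper_space X;
  model_hyperbolic : gromov_hyperbolic X;
  model_properly_discontinuous : forall K : set X, compact K ->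
    finite_set [set g | (a g @` K) `&` K !=set0];
  model_horoball : forall Q, conjugates P Q ->
    exists p, open_horoball p (B Q);
  model_disjoint : forall Q Q', conjugates P Q -> conjugates P Q' ->
    Q <> Q' -> B Q `&` B Q' = set0;
  model_invariant : forall g Q, conjugates P Q ->
    exists2 Q', conjugates P Q' & a g @` B Q = B Q';
  model_stabilizer : forall Q, conjugates P Q ->
    [set g | a g @` B Q = B Q] = Q;
  model_cocompact : exists2 K : set X, compact K &
    \bigcup_g (a g @` K) = ~` \bigcup_(Q in conjugates P) B Q }.

End Actions.

Arguments isometric_action G {R} X.

Section Grassmannian.
Variables (K : numFieldType) (d : nat).

(** The disjoint union of all [Gr_k(K^d)], each with the quotient topology
    from the space of [d x k] matrices of rank [k]. *)
Definition grass : Type := {vspace 'cV[K]_d}.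

Definition column_space k (M : 'M[K]_(d, k)) : grass :=
  limg (linfun (mulmx M : 'cV[K]_k -> 'cV[K]_d)).

Definition grass_open (U : set grass) : Prop :=
  forall k (M : 'M[K]_(d, k)), \rank M = k -> U (column_space M) ->
    \forall N \near M, \rank N = k -> U (column_space N).

Lemma grass_openT : grass_open setT.
Proof. by move=> k M _ _; apply: filterS filterT. Qed.

Lemma grass_openI : setI_closed grass_open.
Proof.
move=> U V oU oV k M rM [UM VM].
apply: filterS (filterI (oU k M rM UM) (oV k M rM VM)) => N [UN VN] rN.
by split; [exact: UN | exact: VN].
Qed.

Lemma grass_open_bigU (I : Type) (f : I -> set grass) :
  (forall i, grass_open (f i)) -> grass_open (\bigcup_i f i).
Proof.
move=> fo k M rM [i _ fiM].
by apply: filterS (fo i k M rM fiM) => N fN rN; exists i => //; exact: fN.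
Qed.

HB.instance Definition _ := Choice.on grass.
HB.instance Definition _ := isOpenTopological.Build grass
  grass_openT grass_openI grass_open_bigU.

Definition flag_set (k : nat) : set (grass * grass) :=
  [set VW | [/\ \dim VW.1 = k, \dim VW.2 = (d - k)%N & (VW.1 <= VW.2)%VS]].

Definition flag (k : nat) : Type := set_type (flag_set k).

HB.instance Definition _ k := SubType.copy (flag k) (set_type (flag_set k)).
HB.instance Definition _ k := Topological.copy (flag k) (set_type (flag_set k)).

End Grassmannian.

Section Flags.
Context {K : numFieldType} {d k : nat}.
Implicit Types (g : 'M[K]_d) (x y : flag K d k).

Definition grass_act g (V : grass K d) : grass K d :=
  (linfun (mulmx g : 'cV[K]_d -> 'cV[K]_d) @: V)%VS.

(** For invertible [g] the translated pair is again a flag, and the default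
    value [x] of [insubd] is not used. *)
Definition flag_act g x : flag K d k :=
  insubd x (grass_act g (val x).1, grass_act g (val x).2).

Definition complementary (V W : grass K d) : Prop :=
  (V + W)%VS = fullv /\ (V :&: W)%VS = 0%VS.

Definition transverse x y : Prop :=
  complementary (val x).1 (val y).2 /\ complementary (val y).1 (val x).2.

Definition transverse_sets (A B : set (flag K d k)) : Prop :=
  forall x y, A x -> B y -> transverse x y.

End Flags.

Section SingularValues.
Context {K : numFieldType} {d : nat}.
Implicit Types (g : 'M[K]_d).

(** Complex conjugation on a subfield of the complex numbers, without a case
    distinction, see [conjK_real] and [conjK_complex]; [0^-1 = 0], so
    [conjK 0 = 0]. *)
Definition conjK (z : K) : K := `|z| ^+ 2 / z.

Definition conj_transpose g : 'M[K]_d := map_mx conjK g^T.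

Definition singular_values g : seq K :=
  xget [::] [set s | [/\ sorted >=%O s, all (>= 0) s &
    char_poly (g *m conj_transpose g) = \prod_(t <- s) ('X - (t ^+ 2)%:P)]].

(** Numbered from 1. *)
Definition sigma (i : nat) g : K := (singular_values g)`_i.-1.

(** If [sigma j g = sigma j.+1 g] this space has dimension larger than [j]. *)
Definition Uspace (j : nat) g : grass K d :=
  (\sum_(i < j) passmx.leigenspace
     (linfun (mulmx (g *m conj_transpose g) : 'cV[K]_d -> 'cV[K]_d))
     (sigma i.+1 g ^+ 2))%VS.

Definition Uflag (k : nat) g : grass K d * grass K d :=
  (Uspace k g, Uspace (d - k) g).

End SingularValues.

Lemma conjK_real (R : realType) (x : R) : conjK x = x.
Proof.
rewrite /conjK real_normK ?num_real//.
by have [->|x0] := eqVneq x 0; rewrite ?invr0 ?mulr0// expr2 mulfK.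
Qed.

Lemma conjK_complex (R : realType) (z : R[i]) : conjK z = conjc z.
Proof.
have [->|z0] := eqVneq z 0; first by rewrite /conjK invr0 mulr0 conjc0.
by rewrite /conjK sqr_normc mulrAC mulfV// mul1r.
Qed.

Definition real_or_complex (R : realType) (K : numFieldType) : Prop :=
  K = (R : numFieldType) \/ K = (R[i] : numFieldType).

Section Representations.
Context {G : groupType} {K : numFieldType} {d : nat}.
Variables (k : nat) (rho : G -> 'M[K]_d).

Definition SL_representation : Prop :=
  (forall g, \det (rho g) = 1) /\
  (forall g h, rho (g * h)%g = rho g *m rho h).

Definition divergent : Prop :=
  forall gamma : nat -> G, injective gamma ->
    sigma k (rho (gamma n)) / sigma k.+1 (rho (gamma n)) @[n --> \oo] --> +oo.

(** [x] is the limit of [(U_k, U_(d-k))(rho (gamma n))].  Since distinct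
    dimensions lie in different components of [grass], both terms have the
    right dimension for all large [n]. *)
Definition limit_flag (gamma : nat -> G) (x : flag K d k) : Prop :=
  Uflag k (rho (gamma n)) @[n --> \oo] --> val x.

Definition limit_set : set (flag K d k) :=
  [set x | exists2 gamma : nat -> G, injective gamma & limit_flag gamma x].

Context {R : realType} {X : metricType R}.
Variable a : isometric_action G X.

Definition fiber (Lambda : set (flag K d k)) (zeta : flag K d k -> boundary X)
    (p : boundary X) : set (flag K d k) :=
  Lambda `&` zeta @^-1` [set p].

(** [zeta] is a function on [Lambda]; its values elsewhere are irrelevant, and
    exist since [boundary X] is nonempty for a taut nonempty [X].  The flag
    space is compact and metrizable, hence so is its closed subset [Lambda]. *)
Record transverse_boundary_extension (Lambda : set (flag K d k))
    (zeta : flag K d k -> boundary X) : Prop := {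
  ext_closed : closed Lambda;
  ext_invariant : forall g x, Lambda x -> Lambda (flag_act (rho g) x);
  ext_continuous : {within Lambda, continuous zeta};
  ext_equivariant : forall g x, Lambda x ->
    zeta (flag_act (rho g) x) = boundary_act a g (zeta x);
  ext_surjective : zeta @` Lambda = setT;
  ext_transverse : forall p q, p <> q ->
    transverse_sets (fiber Lambda zeta p) (fiber Lambda zeta q) }.

Definition EGF_with (Lambda : set (flag K d k))
    (zeta : flag K d k -> boundary X) : Prop :=
  transverse_boundary_extension Lambda zeta /\
  exists C : boundary X -> set (flag K d k),
    [/\ forall p, open (C p),
        forall p, Lambda `\` fiber Lambda zeta p `<=` C p &
        forall (gamma : nat -> G) p q,
          tends_to a gamma p -> tends_to a (fun n => (gamma n)^-1%g) q ->
          forall L U : set (flag K d k), compact L -> L `<=` C q ->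
            open U -> fiber Lambda zeta p `<=` U ->
            \forall n \near \oo, flag_act (rho (gamma n)) @` L `<=` U].

Definition extended_geometrically_finite : Prop :=
  exists Lambda zeta, EGF_with Lambda zeta.

End Representations.

Arguments limit_set {G K d} k rho.

(* Main.v *)
(** Pass to subsequences so that [gamma_n -> p], [gamma_n^-1 -> q] and the
    Cartan flags of [rho gamma_n] and [rho gamma_n^-1] converge to [F+] and [F-].
    By the singular value decomposition, [rho gamma_n x -> F+] as soon as [x] is
    transverse to [F-], locally uniformly in [x].  Comparing with the given
    extension [zeta : Lambda -> boundary X] on a flag of the open set [C q]
    transverse to [F-] shows [F+ \in zeta^-1 p].  Hence [L(rho)] is contained in
    [Lambda], it meets every fibre, and the restriction of [zeta] to it is an
    extension: one may take for [C p] the flags transverse to all of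
    [L(rho) \cap zeta^-1 p].

    Over a conical point [q] the fibre is a singleton: a conical sequence [eta_n]
    at [q] keeps [eta_n x], for [x] over [q], uniformly transverse to the
    repelling flag of [eta_n^-1], and contracts it back to the attracting one.
    Over a parabolic point [p] with stabilizer [H], a sequence [gamma_n -> p] is
    written [gamma_n = h_n g_n] with [h_n] in [H] and [g_n] moving a chosen
    boundary point into a compact set avoiding [p]; if [g_n] tends to a point
    other than [p], the limits of [gamma_n] and [h_n] agree, and otherwise [p]
    is also conical, so its fibre is a singleton. *)
Require Import Defs.
From mathcomp Require Import all_boot all_order all_algebra.
From mathcomp Require Import all_classical all_reals.
From mathcomp Require Import topology normedtype sequences.
From mathcomp Require Import complex.
From mathcomp Require Import ring lra zify.

Set Implicit Arguments.
Unset Strict Implicit.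
Unset Printing Implicit Defensive.

Import Order.TTheory GRing.Theory Num.Theory.
Import numFieldTopology.Exports numFieldNormedType.Exports.

Local Open Scope classical_set_scope.
Local Open Scope ring_scope.

(** * Extraction of subsequences and sequential topology *)

Section Subsequences.

(** Every sequence of distinct elements is reduced by extraction to a [good_seq]: the limits on the
    boundary, the limit flags of the sequence and of its inverses, and the contraction towards the
    first flag all hold at once. Statements about full sequences follow by contradiction along
    subsequences. Limit flags of different sequences are compared through dynamics, not through
    singular vectors, which behave badly under products: a generic flag is transverse to all
    repelling flags involved, because transversality is open and dense, and its orbit identifies the
    limits.

    The map [zeta] is kept and only its domain shrinks. The given contraction property serves to
    place attracting flags in the right fibre; the obstacle there is that it controls neighbourhoods
    of a whole fibre, not of the limit flag.

    The definition of a conical point admits sequences with repeated elements, which leaves a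
    boundary of two points to be treated apart. Extraction on the boundary is done by lifting
    through [zeta] to the compact flag space. The dynamics on the boundary is derived from estimates
    on Gromov products. *)

Definition subsequence (phi : nat -> nat) := {homo phi : m n / (m < n)%N}.

Lemma subsequence_ltn phi : (forall n, (phi n < phi n.+1)%N) -> subsequence phi.
Proof. by move=> h; apply: (homo_ltn (r := fun m n => (m < n)%N)) => // ? ? ?; exact: ltn_trans. Qed.

Lemma subsequence_comp phi psi :
  subsequence phi -> subsequence psi -> subsequence (phi \o psi).
Proof. by move=> hphi hpsi m n mn; apply/hphi/hpsi. Qed.

Lemma subsequence_ge phi n : subsequence phi -> (n <= phi n)%N.
Proof.
move=> hphi; elim: n => // n IH.
by apply: leq_ltn_trans IH _; apply: hphi.
Qed.

Lemma subsequence_inj phi : subsequence phi -> injective phi.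
Proof.
move=> hphi m n mn; case: (ltngtP m n) => // /hphi; rewrite mn ltnn //.
Qed.

Lemma subsequence_cvg phi : subsequence phi -> phi n @[n --> \oo] --> \oo.
Proof.
move=> hphi A [N _ NA]; exists N => // n /= Nn; apply: NA => /=.
exact: leq_trans Nn (subsequence_ge n hphi).
Qed.

Lemma cvg_subsequence (T : topologicalType) (u : nat -> T) (x : T) phi :
  subsequence phi -> u n @[n --> \oo] --> x -> u (phi n) @[n --> \oo] --> x.
Proof. by move=> /subsequence_cvg hphi ux A nA; exact: (hphi _ (ux A nA)). Qed.

Lemma near_ooP (Q : nat -> Prop) :
  (\forall n \near \oo, Q n) <-> exists N, forall n, (N <= n)%N -> Q n.
Proof. by split=> [[N _ H]|[N H]]; exists N. Qed.

Lemma near2_ooP (Q : nat -> nat -> Prop) :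
  (\forall i & j \near \oo, Q i j) <->
  exists N, forall i j, (N <= i)%N -> (N <= j)%N -> Q i j.
Proof.
split=> [[[A B] /= [[N _ NA] [M _ MB]] H]|[N H]].
  exists (maxn N M) => i j; rewrite !geq_max => /andP[Ni _] /andP[_ Mj].
  by apply: (H (i, j)); split; [apply: NA|apply: MB].
exists ([set n | (N <= n)%N], [set n | (N <= n)%N]) => /=.
  by split; exists N.
by move=> -[i j] /= [Ni Nj]; apply: H.
Qed.

Lemma subsequence_choose (S : nat -> nat -> Prop) :
  (forall m N, exists2 n, (N <= n)%N & S m n) ->
  exists2 phi, subsequence phi & forall m, S m (phi m).
Proof.
move=> H.
have /choice[f fP] : forall mN : nat * nat, exists n, (mN.2 <= n)%N /\ S mN.1 n.
  by move=> [m N]; have [n ? ?] := H m N; exists n.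
pose phi := fix phi n := match n with
  | 0 => f (0, 0)%N | n'.+1 => f (n'.+1, (phi n').+1) end.
exists phi; last first.
  by case=> [|m]; [exact: (fP (0, 0)%N).2|exact: (fP (m.+1, (phi m).+1)).2].
apply: subsequence_ltn => n.
by have [] := fP (n.+1, (phi n).+1).
Qed.

Lemma not_near_subsequence (Q : nat -> Prop) :
  ~ (\forall n \near \oo, Q n) ->
  exists2 phi, subsequence phi & forall n, ~ Q (phi n).
Proof.
move=> nQ; apply: (@subsequence_choose (fun _ n => ~ Q n)) => _ N.
apply: contrapT => nN; apply: nQ; exists N => // n Nn.
by apply: contrapT => nQn; apply: nN; exists n.
Qed.

(** Divergence and the limit set speak of distinct elements, which sequences met below need not
    have. If no value recurs infinitely often, each is left for good, and a subsequence can skip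
    past the last return of all earlier values; [M m] bounds the returns of the values of index up
    to [m]. *)
Lemma const_or_injective (T : Type) (u : nat -> T) :
  (exists2 phi, subsequence phi & injective (u \o phi)) \/
  (exists phi c, subsequence phi /\ forall n, u (phi n) = c).
Proof.
have [[c Hc]|nc] := pselect (exists c, forall N, exists2 n, (N <= n)%N & u n = c).
  right; have [phi hphi phiP] := @subsequence_choose (fun _ n => u n = c) (fun _ => Hc).
  by exists phi, c.
left.
have {}nc (c : T) : exists N, forall n, (N <= n)%N -> u n <> c.
  apply: contrapT => nN; apply: nc; exists c => N; apply: contrapT => nn.
  by apply: nN; exists N => n Nn unc; apply: nn; exists n.
have /choice[M MP] : forall m, exists M, forall n i, (M <= n)%N -> (i <= m)%N -> u n <> u i.
  elim=> [|m [M MP]].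
    have [N NP] := nc (u 0%N); exists N => n i Nn; rewrite leqn0 => /eqP ->; exact: NP.
  have [N NP] := nc (u m.+1); exists (maxn M N) => n i.
  rewrite geq_max [(i <= _)%N]leq_eqVlt ltnS => /andP[Mn Nn] /orP[/eqP->|im]; first exact: NP.
  exact: MP.
pose phi := fix phi n := match n with
  | 0 => 0%N | n'.+1 => maxn (M (phi n')) (phi n').+1 end.
have hphi : subsequence phi.
  by apply: subsequence_ltn => n /=; rewrite leq_maxr.
exists phi => // m n; wlog mn : m n / (m < n)%N.
  by move=> W E; case: (ltngtP m n) => // h; [exact: W|apply/esym/W].
case: n mn => // n mn /= E; exfalso; apply: (MP (phi n) (phi n.+1) (phi m)) => //=.
  exact: leq_maxl.
have : (m <= n)%N by []. rewrite leq_eqVlt => /orP[/eqP->//|/hphi/ltnW//].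
Qed.

(** Stated for a choice of one point in each [B n]: a decreasing countable basis satisfies this, and
    extractions use it in this form. *)
Definition first_countable (T : topologicalType) := forall x : T,
  exists2 B : nat -> set T, (forall n, nbhs x (B n)) &
    forall y : nat -> T, (forall n, B n (y n)) -> y n @[n --> \oo] --> x.

Variable T : topologicalType.
Hypothesis fcT : first_countable T.

Lemma seq_closed (A : set T) :
  (forall (y : nat -> T) x, (forall n, A (y n)) -> y n @[n --> \oo] --> x -> A x) -> closed A.
Proof.
move=> H x clx; have [B nB BP] := fcT x.
have /choice[y yP] : forall n, exists y, A y /\ B n y by move=> n; exact: clx.
apply: (H y) => [n|]; first by have [] := yP n.
by apply: BP => n; have [] := yP n.
Qed.

Lemma compact_subsequence (A : set T) (y : nat -> T) :
  compact A -> (forall n, A (y n)) ->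
  exists phi x, [/\ subsequence phi, A x & y (phi n) @[n --> \oo] --> x].
Proof.
move=> cA Ay.
have [|x [Ax clx]] := cA (y @ \oo) _; first by exists 0%N => // n _; exact: Ay.
have [B nB BP] := fcT x.
have [|phi hphi phiP] := @subsequence_choose (fun m n => B m (y n)).
  move=> m N; have [|_ [[n Nn <-] Bn]] := clx (y @` [set n | (N <= n)%N]) (B m) _ (nB m).
    by exists N => // n Nn; exists n.
  by exists n.
by exists phi, x; split=> //; exact: BP.
Qed.

End Subsequences.

(** A point of the closure outside the range has a neighbourhood missing the finitely many early
    terms, so it cannot be separated from [l]. The complement of such a set is the open test set in
    [attract_in_fiber]. *)
Lemma closed_cvg_range (T : topologicalType) (y : nat -> T) (l : T) :
  hausdorff_space T -> y n @[n --> \oo] --> l -> closed (range y `|` [set l]).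
Proof.
move=> hT yl w clw; have [//|wS] := pselect ((range y `|` [set l]) w).
right; apply: (hT) => A A' nA nA'; have [M _ MA'] := yl _ nA'.
have ne : \forall v \near w, forall i : 'I_M, v <> y i.
  apply: filter_forall => i; apply: open_nbhs_nbhs; split.
    by apply: closed_openC; exact: (accessible_closed_set1 (hausdorff_accessible hT)).
  by move=> wy; apply: wS; left; exists i.
have [v [Sv [Av vy]]] := clw _ (filterI nA ne).
exists v; split=> //; case: Sv => [[n _ ynv]|->]; last exact: nbhs_singleton.
rewrite -ynv; apply: MA' => /=; rewrite leqNgt; apply/negP => nM.
exact: vy (Ordinal nM) (esym ynv).
Qed.

Lemma pseudometric_first_countable (K : numFieldType) (T : pseudoMetricType K) :
  (forall e : K, 0 < e -> exists n : nat, n.+1%:R^-1 < e) -> first_countable T.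
Proof.
move=> arch x; exists (fun n => ball x n.+1%:R^-1).
  by move=> n; apply: nbhsx_ballx; rewrite invr_gt0.
move=> y yP; apply/cvg_ballP => e e0; have [N Ne] := arch e e0.
exists N => // n /= Nn; apply: le_ball (yP n); apply: le_trans _ (ltW Ne).
by rewrite lef_pV2 ?posrE// ler_nat.
Qed.

Lemma archimedean_inv (R : archiNumFieldType) (e : R) :
  0 < e -> exists n : nat, n.+1%:R^-1 < e.
Proof.
move=> e0; exists (Num.bound e^-1).
rewrite -[ltRHS]invrK ltf_pV2 ?posrE ?invr_gt0//.
have := archi_boundP (ltW (_ : 0 < e^-1)); rewrite invr_gt0 => /(_ e0) H.
by apply: lt_trans H _; rewrite ltr_nat.
Qed.

(** * The Gromov product and the boundary *)

Section GromovProduct.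
Context {R : realType} {X : metricType R}.
Implicit Types (o x y z : X) (u v w : nat -> X) (p q : boundary X).

Lemma gromov_productC o x y : gromov_product o x y = gromov_product o y x.
Proof. by rewrite /gromov_product addrAC (metric_sym x y) addrAC [X in X - _]addrC. Qed.

Lemma gromov_product_base o o' x y :
  gromov_product o x y <= gromov_product o' x y + mdist o o'.
Proof.
have := metric_triangle o o' x; have := metric_triangle o o' y.
by rewrite /gromov_product; lra.
Qed.

Lemma gromov_product_near o x y x' y' :
  gromov_product o x y <= gromov_product o x' y' + mdist x x' + mdist y y'.
Proof.
have := metric_triangle o x' x; have := metric_triangle o y' y.
have := metric_triangle x' x y'; have := metric_triangle x y y'.
rewrite (metric_sym x' x) (metric_sym y' y).
by rewrite /gromov_product; lra.
Qed.

Lemma gromov_product_split o x y :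
  gromov_product x o y + gromov_product o x y = mdist o x.
Proof.
rewrite /gromov_product (metric_sym x o).
by have ->: forall a b c : R, (a + b - c) / 2 + (a + c - b) / 2 = a by move=> *; lra.
Qed.

Lemma gromov_productxx o x : gromov_product o x x = mdist o x.
Proof. by rewrite /gromov_product mdistxx; lra. Qed.

Lemma diverging_productP o u v : diverging_product u v <->
  forall A, exists N, forall i j, (N <= i)%N -> (N <= j)%N ->
    A <= gromov_product o (u i) (v j).
Proof.
split=> [uv A|H o' A]; first exact/near2_ooP/uv.
apply/near2_ooP; have [N NP] := H (A + mdist o o'); exists N => i j Ni Nj.
by have := NP i j Ni Nj; have := gromov_product_base o o' (u i) (v j); lra.
Qed.

Lemma diverging_productC u v : diverging_product u v -> diverging_product v u.
Proof.
move=> uv; apply/(diverging_productP (u 0%N)) => A.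
have [N NP] := (diverging_productP (u 0%N) _ _).1 uv A.
by exists N => i j Ni Nj; rewrite gromov_productC; exact: NP.
Qed.

Lemma diverging_product_subsequence u v phi psi :
  subsequence phi -> subsequence psi ->
  diverging_product u v -> diverging_product (u \o phi) (v \o psi).
Proof.
move=> hphi hpsi uv; apply/(diverging_productP (u 0%N)) => A.
have [N NP] := (diverging_productP (u 0%N) _ _).1 uv A.
exists N => i j Ni Nj; apply: NP.
  exact: leq_trans Ni (subsequence_ge _ hphi).
exact: leq_trans Nj (subsequence_ge _ hpsi).
Qed.

Lemma diverging_product_near u v u' v' (C : R) :
  (forall n, mdist (u n) (u' n) <= C) -> (forall n, mdist (v n) (v' n) <= C) ->
  diverging_product u v -> diverging_product u' v'.
Proof.
move=> uu' vv' uv; apply/(diverging_productP (u 0%N)) => A.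
have [N NP] := (diverging_productP (u 0%N) _ _).1 uv (A + C + C).
exists N => i j Ni Nj; have := NP i j Ni Nj; have := uu' i; have := vv' j.
by have := gromov_product_near (u 0%N) (u i) (v j) (u' i) (v' j); lra.
Qed.

Lemma bclass_convergent p u : bclass p u -> converges_at_infinity u.
Proof. by have [v _ ->] := bclassP p => -[]. Qed.

Lemma bclass_nonempty p : exists u, bclass p u.
Proof. by have [u cu pE] := bclassP p; exists u; rewrite pE. Qed.

Lemma bclass_ex u : converges_at_infinity u -> exists p : boundary X, bclass p u.
Proof.
move=> cu; exists (Boundary (ex_intro2 _ _ u cu (erefl (gromov_class u)))).
by split.
Qed.

Lemma bclass_subsequence p u phi : subsequence phi -> bclass p u -> bclass p (u \o phi).
Proof.
have [v cv ->] := bclassP p => hphi [cu vu].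
split; first exact: diverging_product_subsequence cu.
exact: (@diverging_product_subsequence v u id).
Qed.

Lemma bclass_near p u u' (C : R) :
  (forall n, mdist (u n) (u' n) <= C) -> bclass p u -> bclass p u'.
Proof.
have [v cv ->] := bclassP p => uu' [cu vu].
have C0 : 0 <= C by exact: le_trans (mdist_ge0 _ _) (uu' 0%N).
split; first exact: diverging_product_near cu.
by apply: diverging_product_near vu => // n; rewrite mdistxx.
Qed.

Lemma bclass_dist p u o (A : R) : bclass p u ->
  exists N, forall n, (N <= n)%N -> A <= mdist o (u n).
Proof.
move=> /bclass_convergent /(diverging_productP o)/(_ A)[N NP].
by exists N => n Nn; rewrite -gromov_productxx NP.
Qed.

Lemma boundary_ext p q : bclass p = bclass q -> p = q.
Proof.
by case: p q => [P hP] [Q hQ] /= E; rewrite E in hP *; congr Boundary; exact: Prop_irrelevance.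
Qed.

Section Hyperbolic.
Variable delta : R.
Hypothesis hyp : forall o x y z : X,
  Num.min (gromov_product o x y) (gromov_product o y z) - delta
    <= gromov_product o x z.

Lemma hyperbolic_ge o x y z (A : R) : A <= gromov_product o x y ->
  A <= gromov_product o y z -> A - delta <= gromov_product o x z.
Proof.
move=> xy yz; apply: le_trans (hyp o x y z); rewrite lerD2r.
by rewrite le_min xy.
Qed.

Lemma hyperbolic_or o x y z :
  gromov_product o x y - delta <= gromov_product o x z \/
  gromov_product o y z - delta <= gromov_product o x z.
Proof. by have := hyp o x y z; rewrite minEle; case: ifP; [left|right]. Qed.

Lemma hyperbolic_delta_ge0 o : 0 <= delta.
Proof.
have := hyp o o o o; rewrite gromov_productxx mdistxx minxx; lra.
Qed.

Lemma diverging_product_trans u v w :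
  diverging_product u v -> diverging_product v w -> diverging_product u w.
Proof.
move=> uv vw; apply/(diverging_productP (u 0%N)) => A.
have [N NP] := (diverging_productP (u 0%N) _ _).1 uv (A + delta).
have [M MP] := (diverging_productP (u 0%N) _ _).1 vw (A + delta).
exists (maxn N M) => i j; rewrite !geq_max => /andP[Ni _] /andP[_ Mj].
have := @hyperbolic_ge (u 0%N) (u i) (v (maxn N M)) (w j) (A + delta).
rewrite addrK; apply; first by apply: NP => //; rewrite leq_maxl.
by apply: MP => //; rewrite leq_maxr.
Qed.

Lemma bclass_diverging p u v : bclass p u -> bclass p v -> diverging_product u v.
Proof.
have [w cw ->] := bclassP p => -[cu wu] [cv wv].
exact: diverging_product_trans (diverging_productC wu) wv.
Qed.

Lemma diverging_bclass p u v : bclass p u -> diverging_product u v -> bclass p v.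
Proof.
have [w cw ->] := bclassP p => -[cu wu] uv; split; last exact: diverging_product_trans uv.
exact: diverging_product_trans (diverging_productC uv) uv.
Qed.

Lemma boundary_eq p q u v :
  bclass p u -> bclass q v -> diverging_product u v -> p = q.
Proof.
move=> pu qv uv; apply: boundary_ext; apply/seteqP; split=> w hw.
  apply: diverging_bclass qv _.
  exact: diverging_product_trans (diverging_productC uv) (bclass_diverging pu hw).
apply: diverging_bclass pu _.
exact: diverging_product_trans uv (bclass_diverging qv hw).
Qed.

Lemma boundary_eq1 p q u : bclass p u -> bclass q u -> p = q.
Proof. by move=> pu qu; exact: boundary_eq pu qu (bclass_convergent pu). Qed.

(** One large product of terms with large indices propagates, by two uses of hyperbolicity, to all
    tail products at the cost of [2 delta]. Unbounded products would therefore diverge and identify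
    the two points. *)
Lemma boundary_neq p q u v o : p <> q -> bclass p u -> bclass q v ->
  exists A N, forall i j, (N <= i)%N -> (N <= j)%N -> gromov_product o (u i) (v j) <= A.
Proof.
move=> pq pu qv; apply: contrapT => H; apply: pq; apply: (boundary_eq pu qv).
apply/(diverging_productP o) => A.
have [N NP] := (diverging_productP o _ _).1 (bclass_convergent pu) (A + delta + delta).
have [M MP] := (diverging_productP o _ _).1 (bclass_convergent qv) (A + delta + delta).
exists (maxn N M) => i j; rewrite !geq_max => /andP[Ni _] /andP[_ Mj].
apply: contrapT => nA; apply: H; exists (A + delta + delta), (maxn N M) => m n.
rewrite !geq_max => /andP[Nm _] /andP[_ Mn].
rewrite leNgt; apply/negP => big; apply: nA.
have h1 : A + delta <= gromov_product o (u i) (v n).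
  rewrite -[leLHS](addrK delta); apply: (hyperbolic_ge (NP i m Ni Nm)); exact: ltW.
rewrite -[leLHS](addrK delta); apply: (hyperbolic_ge h1).
have := MP n j Mn Mj; have := hyperbolic_delta_ge0 o; lra.
Qed.

(** A shadow contains an open neighbourhood of its base point: the interior of
    a set consists of the points having a shadow in it. *)
Lemma shadow_nbhs o p A : nbhs p (shadow o p A).
Proof.
pose U := [set q | exists B, shadow o q B `<=` shadow o p A].
have d0 := hyperbolic_delta_ge0 o.
have shadow_trans q q' B : shadow o q (B + delta + delta) q' ->
    shadow o q' (B + delta + delta) `<=` shadow o q B.
  move=> [u [v [qu q'v /near2_ooP[N NP]]]] r [v' [w [q'v' rw /near2_ooP[M MP]]]].
  exists u, w; split=> //; apply/near2_ooP.
  have [L LP] := (diverging_productP o _ _).1 (bclass_diverging q'v q'v') (B + delta + delta).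
  exists (maxn N (maxn M L)) => i j; rewrite !geq_max => /and3P[Ni Mi Li] /and3P[Nj Mj Lj].
  have h1 : B + delta <= gromov_product o (u i) (v' i).
    rewrite -[leLHS](addrK delta); apply: (hyperbolic_ge (y := v i)); last exact: LP.
    exact: NP.
  rewrite -[leLHS](addrK delta); apply: (hyperbolic_ge h1).
  by have := MP i j Mi Mj; lra.
have base q B : shadow o q B q.
  have [u qu] := bclass_nonempty q; exists u, u; split=> //.
  exact: (bclass_convergent qu).
rewrite nbhsE; exists U; last first.
  by move=> q [B]; apply; exact: base.
split; last by exists A.
move=> q [B BA] o'; exists (B + delta + delta + mdist o' o).
move=> q' [u [v [qu q'v /near2_ooP[N NP]]]]; exists (B + delta + delta).
apply: subset_trans BA; apply: shadow_trans.
exists u, v; split=> //; apply/near2_ooP; exists N => i j Ni Nj.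
have := NP i j Ni Nj; have := gromov_product_base o' o (u i) (v j); lra.
Qed.

Lemma cvg_boundary o (q_ : nat -> boundary X) q :
  (forall A, exists N, forall n, (N <= n)%N -> shadow o q A (q_ n)) ->
  q_ n @[n --> \oo] --> q.
Proof.
move=> H U; rewrite /= nbhsE => -[V [oV Vq] VU].
have [A AV] := oV q Vq o; have [N NP] := H A.
by exists N => // n Nn; apply/VU/AV/NP.
Qed.

Lemma boundary_hausdorff : hausdorff_space (boundary X).
Proof.
move=> p q pq; have [u pu] := bclass_nonempty p; have [v qv] := bclass_nonempty q.
pose o := u 0%N; apply: (boundary_eq pu qv); apply/(diverging_productP o) => A.
have d0 := hyperbolic_delta_ge0 o.
(* Five large products link [u], [u'], [w], [w'], [v'], [v]; joining them costs [delta] four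
   times. *)
pose B := A + delta *+ 4.
have [r [[u' [w [pu' rw /near2_ooP[N NP]]]] [v' [w' [qv' rw' /near2_ooP[M MP]]]]]] :=
  pq _ _ (shadow_nbhs o p B) (shadow_nbhs o q B).
have [L1 LP1] := (diverging_productP o _ _).1 (bclass_diverging pu pu') B.
have [L2 LP2] := (diverging_productP o _ _).1 (bclass_diverging rw rw') B.
have [L3 LP3] := (diverging_productP o _ _).1 (bclass_diverging qv' qv) B.
pose m := maxn (maxn N M) (maxn L1 (maxn L2 L3)).
have [Nm Mm L1m L2m L3m] : [/\ N <= m, M <= m, L1 <= m, L2 <= m & L3 <= m]%N.
  by split; rewrite /m; lia.
exists m => i j mi mj.
have h1 : B - delta <= gromov_product o (u i) (w m).
  by apply: (hyperbolic_ge (y := u' m)); [apply: LP1 => //; exact: leq_trans mi|exact: NP].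
have h2 : B - delta - delta <= gromov_product o (u i) (w' m).
  by apply: (hyperbolic_ge h1); have := LP2 m m L2m L2m; lra.
have h3 : B - delta - delta - delta <= gromov_product o (u i) (v' m).
  by apply: (hyperbolic_ge h2); rewrite gromov_productC; have := MP m m Mm Mm; lra.
have -> : A = B - delta - delta - delta - delta by rewrite /B; lra.
by apply: (hyperbolic_ge h3); have := LP3 m j L3m (leq_trans L3m mj); lra.
Qed.

End Hyperbolic.
End GromovProduct.

(** * Sequences going to infinity in proper geodesic spaces *)

Lemma fmap_ultra (S T : Type) (f : S -> T) (F : set_system S) :
  UltraFilter F -> UltraFilter (f @ F).
Proof.
move=> UF; split=> [|H PH FH]; first exact: fmap_proper_filter.
apply/seteqP; split=> // A HA; have [//|FA] := in_ultra_setVsetC (f @^-1` A) UF.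
have /FH HnA : (f @ F) (~` A) by [].
by have [x [Ax nAx]] := filter_ex (filterI HA HnA).
Qed.

Lemma exists_natr_ge (R : archiRealDomainType) (A : R) : exists N : nat, A <= N%:R.
Proof.
exists (Num.bound `|A|); apply: le_trans (ler_norm A) (ltW _).
by have := archi_boundP (normr_ge0 A).
Qed.

Section ProperSpace.
Context {R : realType} {X : metricType R}.
Implicit Types (o x y : X) (u : nat -> X).

Lemma metric_first_countable : first_countable X.
Proof. by apply: pseudometric_first_countable => e; exact: archimedean_inv. Qed.

(** Geodesics from [o] to [u n] subconverge at every integer distance from [o]
    along an ultrafilter; [u] is extracted accordingly. *)
Lemma diverging_subsequence o u : geodesic_space X -> proper_space X ->
  (forall A : R, exists N, forall n, (N <= n)%N -> A <= mdist o (u n)) ->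
  exists2 phi, subsequence phi & exists p : boundary X, bclass p (u \o phi).
Proof.
move=> geo prop du.
have /choice[c cP] n : exists c, geodesic_segment c o (u n) by exact: geo.
have [F [UF oF]] := @ultraFilterLemma nat \oo _.
have near_c (m : nat) : \forall n \near \oo, m%:R <= mdist o (u n).
  by apply/near_ooP; exact: du.
have ycvg (m : nat) : exists y : X, (fun n => c n m%:R) @ F --> y.
  have := prop o m%:R; rewrite compact_ultra => /(_ ((fun n => c n m%:R) @ F))[].
    exact: fmap_ultra.
    have := oF _ (near_c m); apply: (@filterS nat F _ [set n | _]) => n /= mn.
    have [c0 _ geoc] := cP n; rewrite -{1}c0 geoc ?sub0r ?normrN ?ger0_norm//=.
    - by rewrite lexx mdist_ge0.
    - by rewrite ler0n.
  by move=> y [_ cy]; exists y.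
have [y yP] := choice ycvg.
have FS (m : nat) : F [set n | forall l : nat, (l <= m)%N ->
    l%:R <= mdist o (u n) /\ mdist (y l) (c n l%:R) < 2^-1].
  have near_y l : F [set n | l%:R <= mdist o (u n) /\ mdist (y l) (c n l%:R) < 2^-1].
    have h : F [set n | ball (y l) 2^-1 (c n l%:R)].
      by apply: (yP l); apply: nbhsx_ballx; rewrite invr_gt0.
    apply: filterS (filterI (oF _ (near_c l)) h) => n [n1 n2].
    by split=> //; move: n2; rewrite ballEmdist.
  elim: m => [|m IH].
    by apply: filterS (near_y 0%N) => n nP l; rewrite leqn0 => /eqP ->.
  apply: filterS (filterI IH (near_y m.+1)) => n [n0 n1] l.
  by rewrite leq_eqVlt ltnS => /orP[/eqP ->|/n0].
have [|phi hphi phiP] := @subsequence_choose (fun m n => forall l : nat, (l <= m)%N ->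
    l%:R <= mdist o (u n) /\ mdist (y l) (c n l%:R) < 2^-1).
  move=> m N; have FN : F [set n | (N <= n)%N] by apply: oF; exists N.
  by have [n [n1 n2]] := filter_ex (filterI FN (FS m)); exists n.
exists phi => //; apply: bclass_ex; apply/(diverging_productP o) => A.
(* At distance [N] from [o] both geodesics are within 1/2 of [y N], hence within 1 of each other, so
   the product of their endpoints is at least [N - 1/2]. *)
have [N AN] : exists N : nat, A <= N%:R - 2^-1.
  by have [N NP] := exists_natr_ge (A + 2^-1); exists N; rewrite lerBrDr.
exists N => i j Ni Nj /=; apply: (le_trans AN).
have [oi yi] := phiP i N Ni; have [oj yj] := phiP j N Nj.
have dist_c n : N%:R <= mdist o (u n) -> mdist (c n N%:R) (u n) = mdist o (u n) - N%:R.
  move=> Nn; have [_ c1 geoc] := cP n; rewrite -{1}c1 geoc /=.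
  - by rewrite distrC ger0_norm// subr_ge0.
  - by rewrite ler0n.
  - by rewrite mdist_ge0 lexx.
have := dist_c _ oi; have := dist_c _ oj; move: yi yj.
set ci := c _ _; set cj := c _ _; set uj := u _; set ui := u _ => yi yj ej ei.
have := metric_triangle ui ci uj; have := metric_triangle ci cj uj.
have := metric_triangle ci (y N) cj.
rewrite /gromov_product (metric_sym ui ci) (metric_sym ci (y N)) ei ej.
lra.
Qed.

(** The two ends of a geodesic line differ: seen from [c 0], the product of [c n] and [c (- n)] is
    0. *)
Lemma taut_boundary (delta : R) :
  (forall o x y z : X, Num.min (gromov_product o x y) (gromov_product o y z) - delta
    <= gromov_product o x z) ->
  [set: X] !=set0 -> taut X -> exists p q : boundary X, p <> q.
Proof.
move=> hyp [x _] [r r0 /(_ x)[c cl _]].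
have ray (e : R) : `|e| = 1 ->
    converges_at_infinity (fun n : nat => c (e * n%:R)).
  move=> e1; apply/(diverging_productP (c 0)) => A; have [N AN] := exists_natr_ge A.
  exists N => i j Ni Nj; have {}Ni : A <= i%:R by rewrite (le_trans AN)// ler_nat.
  have {}Nj : A <= j%:R by rewrite (le_trans AN)// ler_nat.
  rewrite /gromov_product !cl// -mulrBr !sub0r !normrN !normrM e1 !mul1r !normr_nat.
  case: (lerP 0 (i%:R - j%:R : R)) => h; [rewrite ger0_norm|rewrite ltr0_norm] => //; lra.
have [p pP] := bclass_ex (ray 1 (normr1 _)).
have [q qP] := bclass_ex (ray (-1) (etrans (normrN 1) (normr1 _))).
exists p, q => pq; rewrite -{}pq in qP.
have := (diverging_productP (c 0) _ _).1 (bclass_diverging hyp pP qP) 1.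
move=> [N /(_ N N (leqnn _) (leqnn _))].
rewrite /gromov_product !cl// !mul1r !mulN1r !sub0r !opprK normrN.
rewrite -natrD !normr_nat natrD; lra.
Qed.

End ProperSpace.

(** * Convergence dynamics of isometric actions *)

Section Dynamics.
Context {G : groupType} {R : realType} {X : metricType R}.
Variable a : isometric_action G X.
Implicit Types (o x y : X) (p q r s : boundary X) (g h : G) (gamma : nat -> G).

Lemma bclass_boundary_act g p u : bclass p u -> bclass (boundary_act a g p) (a g \o u).
Proof. by move=> pu; exists u. Qed.

Lemma boundary_act1 p : boundary_act a 1%g p = p.
Proof.
apply: boundary_ext => /=; apply/seteqP; split=> [_ [u pu <-]|u pu].
  by have -> : a 1%g \o u = u by apply/funext => n /=; rewrite act1.
by exists u => //; apply/funext => n /=; rewrite act1.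
Qed.

Lemma boundary_actM g h p :
  boundary_act a (g * h)%g p = boundary_act a g (boundary_act a h p).
Proof.
apply: boundary_ext => /=; apply/seteqP; split=> [_ [u pu <-]|_ [_ [u pu <-] <-]].
  by exists (a h \o u); [exists u|apply/funext => n /=; rewrite actM].
by exists u => //; apply/funext => n /=; rewrite actM.
Qed.

Lemma boundary_actK g : cancel (boundary_act a g) (boundary_act a g^-1%g).
Proof. by move=> p; rewrite -boundary_actM mulVg boundary_act1. Qed.

Lemma boundary_stabV p g : boundary_stab a p g -> boundary_stab a p g^-1%g.
Proof. by move=> gp; rewrite /boundary_stab /= -{1}gp boundary_actK. Qed.

Lemma tends_toP o gamma p :
  tends_to a gamma p <-> bclass p (fun n => a (gamma n) o).
Proof.
split=> [|H o']; first exact.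
by apply: bclass_near H => n; rewrite act_mdist; exact: lexx.
Qed.

Lemma tends_to_subsequence gamma p phi :
  subsequence phi -> tends_to a gamma p -> tends_to a (gamma \o phi) p.
Proof. by move=> hphi H o; apply: (bclass_subsequence hphi (H o)). Qed.

Lemma tends_to_mull g gamma p :
  tends_to a gamma p -> tends_to a (fun n => g * gamma n)%g (boundary_act a g p).
Proof.
move=> H o; have := bclass_boundary_act g (H o).
by congr (bclass _ _); apply/funext => n /=; rewrite actM.
Qed.

Lemma tends_to_mulr g gamma p :
  tends_to a gamma p -> tends_to a (fun n => gamma n * g)%g p.
Proof.
move=> H o; have := H (a g o).
by congr (bclass _ _); apply/funext => n /=; rewrite actM.
Qed.

Lemma tends_to_dist gamma p o (A : R) : tends_to a gamma p ->
  exists N, forall n, (N <= n)%N -> A <= mdist o (a (gamma n) o).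
Proof. by move=> /(_ o)/bclass_dist; exact. Qed.

Lemma tends_to_nonconst gamma p g : tends_to a gamma p -> ~ (forall n, gamma n = g).
Proof.
move=> H E; have [u _] := bclass_nonempty p; pose o := u 0%N.
have [N /(_ N (leqnn N))] := tends_to_dist o (mdist o (a g o) + 1) H.
by rewrite E; lra.
Qed.

Lemma tends_to_injective gamma p : tends_to a gamma p ->
  exists2 phi, subsequence phi & injective (gamma \o phi).
Proof.
move=> H; have [//|[phi [g [hphi E]]]] := const_or_injective gamma.
by have /tends_to_nonconst/(_ E) := tends_to_subsequence hphi H.
Qed.

Section Hyperbolic.
Variable delta : R.
Hypothesis hyp : forall o x y z : X,
  Num.min (gromov_product o x y) (gromov_product o y z) - delta
    <= gromov_product o x z.

Lemma tends_to_uniq gamma p q : tends_to a gamma p -> tends_to a gamma q -> p = q.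
Proof.
move=> Hp Hq; have [u _] := bclass_nonempty p.
exact: (boundary_eq1 hyp (Hp (u 0%N)) (Hq (u 0%N))).
Qed.

Lemma cvg_boundary_uniq (q_ : nat -> boundary X) p q :
  q_ n @[n --> \oo] --> p -> q_ n @[n --> \oo] --> q -> p = q.
Proof. exact: (cvg_unique (boundary_hausdorff hyp)). Qed.

(** Translating by the inverse, the product of [gamma_n o] and [gamma_n u_i] at [o] is that of [o]
    and [u_i] at [gamma_n^-1 o]. By [gromov_product_split] it equals the distance from [o] to
    [gamma_n^-1 o], which tends to infinity, minus a product that stays bounded because [z <> s]. *)
Lemma convergence_dynamics gamma c s (z : boundary X) :
  tends_to a gamma c -> tends_to a (fun n => (gamma n)^-1%g) s -> z <> s ->
  boundary_act a (gamma n) z @[n --> \oo] --> c.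
Proof.
move=> gc gs zs; have [u zu] := bclass_nonempty z; pose o := u 0%N.
apply: (@cvg_boundary _ _ o) => A.
have [B [N1 NP1]] := boundary_neq hyp o (nesym zs) (gs o) zu.
have [N2 NP2] := tends_to_dist o (B + A + delta) gs.
have [N3 NP3] := (diverging_productP o _ _).1 (bclass_convergent (gc o)) (A + delta).
exists (maxn N1 (maxn N2 N3)) => n; rewrite !geq_max => /and3P[n1 n2 n3].
exists (fun m => a (gamma m) o), (a (gamma n) \o u).
split; [exact: gc|exact: bclass_boundary_act|].
apply/near2_ooP; exists (maxn N1 N3) => m i; rewrite !geq_max => /andP[m1 m3] /andP[i1 i3].
rewrite -[A](addrK delta); apply: (hyperbolic_ge hyp (NP3 m n m3 n3)).
rewrite gromov_product_act.
have := NP1 n i n1 i1; have := NP2 n n2.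
have := gromov_product_split o (a (gamma n)^-1%g o) (u i).
lra.
Qed.

Section ProperlyDiscontinuous.
Hypotheses (geo : geodesic_space X) (prop : proper_space X).
Hypothesis disc : forall K : set X, compact K ->
  finite_set [set g | (a g @` K) `&` K !=set0].

Lemma injective_dist gamma o (A : R) : injective gamma ->
  exists N, forall n, (N <= n)%N -> A <= mdist o (a (gamma n) o).
Proof.
move=> ginj; apply: contrapT => H.
have [|phi hphi phiP] := @not_near_subsequence (fun n => A <= mdist o (a (gamma n) o)).
  by move/near_ooP.
apply: infinite_nat.
have -> : [set: nat] = (gamma \o phi) @^-1`
    [set g | (a g @` [set y | mdist o y <= A]) `&` [set y | mdist o y <= A] !=set0].
  apply/esym; rewrite -subTset => n _ /=; have /negP := phiP n; rewrite -ltNge => nA.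
  exists (a (gamma (phi n)) o); split; last exact: ltW.
  by exists o => //=; rewrite mdistxx; apply: le_trans (ltW nA); exact: mdist_ge0.
apply: finite_preimage; first by move=> m n _ _ /ginj/subsequence_inj; exact.
exact: (disc (@prop o A)).
Qed.

Lemma injective_tends_to o gamma : injective gamma ->
  exists2 phi, subsequence phi & exists p, tends_to a (gamma \o phi) p.
Proof.
move=> ginj; have [phi hphi [p pP]] := diverging_subsequence geo prop
  (fun A => injective_dist o A ginj).
by exists phi => //; exists p; apply/(tends_toP o).
Qed.

(** With [A] a bound for the Gromov product of [g o] and [p], the estimate
    [(g^m o | p)_o <= A + 2 delta] propagates to all [m]: the orbit of [o] is
    then a quasi-geodesic which stays away from [p]. *)
Lemma stab_orbit_away o g p (A : R) :
  boundary_act a g p = p ->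
  (forall v, bclass p v -> exists N, forall i, (N <= i)%N ->
     gromov_product o (a g o) (v i) <= A) ->
  A + A + delta *+ 8 + 1 <= mdist o (a g o) ->
  forall m : nat,
    (forall v, bclass p v -> exists N, forall i, (N <= i)%N ->
       gromov_product o (a (g ^+ m.+1)%g o) (v i) <= A + delta) /\
    mdist o (a (g ^+ m)%g o) + 1 <= mdist o (a (g ^+ m.+1)%g o).
Proof.
move=> gp Ag D; have d0 := hyperbolic_delta_ge0 hyp o.
have A0 : 0 <= A.
  have [v pv] := bclass_nonempty p; have [N /(_ N (leqnn N))] := Ag v pv.
  by apply: le_trans; have := metric_triangle (a g o) o (v N); rewrite /gromov_product (metric_sym (a g o) o); lra.
elim=> [|m [IH1 IH2]].
  rewrite expg1 expg0 act1 mdistxx; split; last by lra.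
  by move=> v /Ag[N NP]; exists N => i /NP; lra.
have step v : bclass p v -> exists N, forall i, (N <= i)%N ->
    gromov_product (a g o) (a (g ^+ m.+2)%g o) o <= A + delta + delta /\
    gromov_product o (a (g ^+ m.+2)%g o) (v i) <= A + delta.
  move=> pv; have [N1 NP1] := Ag v pv.
  have pv' : bclass p (a g^-1%g \o v).
    have /boundary_stabV gVp : boundary_stab a p g by [].
    by rewrite -gVp; exact: bclass_boundary_act.
  have [N2 NP2] := IH1 _ pv'.
  exists (maxn N1 N2) => i; rewrite geq_max => /andP[i1 i2].
  have h1 := NP1 i i1.
  (* Translation by [g^-1], which fixes [p], turns this into the induction hypothesis for
     [g^-1 v]. *)
  have h2 : gromov_product (a g o) (a (g ^+ m.+2)%g o) (v i) <= A + delta.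
    apply: le_trans (NP2 i i2); rewrite -[X in gromov_product _ _ X <= _](actVK a g).
    by rewrite expgS actM gromov_product_act actK.
  have h3 := gromov_product_split o (a g o) (v i).
  (* The second alternative would bound the displacement of [o] under [g] by [2 A + 2 delta],
     against [D]. *)
  have h4 : gromov_product (a g o) (a (g ^+ m.+2)%g o) o <= A + delta + delta.
    by have [] := hyperbolic_or hyp (a g o) (a (g ^+ m.+2)%g o) o (v i); lra.
  split=> //.
  have h5 := gromov_product_split o (a g o) (a (g ^+ m.+2)%g o).
  rewrite gromov_productC in h4; have [] := hyperbolic_or hyp o (a g o) (a (g ^+ m.+2)%g o) (v i); lra.
split=> [v /step[N NP]|]; first by exists N => i /NP[].
have [v pv] := bclass_nonempty p; have [N /(_ N (leqnn N))[h _]] := step v pv.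
have e : mdist (a g o) (a (g ^+ m.+2)%g o) = mdist o (a (g ^+ m.+1)%g o).
  by rewrite [in LHS]expgS actM act_mdist.
move: h; rewrite /gromov_product e (metric_sym (a g o) o) (metric_sym (a (g ^+ m.+2)%g o) o); lra.
Qed.

(** If [r <> p], a late term [g] moves [o] far and away from the direction of [p]. Its powers then
    go to infinity without approaching [p], so they attract to some [q <> p], and [g] fixes exactly
    [q] and [p]: it would be loxodromic. *)
Lemma stab_tends_to gamma p r :
  (forall g, boundary_stab a p g -> ~ loxodromic a g) ->
  (forall n, boundary_stab a p (gamma n)) -> tends_to a gamma r -> r = p.
Proof.
move=> nolox stab gr; apply: contrapT => rp.
have [u pu] := bclass_nonempty p; pose o := u 0%N.
have d0 := hyperbolic_delta_ge0 hyp o.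
have [A [N AN]] := boundary_neq hyp o rp (gr o) pu.
pose A1 := A + delta.
have [M MP] := tends_to_dist o (A1 + A1 + delta *+ 8 + 1) gr.
pose g := gamma (maxn N M).
have gp : boundary_act a g p = p by exact: stab.
have gA v : bclass p v -> exists N, forall i, (N <= i)%N -> gromov_product o (a g o) (v i) <= A1.
  move=> pv.
  have [L LP] := (diverging_productP o _ _).1 (bclass_diverging hyp pv pu) (A + delta + 1).
  exists (maxn N L) => i; rewrite geq_max => /andP[iN iL].
  have h1 := LP i i iL iL; have h2 := AN (maxn N M) i (leq_maxl _ _) iN.
  by have [] := hyperbolic_or hyp o (a g o) (v i) (u i); rewrite /A1; lra.
have orb := stab_orbit_away gp gA (MP _ (leq_maxr _ _)).
have ginc : {homo (fun m => mdist o (a (g ^+ m)%g o)) : m n / (m < n)%N >-> m < n}.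
  apply: homo_ltn => [x y z|m]; first exact: lt_trans.
  by have [_] := orb m; lra.
have ginj : injective (fun m : nat => (g ^+ m)%g).
  move=> m n E; case: (ltngtP m n) => // /ginc; rewrite E ltxx//.
apply: (nolox g) => //; split=> //.
have [phi hphi [q gq]] := injective_tends_to o ginj.
have ginjV : injective (fun m => (g ^+ phi m)^-1)%g.
  by move=> m n /invg_inj/ginj/subsequence_inj; exact.
have [psi hpsi [s gs]] := injective_tends_to o ginjV.
have {}gq := tends_to_subsequence hpsi gq.
have qp : q <> p.
  move=> qp; rewrite {}qp in gq.
  have [L LP] := (diverging_productP o _ _).1 (bclass_diverging hyp (gq o) pu) (A1 + delta + 1).
  have [K KP] := (orb (phi (psi L.+1)).-1).1 u pu.
  have := KP (maxn K L) (leq_maxl _ _); have := LP L.+1 (maxn K L) (leqnSn _) (leq_maxr _ _).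
  rewrite /= prednK; first by lra.
  apply: leq_trans (subsequence_ge _ (subsequence_comp hphi hpsi)); exact: ltn0Sn.
have gnp n : boundary_act a (g ^+ n)%g p = p.
  by elim: n => [|n IH]; rewrite ?expg0 ?boundary_act1// expgS boundary_actM IH.
have attract z : z <> s -> (forall n, boundary_act a (g ^+ n)%g z = z) -> z = q.
  move=> zs zfix; have := convergence_dynamics gq gs zs.
  rewrite (_ : (fun n => _) = fun=> z); last by apply/funext => n; exact: zfix.
  by move=> /(cvg_boundary_uniq (cvg_cst z)).
(* [p] is fixed by all powers; were it not the repelling point, it would be attracted to [q]. *)
have sp : s = p.
  by apply: contrapT => /nesym/attract/(_ gnp) pq; exact: qp.
exists q, p; split=> //; apply/seteqP; split=> [z /= gz|z /= [->|->]//].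
  have [->|zp] := pselect (z = p); [by right|left].
  apply: attract; first by rewrite sp.
  by elim=> [|n IH]; rewrite ?expg0 ?boundary_act1// expgS boundary_actM IH.
(* [g] fixes [q] because [g * g^n] and [g^n * g] have the same limit. *)
apply: (tends_to_uniq (tends_to_mull g gq)).
move: (tends_to_mulr g gq); congr (tends_to _ _ _).
by apply/funext => n /=; rewrite -expgS -expgSr.
Qed.

End ProperlyDiscontinuous.
End Hyperbolic.
End Dynamics.

(** * Horoballs and Gromov models *)

Section Busemann.
Context {R : realType} {X : metricType R}.
Implicit Types (c : R -> X) (x y o : X) (p : boundary X).

(** Along a ray the function of [t] defining [busemann] is nonincreasing and bounded below, so its
    limit is an infimum. *)
Lemma busemann_lt c x (M : R) : geodesic_ray c -> busemann c x < M ->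
  exists T, forall t, T <= t -> mdist x (c t) - t < M.
Proof.
move=> ray; pose f t := mdist x (c t) - t.
have f_noninc s t : 0 <= s -> s <= t -> f t <= f s.
  move=> s0 st; have := metric_triangle x (c s) (c t).
  rewrite (ray s t)//=; last exact: le_trans st.
  by rewrite distrC ger0_norm ?subr_ge0// /f; lra.
pose S := f @` [set t | 0 <= t].
have Slb : has_inf S.
  split; first by exists (f 0), 0 => //=.
  exists (- mdist (c 0) x) => _ [t /= t0 <-].
  have := metric_triangle (c 0) x (c t); rewrite (ray 0 t)//= sub0r normrN ger0_norm//.
  by rewrite /f; lra.
have fcvg : f t @[t --> +oo] --> inf S.
  apply/cvgrPdist_lt => e e0.
  have [_ [s s0 <-] sS] := inf_adherent e0 Slb.
  near=> t; have st : s <= t by near: t; apply: nbhs_pinfty_ge; rewrite num_real.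
  have := f_noninc s t s0 st.
  have : inf S <= f t by apply: (ge_inf Slb.2); exists t => //=; exact: le_trans st.
  by move=> h1 h2; rewrite ler0_norm ?subr_le0//; lra.
rewrite /busemann (cvg_lim _ fcvg)//.
move=> SM; have [_ [s s0 <-] sS] := inf_lt Slb.1 SM.
by exists s => t st; apply: le_lt_trans sS; exact: f_noninc.
Unshelve. all: by end_near. Qed.

Lemma busemann_ray c (t : R) : geodesic_ray c -> 0 <= t -> busemann c (c t) = - t.
Proof.
move=> ray t0; apply: cvg_lim; first exact: (@Rhausdorff R).
apply: cvg_near_cst; near=> s.
have ts : t <= s by near: s; apply: nbhs_pinfty_ge; rewrite num_real.
have s0 := le_trans t0 ts; rewrite (ray t s)//=.
by rewrite distrC ger0_norm ?subr_ge0//; lra.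
Unshelve. all: by end_near. Qed.

Variable delta : R.
Hypothesis hyp : forall o x y z : X,
  Num.min (gromov_product o x y) (gromov_product o y z) - delta
    <= gromov_product o x z.

(** For [x] in the horoball and large [m], [d(x, c m) < m + M]; hence twice the product of [x] and
    [c m] at [c 0] exceeds [d(c 0, x) - M]. Points far out in the horoball thus lie in the direction
    of the ray. *)
Lemma horoball_bclass o p (B : set X) (u : nat -> X) :
  open_horoball p B -> (forall n, B (u n)) ->
  (forall A : R, exists N, forall n, (N <= n)%N -> A <= mdist o (u n)) ->
  bclass p u.
Proof.
move=> [oB [c [M [[ray pc] _ BM]]]] Bu du.
apply: (diverging_bclass hyp pc); apply: diverging_productC.
apply/(diverging_productP (c 0)) => A.
have d0 := hyperbolic_delta_ge0 hyp o.
have [N NP] := du ((A + delta) + (A + delta) + M + mdist o (c 0)).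
have [N' N'A] := exists_natr_ge (A + delta).
exists (maxn N N') => i j; rewrite !geq_max => /andP[Ni _] /andP[_ Nj].
have [T TP] := busemann_lt ray (BM _ (Bu i)).
have [m mT] := exists_natr_ge (Num.max T (j%:R)).
have := mT; rewrite ge_max => /andP[Tm jm].
have nge0 (n : nat) : (0 : R) <= n%:R by rewrite ler0n.
have h1 := TP _ Tm.
have h2 : mdist (c 0) (c m%:R) = m%:R by rewrite ray//= sub0r normrN normr_nat.
have h3 : mdist (c 0) (c j%:R) = j%:R by rewrite ray//= sub0r normrN normr_nat.
have h4 : mdist (c m%:R) (c j%:R) = m%:R - j%:R by rewrite ray//= ger0_norm ?subr_ge0.
have h5 := metric_triangle o (c 0) (u i).
have h6 := NP i Ni.
have h7 : N'%:R <= j%:R :> R by rewrite ler_nat.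
have h8 : A + delta <= gromov_product (c 0) (u i) (c m%:R).
  by rewrite /gromov_product h2; lra.
have h9 : A + delta <= gromov_product (c 0) (c m%:R) (c j%:R).
  by rewrite /gromov_product h2 h3 h4; lra.
by have := hyperbolic_ge hyp h8 h9; rewrite addrK.
Qed.

Lemma horoball_nonempty p (B : set X) : open_horoball p B -> B !=set0.
Proof.
move=> [oB [c [M [[ray pc] MB _]]]]; pose t := `|M| + 1.
have Mt : - t < - M by have := ler_norm M; rewrite /t; lra.
exists (c t); apply: MB => /=; rewrite busemann_ray//.
by rewrite /t; have := normr_ge0 M; lra.
Qed.

(** Connectedness: the preimages of [D i] and of the union of the other [D j] are open, disjoint and
    cover the segment. *)
Lemma segment_in_disjoint_union (I : Type) (J : set I) (D : I -> set X) c x y i :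
  (forall j, J j -> open (D j)) ->
  (forall j k, J j -> J k -> j <> k -> D j `&` D k = set0) ->
  geodesic_segment c x y ->
  (forall t, 0 <= t <= mdist x y -> exists2 j, J j & D j (c t)) ->
  J i -> D i x -> D i y.
Proof.
move=> oD dD [c0 c1 geoc] cD Ji Dix.
(* The clamping map [e] extends the segment to a path on all of [R], where connectedness is
   applied. *)
pose e (t : R) := Num.max 0 (Num.min t (mdist x y)).
have eI t : 0 <= e t <= mdist x y.
  by rewrite /e le_max lexx /= ge_max mdist_ge0 ge_min lexx orbT.
have ce : continuous (c \o e).
  move=> t; apply/cvg_ballP => eps eps0; near=> s.
  rewrite ballEmdist /= geoc /= ?eI//.
  have : `|t - s| < eps by near: s; exact: (@cvgr_dist_lt _ _ _ (nbhs t) _ id t).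
  apply: le_lt_trans; rewrite /e.
  have h1 := ler_norm (t - s); have h2 := ler_norm (s - t).
  rewrite distrC in h2; have L0 := mdist_ge0 x y.
  rewrite ler_norml !maxEle !minEle; apply/andP.
  by do 4?case: ifPn; rewrite -?ltNge => *; split; lra.
have conn : connected [set: R] by apply/connected_intervalP => ? ? _ _ ? _.
have E : (c \o e) @^-1` D i = [set: R].
  pose U := \bigcup_(j in J `\ i) D j.
  have UD : (c \o e) @^-1` D i = (c \o e) @^-1` (~` U).
    apply/seteqP; split=> t /=.
      move=> Dit [j [Jj ji] Djt]; have : (D j `&` D i) (c (e t)) by [].
      by rewrite dD.
    have [j Jj Djt] := cD _ (eI t) => nU.
    have [<-//|ji] := pselect (j = i).
    by exfalso; apply: nU; exists j.
  apply: conn.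
  - exists 0 => /=; rewrite /e (_ : Num.max _ _ = 0) ?c0//.
    by rewrite min_l ?mdist_ge0// maxxx.
  - exists ((c \o e) @^-1` D i); last by rewrite setTI.
    by apply: open_comp => [t _|]; [exact: ce|exact: oD].
  - exists ((c \o e) @^-1` (~` U)); last by rewrite setTI.
    apply: closed_comp => [t _|]; first exact: ce.
    by apply: open_closedC; apply: bigcup_open => j [Jj _]; exact: oD.
have : ((c \o e) @^-1` D i) (mdist x y) by rewrite E.
by rewrite /= /e minxx max_r ?mdist_ge0// c1.
Unshelve. all: by end_near. Qed.
End Busemann.

Lemma infinite_injective (T : Type) (A : set T) : infinite_set A ->
  exists2 f : nat -> T, injective f & forall n, A (f n).
Proof.
elim/Ppointed: T => T in A * => [|Ainf]; first by rewrite emptyE => /(_ (finite_set0 _)).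
have /infiniteP/pcard_leP/unsquash f := Ainf.
exists f => [m n|n]; last exact: funS.
by apply: inj; rewrite inE.
Qed.

(** * Orbits in a Gromov model *)

Section GromovModel.
Context {G : groupType} {R : realType} {X : metricType R}.
Variables (a : isometric_action G X) (P : set (set G)) (B : set G -> set X).
Hypotheses (hP : peripheral_structure P) (hX : gromov_model a P B).

Lemma conjugate_injective Q : conjugates P Q ->
  exists2 gamma : nat -> G, injective gamma & forall n, Q (gamma n).
Proof.
move=> [g [H PH ->]].
have [f finj Hf] := infinite_injective (peripheral_infinite hP PH).
exists (fun n => g * f n * g^-1)%g; last by move=> n; exists (f n).
by move=> m n /mulIg/mulgI/finj.
Qed.

Lemma segment_leaves_horoballs (Q : set G) x y c :
  geodesic_segment c x y -> conjugates P Q -> B Q x -> ~ B Q y ->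
  exists2 t : R, 0 <= t <= mdist x y & ~ (\bigcup_(Q in conjugates P) B Q) (c t).
Proof.
move=> cs PQ Bx nBy; apply: contrapT => nt; apply: nBy.
apply: (segment_in_disjoint_union (J := conjugates P) _ _ cs _ PQ Bx).
- by move=> Q' /(model_horoball hX)[p []].
- by move=> Q1 Q2; exact: model_disjoint hX _ _.
- move=> t tI; apply: contrapT => nQ; apply: nt; exists t => //.
Qed.

(** Cocompactness approximates points outside the horoballs by an orbit, so it suffices to represent
    [p] by such points, unless [p] is the centre of a horoball. *)
Lemma boundary_is_limit (p : boundary X) : exists gamma, tends_to a gamma p.
Proof.
have [delta hyp] := model_hyperbolic hX.
have geo := model_geodesic hX; have prop := model_proper hX.
have disc := model_properly_discontinuous hX.
have [K cK KB] := model_cocompact hX.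
have [u pu] := bclass_nonempty p; pose o := u 0%N.
have outside (w : nat -> X) : bclass p w ->
    (forall n, ~ (\bigcup_(Q in conjugates P) B Q) (w n)) ->
    exists gamma, tends_to a gamma p.
  move=> pw wB.
  have /choice[gk gkP] n : exists gk : G * X, K gk.2 /\ a gk.1 gk.2 = w n.
    have : (~` \bigcup_(Q in conjugates P) B Q) (w n) by exact: wB.
    by rewrite -KB => -[g _ [k Kk <-]]; exists (g, k).
  have [phi [k [hphi Kk kcvg]]] := compact_subsequence (@metric_first_countable _ X)
    cK (fun n => (gkP n).1).
  have /near_ooP[N NP] : \forall n \near \oo, mdist k ((gk (phi n)).2) < 1.
    have /cvg_ballP/(_ 1 ltr01) := kcvg.
    by apply: filterS => n; rewrite ballEmdist.
  pose psi n := phi (n + N)%N.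
  have hpsi : subsequence psi.
    by apply: (subsequence_comp hphi) => m n mn; rewrite ltn_add2r.
  exists (fun n => (gk (psi n)).1); apply/(tends_toP _ o).
  apply: (@bclass_near _ _ _ (w \o psi) _ (1 + mdist k o)); last exact: bclass_subsequence.
  move=> n /=; rewrite -(gkP (psi n)).2 act_mdist.
  have := NP (n + N)%N (leq_addl _ _); rewrite -/(psi n) => h.
  have := metric_triangle (gk (psi n)).2 k o; rewrite (metric_sym _ k); lra.
(* If [u] returns to one horoball infinitely often, [p] is its centre, and the infinite stabilizer
   [Q], which preserves the horoball, supplies the sequence. *)
have [[Q [PQ BQ]]|nQ] := pselect (exists Q, conjugates P Q /\
    forall N, exists2 n, (N <= n)%N & B Q (u n)).
  have [phi hphi Bphi] := @subsequence_choose (fun _ n => B Q (u n)) (fun _ => BQ).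
  have [q hq] := model_horoball hX PQ.
  have pphi := bclass_subsequence hphi pu.
  have qphi := horoball_bclass hyp (o := o) hq Bphi (bclass_dist o ^~ pphi).
  have pq := boundary_eq1 hyp pphi qphi; rewrite -{}pq in hq.
  have [x Bx] := horoball_nonempty hq.
  have [gamma ginj gQ] := conjugate_injective PQ.
  exists gamma; apply/(tends_toP _ x).
  apply: (horoball_bclass hyp (o := x) hq) => [n|A]; last exact: (injective_dist prop disc).
  have : [set g | a g @` B Q = B Q] (gamma n) by rewrite (model_stabilizer hX PQ).
  by move=> /= <-; exists x.
(* Now [u] leaves each horoball for good, so a geodesic from [u i] in a horoball to a later term
   crosses the complement. *)
have step i : exists2 w, ~ (\bigcup_(Q in conjugates P) B Q) w &
    exists j, (i <= j)%N /\ exists k, (i <= k)%N /\ exists c t,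
      [/\ geodesic_segment c (u j) (u k), (0 : R) <= t <= mdist (u j) (u k) & w = c t].
  have [[Q PQ BQ]|nB] := pselect ((\bigcup_(Q in conjugates P) B Q) (u i)); last first.
    have [c cs] := geo (u i) (u i); exists (u i) => //.
    exists i; split=> //; exists i; split=> //; exists c, 0; split=> //.
      by rewrite lexx mdist_ge0.
    by have [-> _ _] := cs.
  have [N NP] : exists N, forall n, (N <= n)%N -> ~ B Q (u n).
    apply: contrapT => nN; apply: nQ; exists Q; split=> // N.
    apply: contrapT => nn; apply: nN; exists N => n Nn Bn; apply: nn; by exists n.
  pose j := maxn i N; have [c cs] := geo (u i) (u j).
  have [t tI ntB] := segment_leaves_horoballs cs PQ BQ (NP j (leq_maxr _ _)).
  exists (c t) => //; exists i; split=> //; exists j; split; first exact: leq_maxl.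
  by exists c, t.
have [w wP] := choice (fun i => let: ex_intro2 w h1 h2 := step i in ex_intro _ w (conj h1 h2)).
apply: (outside w) => [|n]; last by have [] := wP n.
apply: (diverging_bclass hyp pu); apply/(diverging_productP o) => A.
have [N NP] := (diverging_productP o _ _).1 (bclass_convergent pu) (A + delta).
exists N => m i Nm Ni; have [_ [j [ij [k [ik [c [t [[c0 c1 geoc] tI ->]]]]]]]] := wP i.
have h1 := NP m j Nm (leq_trans Ni ij); have h2 := NP j k (leq_trans Ni ij) (leq_trans Ni ik).
rewrite -[A](addrK delta); apply: (hyperbolic_ge hyp h1).
(* Moving from [u k] back towards [u j] along the geodesic does not decrease the product with
   [u j]. *)
apply: le_trans h2 _.
have L0 := mdist_ge0 (u j) (u k).
have /andP[t0 t1] := tI.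
have e1 : mdist (u j) (c t) = t.
  by rewrite -{1}c0 geoc//= ?lexx ?L0// sub0r normrN ger0_norm.
have e2 : mdist (c t) (u k) = mdist (u j) (u k) - t.
  by rewrite -{1}c1 geoc//= ?lexx ?L0// distrC ger0_norm// subr_ge0.
have := metric_triangle o (c t) (u k); rewrite /gromov_product e1 e2; lra.
Qed.

End GromovModel.

(** * Singular value decomposition over the real and complex numbers *)

Section RealOrComplex.

(** What the sequel uses of the real and complex fields beyond [numFieldType], so that both are
    treated at once. Algebraic closedness is absent; below, characteristic polynomials are assumed
    to split when needed. *)
Record real_complex_like (K : numFieldType) : Prop := {
  conjKD : {morph @conjK K : x y / x + y};
  conjKM : {morph @conjK K : x y / x * y};
  conjKK : involutive (@conjK K);
  sqrt_ex : forall x : K, 0 <= x -> exists2 y : K, 0 <= y & y ^+ 2 = x;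
  inv_lt : forall e : K, 0 < e -> exists n : nat, n.+1%:R^-1 < e;
  bounded_subsequence : forall (u : nat -> K) (b : K), (forall n, `|u n| <= b) ->
    exists phi (l : K), subsequence phi /\ u (phi n) @[n --> \oo] --> l }.

Variable R : realType.

Lemma real_bolzano_weierstrass (u : nat -> R) (b : R) : (forall n, `|u n| <= b) ->
  exists phi (l : R), subsequence phi /\ u (phi n) @[n --> \oo] --> l.
Proof.
move=> ub; have fc : first_countable R.
  by apply: pseudometric_first_countable => e; exact: archimedean_inv.
have uI n : `[- b, b]%classic (u n) by rewrite /= in_itv /= -ler_norml.
have [phi [l [hphi _ lP]]] := compact_subsequence fc (@segment_compact R _ _) uI.
by exists phi, l.
Qed.

Lemma real_like : real_complex_like R.
Proof.
split.
- by move=> x y; rewrite !conjK_real.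
- by move=> x y; rewrite !conjK_real.
- by move=> x; rewrite !conjK_real.
- by move=> x x0; exists (Num.sqrt x); rewrite ?sqrtr_ge0 ?sqr_sqrtr.
- exact: archimedean_inv.
- exact: real_bolzano_weierstrass.
Qed.

Lemma complex_gt0 (e : R[i]) : 0 < e -> exists2 r : R, 0 < r & e = real_complex R r.
Proof.
case: e => r i; rewrite ltcE /= => /andP[/eqP -> r0].
by exists r.
Qed.

Lemma complex_norm_le (r b : R) (z : R[i]) : `|z| <= real_complex R b ->
  `|complex.Re z| <= b /\ `|complex.Im z| <= b.
Proof.
rewrite normc_def lecR => zb; split; apply: le_trans zb; rewrite -sqrtr_sqr.
  by rewrite ler_wsqrtr// lerDl sqr_ge0.
by rewrite ler_wsqrtr// lerDr sqr_ge0.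
Qed.

Lemma complex_norm_lt (b : R) (z : R[i]) :
  `|complex.Re z| + `|complex.Im z| < b -> `|z| < real_complex R b.
Proof.
rewrite normc_def ltcR; apply: le_lt_trans.
rewrite -[leRHS]ger0_norm ?addr_ge0// -sqrtr_sqr ler_wsqrtr//.
rewrite sqrrD !real_normK ?num_real// lerD2r lerDl mulrn_wge0// mulr_ge0//.
Qed.

Lemma complex_like : real_complex_like R[i].
Proof.
split.
- by move=> x y; rewrite !conjK_complex rmorphD.
- by move=> x y; rewrite !conjK_complex rmorphM.
- by move=> x; rewrite !conjK_complex conjcK.
- move=> x x0; exists (sqrtc x); first by rewrite sqrtc_ge0.
  by rewrite sqr_sqrtc.
- move=> e /complex_gt0[r r0 ->]; have [n nr] := archimedean_inv r0; exists n.
  have -> : n.+1%:R^-1 = real_complex R n.+1%:R^-1 by rewrite fmorphV rmorph_nat.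
  by rewrite ltcR.
- move=> u b ub.
  (* A positive element of [R[i]] is real; adding 1 makes the bound positive. *)
  have /complex_gt0[c c0 bE] : 0 < b + 1.
    by rewrite ltr_wpDl// (le_trans _ (ub 0%N)).
  have uc n : `|complex.Re (u n)| <= c /\ `|complex.Im (u n)| <= c.
    by apply: complex_norm_le => //; rewrite -bE (le_trans (ub n))// lerDl.
  have [phi [x [hphi xP]]] := real_bolzano_weierstrass (fun n => (uc n).1).
  have [psi [y [hpsi yP]]] := real_bolzano_weierstrass (fun n => (uc (phi n)).2).
  exists (phi \o psi), (Complex x y); split; first exact: subsequence_comp.
  apply/cvgrPdist_lt => e /complex_gt0[r r0 ->].
  have r20 : 0 < r / 2 by rewrite divr_gt0.
  have /cvgrPdist_lt/(_ _ r20) := cvg_subsequence hpsi xP.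
  move=> hx; have /cvgrPdist_lt/(_ _ r20) := yP.
  apply: filterS2 hx => n hx hy; apply: complex_norm_lt.
  case: (u _) hx hy => s t /= hx hy; rewrite [ltRHS](splitr r).
  exact: ltrD.
Qed.

Lemma real_or_complex_like (K : numFieldType) : real_or_complex R K -> real_complex_like K.
Proof. by case=> ->; [exact: real_like|exact: complex_like]. Qed.

End RealOrComplex.

(** * Hermitian linear algebra *)

Section Unitary.
Variable K : numFieldType.
Hypothesis hK : real_complex_like K.

(** The rectangular form of [conj_transpose], convertible to it on square matrices. *)
Definition ctrmx m n (A : 'M[K]_(m, n)) : 'M[K]_(n, m) := map_mx (@conjK K) A^T.

Lemma conjK0 : conjK 0 = 0 :> K. Proof. by rewrite /conjK invr0 mulr0. Qed.

Lemma conjK_ge0 (x : K) : 0 <= x -> conjK x = x.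
Proof.
move=> x0; rewrite /conjK ger0_norm//.
by have [->|xn0] := eqVneq x 0; rewrite ?invr0 ?mulr0// expr2 mulfK.
Qed.

Lemma mul_conjK (x : K) : conjK x * x = `|x| ^+ 2.
Proof.
rewrite /conjK; have [->|xn0] := eqVneq x 0; last by rewrite divfK.
by rewrite mulr0 normr0 expr0n.
Qed.

Lemma ctrmxM m n p (A : 'M[K]_(m, n)) (B : 'M_(n, p)) :
  ctrmx (A *m B) = ctrmx B *m ctrmx A.
Proof.
apply/matrixP => i j; rewrite !mxE (big_morph _ (conjKD hK) conjK0).
by apply: eq_bigr => l _; rewrite !mxE (conjKM hK) mulrC.
Qed.

Lemma ctrmxK m n (A : 'M[K]_(m, n)) : ctrmx (ctrmx A) = A.
Proof. by apply/matrixP => i j; rewrite !mxE (conjKK hK). Qed.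

Lemma ctrmx0 m n : ctrmx (0 : 'M[K]_(m, n)) = 0.
Proof. by apply/matrixP => i j; rewrite !mxE conjK0. Qed.

Lemma ctrmx_diag n (d : 'rV[K]_n) : (forall i, 0 <= d 0 i) -> ctrmx (diag_mx d) = diag_mx d.
Proof.
move=> d0; apply/matrixP => i j; rewrite !mxE eq_sym.
by case: eqP => [->|_]; rewrite ?mulr1n ?mulr0n ?conjK0// conjK_ge0.
Qed.

Lemma ctrmx1 n : ctrmx (1%:M : 'M[K]_n) = 1%:M.
Proof. by rewrite -diag_const_mx ctrmx_diag// => i; rewrite mxE ler01. Qed.

Lemma ctrmx_scale_ge0 m n (a : K) (A : 'M[K]_(m, n)) : 0 <= a -> ctrmx (a *: A) = a *: ctrmx A.
Proof. by move=> a0; apply/matrixP => i j; rewrite !mxE (conjKM hK) conjK_ge0. Qed.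

Lemma ctrmx_row m n1 n2 (A : 'M[K]_(m, n1)) (B : 'M_(m, n2)) :
  ctrmx (row_mx A B) = col_mx (ctrmx A) (ctrmx B).
Proof. by rewrite /ctrmx tr_row_mx map_col_mx. Qed.

Lemma mxrank_row_mx_le m n1 n2 (A : 'M[K]_(m, n1)) (B : 'M_(m, n2)) :
  (\rank (row_mx A B) <= \rank A + \rank B)%N.
Proof.
rewrite -[\rank (row_mx A B)]mxrank_tr tr_row_mx -addsmxE -(mxrank_tr A) -(mxrank_tr B).
exact: (mxrank_adds_leqif _ _).1.
Qed.

Lemma ctrmx_mul_diag m n (A : 'M[K]_(m, n)) j :
  (ctrmx A *m A) j j = \sum_i `|A i j| ^+ 2.
Proof. by rewrite mxE; apply: eq_bigr => i _; rewrite !mxE mul_conjK. Qed.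

Lemma ctrmx_mul_eq0 m n (A : 'M[K]_(m, n)) : ctrmx A *m A = 0 -> A = 0.
Proof.
move=> A0; apply/matrixP => i j; rewrite mxE.
have := ctrmx_mul_diag A j; rewrite A0 mxE => /esym/eqP.
rewrite psumr_eq0 => [/allP/(_ i)|i' _]; last by rewrite exprn_ge0.
by rewrite mem_index_enum expf_eq0 normr_eq0 /= => /(_ isT)/eqP.
Qed.

Lemma ctrmx_unitary n (U : 'M[K]_n) : ctrmx U *m U = 1%:M -> U *m ctrmx U = 1%:M.
Proof. by move=> h; apply: mulmx1C. Qed.

(** The change of basis [T] acts on the right, so orthonormalising keeps the column space. The
    induction treats the last [k] columns first and then corrects the first one. *)
Lemma gram_schmidt d k (M : 'M[K]_(d, k)) : \rank M = k ->
  exists2 T : 'M[K]_k, T \in unitmx & ctrmx (M *m T) *m (M *m T) = 1%:M.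
Proof.
elim: k M => [|k IH] M rM.
  by exists 1%:M; rewrite ?unitmx1//; apply/matrixP => -[].
rewrite -[k.+1]/(1 + k)%N in M rM *.
pose m := lsubmx M; pose M1 := rsubmx M.
have ME : M = row_mx m M1 by rewrite hsubmxK.
have rM1 : \rank M1 = k.
  apply/eqP; rewrite eqn_leq rank_leq_col /= -ltnS -[k.+1]/(1 + k)%N -[X in (X <= _)%N]rM ME.
  exact: leq_trans (mxrank_row_mx_le _ _) (leq_add (rank_leq_col _) (leqnn _)).
have [T1 uT1 E1] := IH _ rM1.
have [E ME1] : exists E, M1 *m T1 = E by exists (M1 *m T1).
rewrite ME1 in E1.
pose w := m - E *m (ctrmx E *m m).
have Ew : ctrmx E *m w = 0.
  by rewrite /w mulmxBr !mulmxA E1 mul1mx subrr.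
have w0 : w != 0.
  apply/eqP => /subr0_eq mE.
  (* If the component [w] of [m] orthogonal to the columns of [E] vanished, [M] would factor through
     [M1] and have rank at most [k]. *)
  have : (\rank (M1 *m row_mx (T1 *m (ctrmx E *m m)) 1%:M) <= k)%N.
    by rewrite -[X in (_ <= X)%N]rM1 mxrankM_maxl.
  by rewrite mul_mx_row mulmxA ME1 -mE mulmx1 -ME rM ltnn.
pose q := \sum_i `|w i 0| ^+ 2.
have wq : ctrmx w *m w = q%:M.
  by apply/matrixP => i j; rewrite !ord1 ctrmx_mul_diag !mxE mulr1n.
have q0 : 0 <= q by apply: sumr_ge0 => i _; rewrite exprn_ge0.
have qn0 : q != 0.
  apply: contra_neq w0 => q00; apply: ctrmx_mul_eq0; rewrite wq q00.
  by apply/matrixP => i j; rewrite !mxE mul0rn.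
have [s s0 sq] := sqrt_ex hK q0.
have sn0 : s != 0 by apply: contra_neq qn0 => e; rewrite -sq e expr0n.
pose e := s^-1 *: w.
have ee : ctrmx e *m e = 1%:M.
  rewrite ctrmx_scale_ge0 ?invr_ge0// -scalemxAl -scalemxAr wq scalerA -scalemx1 scalerA.
  by rewrite -invfM -expr2 sq mulVf// scale1r.
have Ee : ctrmx E *m e = 0 by rewrite -scalemxAr Ew scaler0.
have eE : ctrmx e *m E = 0 by rewrite -[LHS]ctrmxK ctrmxM ctrmxK Ee ctrmx0.
pose T : 'M_(1 + k) := block_mx (s^-1)%:M 0 (- (s^-1 *: (T1 *m (ctrmx E *m m)))) T1.
have MT : M *m T = row_mx e E.
  rewrite ME mul_row_block mulmx0 add0r mul_mx_scalar ME1; congr row_mx.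
  by rewrite mulmxN -scalemxAr !mulmxA ME1 -mulmxA -scalerBr.
exists T.
  by rewrite unitmxE det_lblock det_scalar1 unitrM unitfE invr_eq0 sn0 /= -unitmxE.
rewrite MT ctrmx_row mul_col_row ee eE Ee E1.
by rewrite -scalar_mx_block.
Qed.

End Unitary.

Section Spectral.
Variable K : numFieldType.
Hypothesis hK : real_complex_like K.

Lemma char_poly_conj n (U V A : 'M[K]_n) : U *m V = 1%:M ->
  char_poly (V *m A *m U) = char_poly A.
Proof.
move=> UV; have VU := mulmx1C UV; rewrite /char_poly.
have -> : char_poly_mx (V *m A *m U) = map_mx polyC V *m char_poly_mx A *m map_mx polyC U.
  rewrite /char_poly_mx mulmxBr mulmxBl !map_mxM; congr (_ - _).
  by rewrite -scalemx1 -scalemxAr mulmx1 -scalemxAl -map_mxM VU map_mx1.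
rewrite !det_mulmx mulrAC -det_mulmx -map_mxM VU map_mx1 det1 mul1r//.
Qed.

Lemma char_poly_block n (t : K) (B : 'M[K]_n) :
  char_poly (block_mx t%:M 0 0 B : 'M_(1 + n)) = ('X - t%:P) * char_poly B.
Proof.
rewrite /char_poly /char_poly_mx map_block_mx !map_mx0 map_scalar_mx /=.
rewrite (scalar_mx_block 1 n 'X) opp_block_mx add_block_mx !oppr0 !addr0.
by rewrite det_ublock -raddfB /= det_scalar1.
Qed.

Lemma ctrmx_block1 m n (U : 'M[K]_n) :
  ctrmx (block_mx (1%:M : 'M_m) 0 0 U) = block_mx 1%:M 0 0 (ctrmx U).
Proof.
rewrite {1}/ctrmx tr_block_mx map_block_mx -[map_mx _ 1%:M^T]/(ctrmx 1%:M) ctrmx1.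
by rewrite -![map_mx _ 0^T]/(ctrmx 0) !ctrmx0.
Qed.

Lemma unitary_completion n (v : 'cV[K]_(1 + n)) : v != 0 ->
  exists (e : 'cV[K]_(1 + n)) (F : 'M[K]_(1 + n, n)) (a : K),
    e = a *: v /\ ctrmx (row_mx e F) *m row_mx e F = 1%:M.
Proof.
move=> v0.
have rv : \rank v = 1%N by rewrite -mxrank_tr rank_rV -trmx0 (inj_eq trmx_inj) v0.
have [T uT eE] := gram_schmidt hK rv.
have [e eT] : exists e, e = T 0 0 *: v by exists (T 0 0 *: v).
rewrite [T]mx11_scalar mul_mx_scalar -eT in eE.
have e0 : e^T != 0.
  rewrite -trmx0 (inj_eq trmx_inj); apply: contra_eq_neq eE => ->.
  by rewrite mulmx0 eq_sym; apply/eqP => /matrixP/(_ 0 0)/eqP; rewrite !mxE oner_eq0.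
(* For a nonzero row, [row_ebase] is an invertible matrix whose first row is proportional to it; its
   other rows complete [e] to a basis, then made orthogonal to [e]. *)
pose Q := row_ebase e^T : 'M_(1 + n).
have eQ : exists c : K, e^T = c *: usubmx Q.
  exists (col_ebase e^T 0 0); rewrite -[LHS]mulmx_ebase rank_rV e0.
  rewrite [X in X *m _ *m _]mx11_scalar -mulmxA mul_scalar_mx; congr (_ *: _).
  by rewrite -/Q -[Q in LHS]vsubmxK pid_mx_row mul_row_col mul1mx mul0mx addr0.
have [c ec] := eQ.
pose C := (dsubmx Q)^T : 'M_(1 + n, n).
pose C' := C - e *m (ctrmx e *m C).
have eC' : ctrmx e *m C' = 0 by rewrite mulmxBr !mulmxA eE mul1mx subrr.
have c0 : c != 0 by apply: contraNneq e0 => c0; rewrite ec c0 scale0r.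
have rC' : \rank C' = n.
  have rQ : \rank (row_mx e C) = (1 + n)%N.
    have -> : row_mx e C = Q^T *m block_mx c%:M 0 0 1%:M.
      rewrite -[X in X^T *m _]vsubmxK tr_col_mx mul_row_block !mulmx0 addr0 add0r mulmx1 mul_mx_scalar.
      by rewrite -linearZ /= -ec trmxK.
    rewrite mxrankMfree ?mxrank_tr ?mxrank_unit ?row_ebase_unit//.
    by rewrite row_free_unit unitmxE det_ublock det_scalar1 det1 mulr1 unitfE.
  apply/eqP; rewrite eqn_leq rank_leq_col /= -(leq_add2l 1) -[X in (X <= _)%N]rQ.
  have -> : row_mx e C = row_mx e C' *m block_mx 1%:M (ctrmx e *m C) 0 1%:M.
    by rewrite mul_row_block !mulmx1 mulmx0 addr0 /C' addrCA subrr addr0.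
  apply: leq_trans (mxrankM_maxl _ _) _; apply: leq_trans (mxrank_row_mx_le _ _) _.
  by rewrite leq_add2r rank_leq_col.
have [T2 _ FF] := gram_schmidt hK rC'.
exists e, (C' *m T2), (T 0 0); split=> //.
have eF : ctrmx e *m (C' *m T2) = 0 by rewrite mulmxA eC' mul0mx.
rewrite ctrmx_row mul_col_row eE FF eF -[ctrmx (C' *m T2) *m e](ctrmxK hK).
by rewrite (ctrmxM hK) (ctrmxK hK) eF ctrmx0 -scalar_mx_block.
Qed.

(** An eigenvector of a self-adjoint matrix splits off an orthogonal block, and its eigenvalue can
    be taken to be the head of [s]. The diagonal therefore follows the order of [s] itself, which
    keeps singular values sorted. *)
Lemma spectral n (A : 'M[K]_n) (s : seq K) : ctrmx A = A -> all (>= 0) s ->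
  char_poly A = \prod_(t <- s) ('X - t%:P) ->
  exists2 U : 'M[K]_n, ctrmx U *m U = 1%:M &
    A = U *m diag_mx (\row_i s`_i) *m ctrmx U.
Proof.
elim: n A s => [|n IH] A s hA s0 pA.
  by exists 1%:M; apply/matrixP => -[].
rewrite -[n.+1]/(1 + n)%N in A hA pA *.
have ss : size s = n.+1.
  by apply: succn_inj; rewrite -[RHS](size_char_poly A) pA size_prod_XsubC.
case: s ss s0 pA => // t s [ss] /= /andP[t0 s0]; rewrite big_cons => pA.
have [v vA v0] : exists2 v : 'rV_(1 + n), v *m A = t *: v & v != 0.
  by apply/eigenvalueP; rewrite eigenvalue_root_char pA rootM root_XsubC eqxx.
have Av : A *m ctrmx v = t *: ctrmx v.
  by rewrite -{1}hA -(ctrmxM hK) vA (ctrmx_scale_ge0 hK).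
have cv0 : ctrmx v != 0.
  by apply: contraNneq v0 => cv0; rewrite -[v](ctrmxK hK) cv0 ctrmx0.
have [e [F [b [eE UU]]]] := unitary_completion cv0.
have Ae : A *m e = t *: e by rewrite eE -scalemxAr Av !scalerA mulrC.
have eA : ctrmx e *m A = t *: ctrmx e by rewrite -{1}hA -(ctrmxM hK) Ae (ctrmx_scale_ge0 hK).
pose U := row_mx e F; rewrite -/U in UU.
pose A' := ctrmx F *m A *m F.
have hA' : ctrmx A' = A' by rewrite /A' !(ctrmxM hK) (ctrmxK hK) hA mulmxA.
have [ee eF] : ctrmx e *m e = 1%:M /\ ctrmx e *m F = 0.
  move: UU; rewrite ctrmx_row mul_col_row (scalar_mx_block 1 n) => /eq_block_mx[-> ->]//.
have Fe : ctrmx F *m e = 0 by rewrite -[LHS](ctrmxK hK) (ctrmxM hK) (ctrmxK hK) eF ctrmx0.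
have UAU : ctrmx U *m A *m U = block_mx t%:M 0 0 A'.
  rewrite /U ctrmx_row mul_col_mx mul_col_row -/A' eA -!scalemxAl ee eF.
  by rewrite -(mulmxA _ A e) Ae -scalemxAr Fe !scaler0 scalemx1.
have UU' := ctrmx_unitary UU.
have pA' : char_poly A' = \prod_(t <- s) ('X - t%:P).
  apply: (@mulfI _ ('X - t%:P)); first by rewrite polyXsubC_eq0.
  by rewrite -pA -char_poly_block -UAU char_poly_conj.
have [U' UU1 A'E] := IH _ _ hA' s0 pA'.
exists (U *m block_mx 1%:M 0 0 U').
  rewrite (ctrmxM hK) mulmxA -[_ *m ctrmx U *m U]mulmxA UU mulmx1.
  rewrite ctrmx_block1 mulmx_block !mul0mx !mulmx0 !addr0 !add0r mul1mx UU1.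
  by rewrite -scalar_mx_block.
have -> : A = U *m (ctrmx U *m A *m U) *m ctrmx U.
  by rewrite !mulmxA UU' mul1mx -mulmxA UU' mulmx1.
have -> : \row_(i < 1 + n) (t :: s)`_i = row_mx t%:M (\row_(i < n) s`_i).
  apply/rowP => i; rewrite !mxE; case: splitP => j ij; rewrite !mxE ij.
    by rewrite !ord1 mulr1n.
  by [].
rewrite UAU (ctrmxM hK) ctrmx_block1 diag_mx_row A'E -!mulmxA; congr (U *m _).
rewrite !mulmxA; congr (_ *m ctrmx U).
rewrite !mulmx_block ?(mul0mx, mulmx0, addr0, add0r, mul1mx, mulmx1).
by congr block_mx; apply/matrixP => i j; rewrite !ord1 !mxE.
Qed.

End Spectral.

(** * Subspaces as column spaces of frames *)

Section ColumnSpace.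
Variable K : numFieldType.
Variable d : nat.
Implicit Types V W : grass K d.

Lemma column_spaceP k (M : 'M[K]_(d, k)) v :
  reflect (exists w, v = M *m w) (v \in column_space M).
Proof.
apply: (iffP idP) => [/memv_imgP[w _ ->]|[w ->]].
  by exists w; rewrite lfunE.
by apply/memv_imgP; exists w; rewrite ?memvf ?lfunE.
Qed.

Lemma column_spaceS k l (N : 'M[K]_(d, k)) (M : 'M[K]_(d, l)) :
  (column_space N <= column_space M)%VS <-> exists Y, N = M *m Y.
Proof.
split=> [/subvP NM|[Y ->]]; last first.
  apply/subvP => v /column_spaceP[w ->]; apply/column_spaceP.
  by exists (Y *m w); rewrite mulmxA.
have /choice[y yP] j : exists y, col j N = M *m y.
  by apply/column_spaceP/NM/column_spaceP; exists (delta_mx j 0); rewrite colE.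
exists (\matrix_(i, j) y j i 0); apply/matrixP => i j.
have := congr1 (fun A : 'cV_d => A i 0) (yP j); rewrite !mxE => ->.
by apply: eq_bigr => l' _; rewrite mxE.
Qed.

Lemma column_space_eqP k l (N : 'M[K]_(d, k)) (M : 'M[K]_(d, l)) :
  column_space N = column_space M <-> (exists Y, N = M *m Y) /\ (exists Z, M = N *m Z).
Proof.
split=> [E|[/column_spaceS h1 /column_spaceS h2]]; last first.
  by apply/eqP; rewrite eqEsubv h1 h2.
by split; apply/column_spaceS; rewrite E subvv.
Qed.

Lemma column_space_mulr k (N : 'M[K]_(d, k)) (T : 'M_k) :
  T \in unitmx -> column_space (N *m T) = column_space N.
Proof.
move=> uT; apply/column_space_eqP; split; first by exists T.
by exists (invmx T); rewrite mulmxK.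
Qed.

Lemma mulmx_left_inverse k (M : 'M[K]_(d, k)) : \rank M = k -> exists L, L *m M = 1%:M.
Proof.
move=> rM; have fM : row_full M by rewrite /row_full rM.
by have [L LM] := row_fullP fM; exists L.
Qed.

Lemma left_inverse_rank k (M : 'M[K]_(d, k)) L : L *m M = 1%:M -> \rank M = k.
Proof. by move=> LM; apply/eqP; apply/row_fullP; exists L. Qed.

Lemma dim_column_space k (M : 'M[K]_(d, k)) : \dim (column_space M) = \rank M.
Proof.
have full l (N : 'M[K]_(d, l)) : \rank N = l -> \dim (column_space N) = l.
  move=> /mulmx_left_inverse[L LN].
  rewrite /column_space limg_dim_eq ?dimvf /dim /= ?muln1//.
  apply/eqP; rewrite capfv -subv0; apply/subvP => w; rewrite memv_ker lfunE /= memv0.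
  by move=> /eqP Nw; rewrite -[w]mul1mx -LN -mulmxA Nw mulmx0.
rewrite -[RHS](full _ (col_base M)); last by apply/eqP; exact: col_base_full.
congr (\dim _); apply/column_space_eqP; split.
  by exists (row_base M); rewrite mulmx_base.
have [Z /esym RZ] := row_freeP (row_base_free M).
have := congr1 (mulmx (col_base M)) RZ; rewrite mulmx1 mulmxA mulmx_base => E.
by exists Z.
Qed.

Lemma grass_frame V : exists2 M : 'M[K]_(d, \dim V), \rank M = \dim V & column_space M = V.
Proof.
pose M : 'M[K]_(d, \dim V) := \matrix_(i, j) (vbasis V)`_j i 0.
have ME w : M *m w = \sum_j w j 0 *: (vbasis V)`_j.
  apply/colP => i; rewrite !mxE summxE; apply: eq_bigr => j _.
  by rewrite !mxE mulrC.
have MV : column_space M = V.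
  apply/eqP; rewrite eqEsubv; apply/andP; split; apply/subvP => v.
    move=> /column_spaceP[w ->]; rewrite ME; apply: rpred_sum => j _.
    by apply: rpredZ; apply: vbasis_mem; rewrite mem_nth// size_tuple.
  move=> /coord_vbasis ->; apply/column_spaceP.
  exists (\col_j coord (vbasis V) j v); rewrite ME; apply: eq_bigr => j _.
  by rewrite mxE.
by exists M => //; rewrite -dim_column_space MV.
Qed.

Lemma grass_frame_dim V k : \dim V = k ->
  exists2 M : 'M[K]_(d, k), \rank M = k & column_space M = V.
Proof. by move=> <-; exact: grass_frame. Qed.

Lemma column_space_row k l (N : 'M[K]_(d, k)) (M : 'M[K]_(d, l)) :
  column_space (row_mx N M) = (column_space N + column_space M)%VS.
Proof.
apply/eqP; rewrite eqEsubv; apply/andP; split; apply/subvP => v.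
  move=> /column_spaceP[w ->]; rewrite -[w]vsubmxK mul_row_col.
  by apply: memv_add; apply/column_spaceP; eexists.
move=> /memv_addP[_ /column_spaceP[y ->] [_ /column_spaceP[z ->] ->]].
by apply/column_spaceP; exists (col_mx y z); rewrite mul_row_col.
Qed.

Lemma grass_act_column_space k (g : 'M[K]_d) (M : 'M[K]_(d, k)) :
  grass_act g (column_space M) = column_space (g *m M).
Proof.
apply/eqP; rewrite eqEsubv; apply/andP; split; apply/subvP => v.
  move=> /memv_imgP[_ /column_spaceP[w ->] ->]; rewrite lfunE /=.
  by apply/column_spaceP; exists w; rewrite mulmxA.
move=> /column_spaceP[w ->]; rewrite -mulmxA -[g *m _](lfunE (mulmx g : {linear _ -> _})).
by apply: memv_img; apply/column_spaceP; exists w.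
Qed.

Lemma column_space_full k (M : 'M[K]_(d, k)) : column_space M = fullv <-> \rank M = d.
Proof.
have df : \dim {:'cV[K]_d} = d by rewrite dimvf /dim /= muln1.
split=> [E|rM]; first by rewrite -dim_column_space E.
by apply/eqP; rewrite eqEdim subvf dim_column_space rM df leqnn.
Qed.

End ColumnSpace.

(** * Singular value decompositions *)

Section SVD.
Variable K : numFieldType.
Hypothesis hK : real_complex_like K.
Variable d : nat.
Implicit Types (g U V : 'M[K]_d) (s t : seq K).

Definition seq_diag s : 'M[K]_d := diag_mx (\row_i s`_i).

Definition singular_spec g s := [/\ sorted >=%O s, all (>= 0) s &
  char_poly (g *m conj_transpose g) = \prod_(x <- s) ('X - (x ^+ 2)%:P)].

(** [V] is the right factor itself, not its adjoint: the right singular vectors are the columns of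
    [ctrmx V]. *)
Record svd g U V s : Prop := {
  svd_left : ctrmx U *m U = 1%:M;
  svd_right : V *m ctrmx V = 1%:M;
  svd_size : size s = d;
  svd_sorted : sorted >=%O s;
  svd_ge0 : all (>= 0) s;
  svd_eq : g = U *m seq_diag s *m V }.

Lemma seq_ge0 s i : all (>= 0) s -> 0 <= s`_i.
Proof.
move=> s0; have [lt_is|si] := ltnP i (size s); last by rewrite nth_default.
exact: (allP s0) (mem_nth 0 lt_is).
Qed.

Lemma sorted_ge s i j : sorted >=%O s -> all (>= 0) s -> (i <= j)%N -> s`_j <= s`_i.
Proof.
move=> ss s0 ij; have [js|sj] := ltnP j (size s); last by rewrite nth_default// seq_ge0.
have trans : transitive (>=%O : rel K) by move=> y x z /= xy yz; exact: le_trans yz xy.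
by apply: (sorted_leq_nth trans (@lexx _ _) 0 ss) => //; rewrite inE (leq_ltn_trans ij).
Qed.

Lemma seq_diag_sqr s : seq_diag s *m seq_diag s = diag_mx (\row_i (map (fun x => x ^+ 2) s)`_i).
Proof.
rewrite /seq_diag mulmx_diag; congr diag_mx; apply/rowP => i; rewrite !mxE.
have [lt_is|si] := ltnP i (size s); first by rewrite (nth_map 0).
by rewrite !nth_default ?size_map// mulr0.
Qed.

Lemma ctrmx_seq_diag s : all (>= 0) s -> ctrmx (seq_diag s) = seq_diag s.
Proof. by move=> s0; apply: ctrmx_diag => i; rewrite mxE seq_ge0. Qed.

Lemma svd_ex g s : g \in unitmx -> singular_spec g s -> exists U V, svd g U V s.
Proof.
move=> ug [ss s0 pg].
pose s2 := map (fun x => x ^+ 2) s.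
have s20 : all (>= 0) s2 by rewrite all_map; apply/allP => x xs /=; apply: exprn_ge0; exact: (allP s0).
have hA : ctrmx (g *m ctrmx g) = g *m ctrmx g by rewrite (ctrmxM hK) (ctrmxK hK).
have pA : char_poly (g *m ctrmx g) = \prod_(x <- s2) ('X - x%:P) by rewrite big_map.
have [U UU AE] := spectral hK hA s20 pA.
have UU' := ctrmx_unitary UU.
have uU : U \in unitmx by have [] := mulmx1_unit UU'.
have uU' : ctrmx U \in unitmx by have [] := mulmx1_unit UU'.
rewrite -seq_diag_sqr in AE; set D := seq_diag s in AE.
have cD : ctrmx D = D by exact: ctrmx_seq_diag.
have ug' : ctrmx g \in unitmx.
  have := congr1 (@ctrmx _ _ _) (mulmxV ug); rewrite (ctrmxM hK) ctrmx1.
  by move=> /mulmx1C/mulmx1_unit[].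
have uD : D \in unitmx.
  have : g *m ctrmx g \in unitmx by rewrite unitmx_mul ug.
  by rewrite AE !unitmx_mul uU uU' andbT /= => /andP[].
have sz : size s = d.
  by apply: succn_inj; rewrite -(size_char_poly (g *m ctrmx g)) pA size_prod_XsubC size_map.
pose E := invmx D; have DE : D *m ctrmx E = 1%:M.
  by apply: mulmx1C; rewrite -[X in _ *m X]cD -(ctrmxM hK) mulmxV// ctrmx1.
exists U, (E *m ctrmx U *m g); split=> //.
  rewrite !(ctrmxM hK) (ctrmxK hK) !mulmxA -[_ *m g *m ctrmx g]mulmxA AE !mulmxA.
  rewrite -[_ *m ctrmx U *m U]mulmxA UU mulmx1 -[_ *m ctrmx U *m U]mulmxA UU mulmx1.
  by rewrite mulVmx// mul1mx.
by rewrite -/D !mulmxA -[_ *m D *m E]mulmxA mulmxV// mulmx1 UU' mul1mx.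
Qed.

Lemma svd_spec g U V s : svd g U V s -> singular_spec g s.
Proof.
move=> [UU VV sz ss s0 ->]; split=> //.
have -> : U *m seq_diag s *m V *m conj_transpose (U *m seq_diag s *m V) =
    U *m (seq_diag s *m seq_diag s) *m ctrmx U.
  rewrite -[conj_transpose _]/(ctrmx _) !(ctrmxM hK) (ctrmx_seq_diag s0) !mulmxA.
  by rewrite -[_ *m V *m ctrmx V]mulmxA VV mulmx1.
rewrite (char_poly_conj _ UU) seq_diag_sqr char_poly_trig ?diag_mx_is_trig//.
rewrite -(big_map (fun x => x ^+ 2) xpredT (fun x => 'X - x%:P)) (big_nth 0) size_map sz big_mkord.
by apply: eq_bigr => i _; rewrite !mxE eqxx mulr1n.
Qed.

Lemma singular_spec_uniq g s t : singular_spec g s -> singular_spec g t -> s = t.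
Proof.
move=> [ss s0 ps] [st t0 pt].
have sq_sorted r : sorted >=%O r -> all (>= 0) r -> sorted >=%O (map (fun x => x ^+ 2) r).
  move=> sr r0; apply: (homo_sorted_in _ r0 sr) => x y /= x0 y0 xy.
  by rewrite lerXn2r.
have E : map (fun x => x ^+ 2) s = map (fun x => x ^+ 2) t.
  apply: (@sorted_eq _ >=%O).
  - by move=> y x z /= xy yz; exact: le_trans yz xy.
  - by move=> x y /= xy; apply: le_anti; rewrite andbC.
  - exact: sq_sorted.
  - exact: sq_sorted.
  - by apply: prod_XsubC_eq; rewrite !big_map -ps -pt.
have sz : size s = size t by rewrite -(size_map (fun x => x ^+ 2)) E size_map.
apply: (@eq_from_nth _ 0 _ _ sz) => i si.
have := congr1 (fun r => r`_i) E; rewrite /= !(nth_map 0) -?sz// => /eqP.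
by rewrite eqrXn2 ?seq_ge0// => /eqP.
Qed.

Lemma singular_valuesE g U V s : svd g U V s -> singular_values g = s.
Proof.
move=> /svd_spec gs; apply: xget_unique => // t gt.
exact: singular_spec_uniq gt gs.
Qed.

(** In the coordinates [ctrmx U *m v], an eigenspace of [g g*] consists of the vectors supported
    where [s_i ^ 2] is the eigenvalue. Indices of [s] start at 0, so the hypothesis is a gap between
    the singular values numbered [j] and [j + 1]; it confines the first [j] eigenvalues to the first
    [j] coordinates. *)
Lemma Uspace_svd g U V s j : svd g U V s -> (0 < j)%N -> (j < d)%N ->
  s`_j < s`_j.-1 -> Uspace j g = column_space (U *m (pid_mx j : 'M_(d, j))).
Proof.
move=> gs j0 jd gap; have [UU VV sz ss s0 gE] := gs.
have UU' := ctrmx_unitary UU.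
pose s2 := \row_(i < d) (map (fun x => x ^+ 2) s)`_i.
have AE : g *m conj_transpose g = U *m diag_mx s2 *m ctrmx U.
  rewrite -seq_diag_sqr gE -[conj_transpose _]/(ctrmx _) !(ctrmxM hK) (ctrmx_seq_diag s0) !mulmxA.
  by rewrite -[_ *m V *m ctrmx V]mulmxA VV mulmx1.
have s2E (i : 'I_d) : s2 0 i = s`_i ^+ 2 by rewrite mxE (nth_map 0) ?sz.
have eigP a v : (v \in passmx.leigenspace
    (linfun (mulmx (g *m conj_transpose g) : 'cV[K]_d -> 'cV[K]_d)) a) <->
    (forall i : 'I_d, (s`_i ^+ 2 - a) * (ctrmx U *m v) i 0 = 0).
  have -> : (v \in passmx.leigenspace
      (linfun (mulmx (g *m conj_transpose g) : 'cV[K]_d -> 'cV[K]_d)) a) =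
      (diag_mx s2 *m (ctrmx U *m v) == a *: (ctrmx U *m v)).
    rewrite memv_ker add_lfunE opp_lfunE scale_lfunE id_lfunE lfunE /= subr_eq0 AE.
    apply/eqP/eqP => [E|E].
      by rewrite scalemxAr -E !mulmxA UU mul1mx.
    by rewrite -!mulmxA E -scalemxAr mulmxA UU' mul1mx.
  split=> [/eqP E i|E].
    have := congr1 (fun w : 'cV_d => w i 0) E; rewrite mul_diag_mx !mxE -/s2 => Ei.
    by rewrite mulrBl; apply/eqP; rewrite subr_eq0 -Ei (nth_map 0) ?sz// mxE.
  apply/eqP/colP => i; rewrite mul_diag_mx !mxE (nth_map 0) ?sz//.
  by have /eqP := E i; rewrite mulrBl subr_eq0 mxE => /eqP.
have sig i : sigma i.+1 g = s`_i by rewrite /sigma (singular_valuesE gs).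
apply/eqP; rewrite eqEsubv; apply/andP; split.
  apply/subv_sumP => i _; apply/subvP => v /eigP vi; rewrite sig in vi.
  apply/column_spaceP; exists ((pid_mx j : 'M_(j, d)) *m (ctrmx U *m v)).
  rewrite -mulmxA [_ *m (_ *m (ctrmx U *m v))]mulmxA pid_mx_id//.
  suff -> : (pid_mx j : 'M_d) *m (ctrmx U *m v) = ctrmx U *m v by rewrite mulmxA UU' mul1mx.
  apply/colP => l; rewrite [LHS]mxE (bigD1 l)//= big1 ?addr0 => [|m ml]; last first.
    by rewrite mxE (val_eqE l m) eq_sym (negbTE ml) mul0r.
  rewrite mxE eqxx /=; have [lj|jl] := ltnP l j; first by rewrite mul1r.
  have /eqP := vi l; rewrite mul0r mulf_eq0 => /orP[|/eqP->//].
  rewrite subr_eq0 eqrXn2 ?seq_ge0// => /eqP E.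
  have := lt_le_trans gap (sorted_ge ss s0 (_ : (i <= j.-1)%N)).
  rewrite -ltnS prednK// ltn_ord -E => /(_ isT).
  by move=> /lt_le_trans/(_ (sorted_ge ss s0 jl)); rewrite ltxx.
apply/subvP => _ /column_spaceP[w ->].
have -> : U *m pid_mx j *m w = \sum_i w i 0 *: col i (U *m pid_mx j).
  apply/colP => l; rewrite [LHS]mxE summxE; apply: eq_bigr => i _.
  by rewrite !mxE mulrC.
apply: memv_sumr => i _; apply: rpredZ; apply/eigP => l.
rewrite sig colE !mulmxA UU mul1mx -colE !mxE.
case: eqP => [->|_]; first by rewrite subrr mul0r.
by rewrite mulr0.
Qed.

End SVD.

(** * Limits of matrices, subspaces and flags *)

Section MatrixLimits.
Variable K : numFieldType.
Context {T : Type} {F : set_system T} {FF : Filter F}.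

Lemma cvg_mxP m n (f : T -> 'M[K]_(m, n)) (A : 'M[K]_(m, n)) :
  f t @[t --> F] --> A <-> forall i j, f t i j @[t --> F] --> A i j.
Proof.
split=> [fA i j B nB|H B [P nP PB]].
  pose Q (i' : 'I_m) (j' : 'I_n) := if (i' == i) && (j' == j) then B else setT.
  have /fA : nbhs A [set N : 'M[K]_(m, n) | forall i j, Q i j (N i j)].
    exists Q => // i' j'; rewrite /Q; case: ifP => [/andP[/eqP-> /eqP->]//|_].
    exact: filterT.
  by rewrite /= /nbhs/=; apply: filterS => t /(_ i j); rewrite /Q !eqxx.
have : \forall t \near F, forall i j, P i j (f t i j).
  apply: filter_forall => i; apply: filter_forall => j.
  exact: H (nP i j).
by apply: filterS => t Pt; apply: PB.
Qed.

Lemma cvg_sum (I : Type) (r : seq I) (f : I -> T -> K) (l : I -> K) :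
  (forall i, f i t @[t --> F] --> l i) ->
  \sum_(i <- r) f i t @[t --> F] --> \sum_(i <- r) l i.
Proof.
move=> fl; elim: r => [|i r IH].
  by rewrite big_nil; under eq_fun do rewrite big_nil; exact: cvg_cst.
by rewrite big_cons; under eq_fun do rewrite big_cons; exact: cvgD.
Qed.

Lemma cvg_prod (I : Type) (r : seq I) (f : I -> T -> K) (l : I -> K) :
  (forall i, f i t @[t --> F] --> l i) ->
  \prod_(i <- r) f i t @[t --> F] --> \prod_(i <- r) l i.
Proof.
move=> fl; elim: r => [|i r IH].
  by rewrite big_nil; under eq_fun do rewrite big_nil; exact: cvg_cst.
by rewrite big_cons; under eq_fun do rewrite big_cons; exact: cvgM.
Qed.

Lemma cvg_mulmx m n p (f : T -> 'M[K]_(m, n)) (g : T -> 'M[K]_(n, p))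
    (A : 'M[K]_(m, n)) (B : 'M[K]_(n, p)) :
  f t @[t --> F] --> A -> g t @[t --> F] --> B ->
  f t *m g t @[t --> F] --> A *m B.
Proof.
move=> /cvg_mxP fA /cvg_mxP gB; apply/cvg_mxP => i j.
rewrite mxE; under eq_fun do rewrite mxE.
by apply: cvg_sum => l; apply: cvgM.
Qed.

Lemma cvg_row_mx m n1 n2 (f : T -> 'M[K]_(m, n1)) (g : T -> 'M[K]_(m, n2))
    (A : 'M[K]_(m, n1)) (B : 'M[K]_(m, n2)) :
  f t @[t --> F] --> A -> g t @[t --> F] --> B ->
  row_mx (f t) (g t) @[t --> F] --> row_mx A B.
Proof.
move=> /cvg_mxP fA /cvg_mxP gB; apply/cvg_mxP => i j; rewrite mxE.
under eq_fun do rewrite mxE.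
by case: (fintype.split j) => l; [exact: fA|exact: gB].
Qed.

Lemma cvg_det n (f : T -> 'M[K]_n) (A : 'M[K]_n) :
  f t @[t --> F] --> A -> \det (f t) @[t --> F] --> \det A.
Proof.
move=> /cvg_mxP fA; rewrite /determinant; apply: cvg_sum => s.
apply: cvgM; first exact: cvg_cst.
by apply: cvg_prod => i; exact: fA.
Qed.

Lemma near_unitmx n (f : T -> 'M[K]_n) (A : 'M[K]_n) :
  A \in unitmx -> f t @[t --> F] --> A -> \forall t \near F, f t \in unitmx.
Proof.
move=> uA /cvg_det fA; have dA : \det A != 0 by rewrite -unitfE -unitmxE.
have /cvgrPdist_lt/(_ `|\det A|) := fA; rewrite normr_gt0 => /(_ dA).
apply: filterS => t; rewrite unitmxE unitfE.
by apply: contraTneq => ->; rewrite subr0 ltxx.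
Qed.

Lemma cvg_invmx n (f : T -> 'M[K]_n) (A : 'M[K]_n) :
  A \in unitmx -> f t @[t --> F] --> A -> invmx (f t) @[t --> F] --> invmx A.
Proof.
move=> uA fA; have dA : \det A != 0 by rewrite -unitfE -unitmxE.
have E : \forall t \near F, (\det (f t))^-1 *: \adj (f t) = invmx (f t).
  by apply: filterS (near_unitmx uA fA) => t ut; rewrite /invmx ut.
apply: cvg_trans (near_eq_cvg E) _.
rewrite /invmx uA; apply/cvg_mxP => i j; rewrite mxE; under eq_fun do rewrite mxE.
apply: cvgM; first by apply: cvgV => //; exact: cvg_det.
rewrite mxE; under eq_fun do rewrite mxE.
rewrite /cofactor; apply: cvgM; first exact: cvg_cst.
apply: cvg_det; apply/cvg_mxP => k l; rewrite !mxE; under eq_fun do rewrite !mxE.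
exact: (cvg_mxP _ _).1.
Qed.

Lemma near_rank d k (f : T -> 'M[K]_(d, k)) (M : 'M[K]_(d, k)) :
  \rank M = k -> f t @[t --> F] --> M -> \forall t \near F, \rank (f t) = k.
Proof.
move=> /mulmx_left_inverse[L LM] fM.
have : \forall t \near F, L *m f t \in unitmx.
  apply: (@near_unitmx _ _ (L *m M)); first by rewrite LM unitmx1.
  apply: cvg_mulmx => //; exact: cvg_cst.
apply: filterS => t ut; apply: (@left_inverse_rank _ _ _ _ (invmx (L *m f t) *m L)).
by rewrite -mulmxA mulVmx.
Qed.

Lemma near_rank_row d k (f : T -> 'M[K]_(d, k)) (M : 'M[K]_(d, k)) :
  \rank M = d -> f t @[t --> F] --> M -> \forall t \near F, \rank (f t) = d.
Proof.
move=> rM fM.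
have : \forall t \near F, \rank (f t)^T = d.
  apply: (@near_rank _ _ _ M^T); first by rewrite mxrank_tr.
  apply/cvg_mxP => i j; rewrite mxE; under eq_fun do rewrite mxE.
  exact: (cvg_mxP _ _).1.
by apply: filterS => t; rewrite mxrank_tr.
Qed.

End MatrixLimits.

(** * The Grassmannian as a quotient of spaces of frames *)

Section GrassTopology.
Variables (K : numFieldType) (d : nat).

Lemma cvg_column_space (T : Type) (F : set_system T) {FF : Filter F} k
    (f : T -> 'M[K]_(d, k)) (M : 'M[K]_(d, k)) :
  \rank M = k -> f t @[t --> F] --> M -> column_space (f t) @[t --> F] --> column_space M.
Proof.
move=> rM fM U; rewrite /= nbhsE => -[V [oV VM] VU].
have := oV k M rM VM => /fM VfM.
by apply: filterS2 (near_rank rM fM) VfM => t rt Vt; apply/VU/Vt.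
Qed.

(** The normalisation [L *m N = 1%:M] selects one frame in each subspace of dimension [k] that [L]
    maps isomorphically onto [K^k]. These are the affine charts of the Grassmannian. *)
Lemma frame_uniq k (L : 'M[K]_(k, d)) (N N' : 'M[K]_(d, k)) :
  L *m N = 1%:M -> L *m N' = 1%:M -> column_space N = column_space N' -> N = N'.
Proof.
move=> LN LN' /column_space_eqP[[Y NE] _].
by move: LN; rewrite NE mulmxA LN' mul1mx => ->; rewrite mulmx1.
Qed.

(** Openness is tested on arbitrary frames [M'']; the normalised frame [M'' (L M'')^-1] spans the
    same subspace and depends continuously on [M'']. *)
Lemma chart_open k (L : 'M[K]_(k, d)) (P : set 'M[K]_(d, k)) : open P ->
  open [set V : grass K d | exists N, [/\ L *m N = 1%:M, V = column_space N & P N]].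
Proof.
move=> oP; apply: (_ : grass_open _) => k' M' rM' [N [LN M'N PN]].
have ekk : k' = k by rewrite -rM' -dim_column_space M'N dim_column_space (left_inverse_rank LN).
subst k'; have [[Z M'E] [Y NE]] := (column_space_eqP _ _).1 M'N.
have LM' : L *m M' = Z by rewrite M'E mulmxA LN mul1mx.
have ZY : Z *m Y = 1%:M by rewrite -LM' -mulmxA -NE.
have uZ : Z \in unitmx by have [] := mulmx1_unit ZY.
have FM : Filter (nbhs M') by exact: nbhs_filter.
have cM : M'' @[M'' --> M'] --> M' by move=> A nA.
have cLM : L *m M'' @[M'' --> M'] --> Z.
  by rewrite -LM'; apply: (cvg_mulmx (F := nbhs M')) => //; exact: cvg_cst.
have cf : M'' *m invmx (L *m M'') @[M'' --> M'] --> N.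
  have -> : N = M' *m invmx Z by rewrite M'E mulmxK.
  by apply: (cvg_mulmx (F := nbhs M')) => //; apply: cvg_invmx.
have nP : nbhs N P by apply: open_nbhs_nbhs.
apply: filterS2 (near_unitmx uZ cLM) (cf _ nP) => M'' uM'' PM'' _.
exists (M'' *m invmx (L *m M'')); split=> //; first by rewrite mulmxA mulmxV.
by rewrite column_space_mulr// unitmx_inv.
Qed.

(** Limits in the quotient topology lift to limits of normalised frames. The default [M] of [xget]
    only occurs where [V_ t] lies outside the chart. *)
Lemma cvg_grass_lift (T : Type) (F : set_system T) {FF : Filter F} k
    (V_ : T -> grass K d) (L : 'M[K]_(k, d)) (M : 'M[K]_(d, k)) :
  L *m M = 1%:M -> V_ t @[t --> F] --> column_space M ->
  exists2 N_ : T -> 'M[K]_(d, k), N_ t @[t --> F] --> M &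
    \forall t \near F, L *m N_ t = 1%:M /\ V_ t = column_space (N_ t).
Proof.
move=> LM VM; pose S t := [set N : 'M[K]_(d, k) | L *m N = 1%:M /\ V_ t = column_space N].
have near_chart (P : set 'M[K]_(d, k)) : nbhs M P ->
    \forall t \near F, exists2 N, S t N & P N.
  rewrite nbhsE => -[Q [oQ QM] QP].
  have oC := chart_open (L := L) oQ.
  set C := (X in open X) in oC.
  have VF : F (V_ @^-1` C).
    by apply: VM; apply: open_nbhs_nbhs; split; [exact: oC|exists M; split].
  by apply: filterS VF => t [N [LN VN /QP PN]]; exists N.
have S_uniq t N N' : S t N -> S t N' -> N = N'.
  by move=> [LN VN] [LN' VN']; apply: frame_uniq LN LN' _; rewrite -VN.
exists (fun t => xget M (S t)).
  move=> P /near_chart; apply: filterS => t [N SN PN].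
  by rewrite /= (xget_unique M SN)// => N' SN'; exact: S_uniq SN' SN.
apply: filterS (near_chart setT filterT) => t [N SN _].
by rewrite (xget_unique M SN)// => N' SN'; exact: S_uniq SN' SN.
Qed.

Lemma cvg_grass_lift_ex (T : Type) (F : set_system T) {FF : Filter F} k
    (V_ : T -> grass K d) (V : grass K d) :
  \dim V = k -> V_ t @[t --> F] --> V ->
  exists N_ (M : 'M[K]_(d, k)), [/\ \rank M = k, V = column_space M,
    N_ t @[t --> F] --> M & \forall t \near F, \rank (N_ t) = k /\ V_ t = column_space (N_ t)].
Proof.
move=> /grass_frame_dim[M rM <-] VM; have [L LM] := mulmx_left_inverse rM.
have [N_ NM nN] := cvg_grass_lift LM VM.
exists N_, M; split=> //; apply: filterS nN => t [LN VN]; split=> //.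
exact: left_inverse_rank LN.
Qed.

(** With [W_ t] written by its normalised frame [M_ t], inclusion becomes the closed condition
    [M_ t L N_ t = N_ t]. Applied in both directions it yields uniqueness of limits. *)
Lemma cvg_grass_sub (T : Type) (F : set_system T) {FF : ProperFilter F}
    (V_ W_ : T -> grass K d) (V W : grass K d) :
  V_ t @[t --> F] --> V -> W_ t @[t --> F] --> W ->
  (\forall t \near F, (V_ t <= W_ t)%VS) -> (V <= W)%VS.
Proof.
move=> VV WW VW.
have [k kV] : exists k, \dim V = k by exists (\dim V).
have [l lW] : exists l, \dim W = l by exists (\dim W).
have [N_ [N [rN VN NN nN]]] := cvg_grass_lift_ex kV VV; rewrite {}VN in kV VV *.
have [M LM EM] := grass_frame_dim lW.
have [L {}LM] := mulmx_left_inverse LM; rewrite -{}EM in WW lW *.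
have [M_ MM nM] := cvg_grass_lift LM WW.
apply/column_spaceS; exists (L *m N).
have E : \forall t \near F, M_ t *m (L *m N_ t) = N_ t.
  apply: filterS3 VW nN nM => t VWt [_ VN] [LMt WM].
  move: VWt; rewrite VN WM => /column_spaceS[Y ->].
  by rewrite !mulmxA -[_ *m L *m _]mulmxA LMt mulmx1.
have h1 : M_ t *m (L *m N_ t) @[t --> F] --> M *m (L *m N).
  by apply: cvg_mulmx => //; apply: cvg_mulmx => //; exact: cvg_cst.
have h2 : M_ t *m (L *m N_ t) @[t --> F] --> N.
  exact: cvg_trans (near_eq_cvg (filterS (fun t => @esym _ _ _) E)) NN.
apply/matrixP => i j.
move/cvg_mxP: h1 => /(_ i j) h1; move/cvg_mxP: h2 => /(_ i j) h2.
exact: (cvg_unique (@norm_hausdorff K K) h2 h1).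
Qed.

Lemma cvg_grass_unique (T : Type) (F : set_system T) {FF : ProperFilter F}
    (V_ : T -> grass K d) (V W : grass K d) :
  V_ t @[t --> F] --> V -> V_ t @[t --> F] --> W -> V = W.
Proof.
move=> VV WW; apply/eqP; rewrite eqEsubv.
by rewrite (cvg_grass_sub VV WW) ?(cvg_grass_sub WW VV)//; near=> t; exact: subvv.
Unshelve. all: by end_near. Qed.

End GrassTopology.

(** * The flag space: compactness and the linear action *)

Section Flags.
Variable K : numFieldType.
Hypothesis hK : real_complex_like K.
Variables (d k : nat).
Implicit Types x y : flag K d k.

Lemma flag_setP x : flag_set k (val x).
Proof. exact: set_mem (valP x). Qed.

Lemma flag_dim1 x : \dim (val x).1 = k. Proof. by have [] := flag_setP x. Qed.
Lemma flag_dim2 x : \dim (val x).2 = (d - k)%N. Proof. by have [] := flag_setP x. Qed.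
Lemma flag_sub x : ((val x).1 <= (val x).2)%VS. Proof. by have [] := flag_setP x. Qed.

Lemma val_flag_insubd x (VW : grass K d * grass K d) :
  flag_set k VW -> val (insubd x VW : flag K d k) = VW.
Proof. by move=> h; rewrite val_insubd; case: ifP => // /negP[]; exact: mem_set. Qed.

Lemma cvg_flagP (T : Type) (F : set_system T) {FF : Filter F} (x_ : T -> flag K d k) x :
  x_ t @[t --> F] --> x <->
  (val (x_ t)).1 @[t --> F] --> (val x).1 /\ (val (x_ t)).2 @[t --> F] --> (val x).2.
Proof.
split=> [xx|[h1 h2]].
  have h : val (x_ t) @[t --> F] --> val x.
    by apply: (continuous_cvg _ _ xx); exact: initial_continuous.
  by split; [exact: cvg_comp h cvg_fst|exact: cvg_comp h cvg_snd].
have h : val (x_ t) @[t --> F] --> val x.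
  rewrite (surjective_pairing (val x)) (_ : (fun t => val (x_ t)) =
    fun t => ((val (x_ t)).1, (val (x_ t)).2)); first exact: (cvg_pair h1 h2).
  by apply/funext => t; rewrite -surjective_pairing.
move=> U; rewrite /= nbhsE => -[V [[W oW WV] Vx] VU].
have nW : nbhs (val x) W by apply: open_nbhs_nbhs; split=> //; rewrite -WV in Vx.
have WF : F [set t | W (val (x_ t))] := h _ nW.
by apply: filterS WF => t Wt; apply: VU; rewrite -WV; exact: Wt.
Qed.

Lemma flag_cvg_unique (T : Type) (F : set_system T) {FF : ProperFilter F}
    (x_ : T -> flag K d k) x y :
  x_ t @[t --> F] --> x -> x_ t @[t --> F] --> y -> x = y.
Proof.
move=> /cvg_flagP[x1 x2] /cvg_flagP[y1 y2]; apply: val_inj.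
by rewrite [val x]surjective_pairing [val y]surjective_pairing
  (cvg_grass_unique x1 y1) (cvg_grass_unique x2 y2).
Qed.

Lemma grass_first_countable : first_countable (grass K d).
Proof.
move=> V; have [M rM MV] := grass_frame V.
have [L LM] := mulmx_left_inverse rM; rewrite -MV.
have fcK : first_countable K by apply: pseudometric_first_countable; exact: inv_lt hK.
have /choice[b bP] ij : exists b : nat -> set K, (forall n, open_nbhs (M ij.1 ij.2) (b n)) /\
    forall y : nat -> K, (forall n, b n (y n)) -> y n @[n --> \oo] --> M ij.1 ij.2.
  have [b nb bP] := fcK (M ij.1 ij.2).
  exists (fun n => (b n)^°); split=> [n|y yb]; last by apply: bP => n; exact: interior_subset.
  by split; [exact: open_interior|exact: nb].
exists (fun n => [set V : grass K d | exists N, [/\ L *m N = 1%:M, V = column_space N &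
    [set N | forall i j, b (i, j) n (N i j)] N]]).
  move=> n; have oP : open [set N : 'M[K]_(d, \dim V) | forall i j, b (i, j) n (N i j)].
    rewrite openE => N bN; exists (fun i j => b (i, j) n) => // i j.
    by apply: open_nbhs_nbhs; split; [exact: ((bP (i, j)).1 n).1|exact: bN].
  have oC := chart_open (L := L) oP; apply: open_nbhs_nbhs; split; first exact: oC.
  by exists M; split=> // i j; have [] := (bP (i, j)).1 n.
move=> y /choice[N NP].
have NM : N n @[n --> \oo] --> M.
  apply/cvg_mxP => i j; apply: (bP (i, j)).2 => n.
  by have [_ _] := NP n; exact.
have -> : y = (fun n => column_space (N n)) by apply/funext => n; have [] := NP n.
exact: cvg_column_space.
Qed.

Lemma flag_first_countable : first_countable (flag K d k).
Proof.
move=> x; have [b1 nb1 b1P] := grass_first_countable (val x).1.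
have [b2 nb2 b2P] := grass_first_countable (val x).2.
exists (fun n => [set y : flag K d k | b1 n (val y).1 /\ b2 n (val y).2]).
  move=> n; have /cvg_flagP[h1 h2] : y @[y --> x] --> x by move=> A nA.
  by apply: filterI; [exact: h1 (nb1 n)|exact: h2 (nb2 n)].
move=> y yb; apply/cvg_flagP; split; [apply: b1P|apply: b2P] => n.
  by have [] := yb n.
by have [] := yb n.
Qed.

Lemma mx_bolzano_weierstrass m n (u : nat -> 'M[K]_(m, n)) (b : K) :
  (forall t i j, `|u t i j| <= b) ->
  exists phi (A : 'M[K]_(m, n)), subsequence phi /\ u (phi t) @[t --> \oo] --> A.
Proof.
move=> ub.
have [phi hphi phiP] : exists2 phi, subsequence phi &
    forall ij, exists l : K, u (phi t) ij.1 ij.2 @[t --> \oo] --> l.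
  suff H (r : seq ('I_m * 'I_n)) : exists2 phi, subsequence phi &
      forall ij, ij \in r -> exists l : K, u (phi t) ij.1 ij.2 @[t --> \oo] --> l.
    have [phi hphi phiP] := H (index_enum _).
    by exists phi => // ij; apply: phiP; rewrite mem_index_enum.
  elim: r => [|ij r [phi hphi phiP]]; first by exists id.
  have [psi [l [hpsi lP]]] := bounded_subsequence hK (fun t => ub (phi t) ij.1 ij.2).
  exists (phi \o psi); first exact: subsequence_comp.
  move=> ij'; rewrite inE => /orP[/eqP->|/phiP[l' l'P]]; first by exists l.
  by exists l'; exact: cvg_subsequence hpsi l'P.
have /choice[l lP] := phiP.
exists phi, (\matrix_(i, j) l (i, j)); split=> //.
by apply/cvg_mxP => i j; rewrite mxE; exact: lP (i, j).
Qed.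

Lemma norm_conjK (z : K) : `|conjK z| = `|z|.
Proof.
rewrite /conjK normrM normfV normrX normr_id; have [->|z0] := eqVneq z 0.
  by rewrite normr0 invr0 mulr0.
by rewrite expr2 mulfK// normr_eq0.
Qed.

Lemma cvg_ctrmx (T : Type) (F : set_system T) {FF : Filter F} m n
    (f : T -> 'M[K]_(m, n)) (A : 'M[K]_(m, n)) :
  f t @[t --> F] --> A -> ctrmx (f t) @[t --> F] --> ctrmx A.
Proof.
move=> /cvg_mxP fA; apply/cvg_mxP => i j; rewrite !mxE; under eq_fun do rewrite !mxE.
apply/cvgrPdist_lt => e e0; have /cvgrPdist_lt/(_ e e0) := fA j i.
apply: filterS => t; rewrite -(norm_conjK (_ - _)) (conjKD hK).
have -> // : conjK (- f t j i) = - conjK (f t j i).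
by apply/eqP; rewrite -addr_eq0 -(conjKD hK) addNr conjK0.
Qed.

Lemma orthonormal_norm_le m n (E : 'M[K]_(m, n)) i j :
  ctrmx E *m E = 1%:M -> `|E i j| <= 1.
Proof.
move=> EE; have := ctrmx_mul_diag E j; rewrite EE !mxE eqxx mulr1n (bigD1 i)//= => e1.
rewrite -(@expr_le1 _ 2)// [leRHS]e1 lerDl; apply: sumr_ge0 => l _.
by rewrite exprn_ge0.
Qed.

Lemma grass_orthonormal_frame (V : grass K d) l : \dim V = l ->
  exists2 E : 'M[K]_(d, l), ctrmx E *m E = 1%:M & column_space E = V.
Proof.
move=> /grass_frame_dim[M rM <-]; have [T uT E] := gram_schmidt hK rM.
by exists (M *m T) => //; rewrite column_space_mulr.
Qed.

(** Orthonormal frames have bounded entries, and a limit of orthonormal frames is orthonormal, so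
    the rank does not drop. *)
Lemma grass_subsequence (V_ : nat -> grass K d) l : (forall n, \dim (V_ n) = l) ->
  exists phi (V : grass K d), [/\ subsequence phi, \dim V = l & V_ (phi n) @[n --> \oo] --> V].
Proof.
move=> dV; have /choice[E EP] n : exists E : 'M[K]_(d, l),
    ctrmx E *m E = 1%:M /\ column_space E = V_ n.
  by have [E ? ?] := grass_orthonormal_frame (dV n); exists E.
have [|phi [A [hphi EA]]] := @mx_bolzano_weierstrass _ _ E 1.
  by move=> n i j; apply: orthonormal_norm_le; have [] := EP n.
have AA : ctrmx A *m A = 1%:M.
  have h : ctrmx (E (phi n)) *m E (phi n) @[n --> \oo] --> ctrmx A *m A.
    by apply: cvg_mulmx => //; exact: cvg_ctrmx.
  have E1 : (fun n => ctrmx (E (phi n)) *m E (phi n)) = fun=> 1%:M.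
    by apply/funext => n; have [] := EP (phi n).
  rewrite E1 in h; apply/matrixP => i j; move/cvg_mxP: h => /(_ i j) h.
  exact: (cvg_unique (@norm_hausdorff K K) h (cvg_cst _)).
have rA := left_inverse_rank AA.
exists phi, (column_space A); split=> //; first by rewrite dim_column_space.
have -> : (fun n => V_ (phi n)) = fun n => column_space (E (phi n)).
  by apply/funext => n; have [] := EP (phi n).
exact: cvg_column_space.
Qed.

Lemma flag_subsequence (x_ : nat -> flag K d k) :
  exists phi x, subsequence phi /\ x_ (phi n) @[n --> \oo] --> x.
Proof.
have [phi [V [hphi dV VV]]] := grass_subsequence (fun n => flag_dim1 (x_ n)).
have [psi [W [hpsi dW WW]]] := grass_subsequence (fun n => flag_dim2 (x_ (phi n))).
have {}VV := cvg_subsequence hpsi VV.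
have VW : flag_set k (V, W).
  split=> //; apply: (cvg_grass_sub VV WW); near=> n; exact: flag_sub.
exists (phi \o psi), (insubd (x_ 0%N) (V, W)); split; first exact: subsequence_comp.
by apply/cvg_flagP; rewrite val_flag_insubd.
Unshelve. all: by end_near. Qed.

Lemma flag_act_val (g : 'M[K]_d) x : g \in unitmx ->
  val (flag_act g x) = (grass_act g (val x).1, grass_act g (val x).2).
Proof.
move=> ug; apply: val_flag_insubd.
have dimg (V : grass K d) : \dim (grass_act g V) = \dim V.
  have [M rM MV] := grass_frame V; rewrite -{1}MV grass_act_column_space dim_column_space.
  by rewrite -mxrank_tr trmx_mul mxrankMfree ?mxrank_tr// row_free_unit unitmx_tr.
by split=> /=; rewrite ?dimg ?flag_dim1 ?flag_dim2//; apply: limgS; exact: flag_sub.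
Qed.

Lemma flag_actM (g h : 'M[K]_d) x : g \in unitmx -> h \in unitmx ->
  flag_act (g *m h) x = flag_act g (flag_act h x).
Proof.
move=> ug uh; apply: val_inj; rewrite !flag_act_val ?unitmx_mul ?ug//=.
have actM (V : grass K d) : grass_act (g *m h) V = grass_act g (grass_act h V).
  have [M rM <-] := grass_frame V.
  by rewrite !grass_act_column_space mulmxA.
by rewrite !actM.
Qed.

Lemma flag_act1 x : flag_act 1%:M x = x.
Proof.
apply: val_inj; rewrite flag_act_val ?unitmx1// [RHS]surjective_pairing.
have act1 (V : grass K d) : grass_act 1%:M V = V.
  by have [M rM <-] := grass_frame V; rewrite grass_act_column_space mul1mx.
by rewrite !act1.
Qed.

Lemma cvg_flag_act (T : Type) (F : set_system T) {FF : Filter F} (g : 'M[K]_d)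
    (x_ : T -> flag K d k) x : g \in unitmx ->
  x_ t @[t --> F] --> x -> flag_act g (x_ t) @[t --> F] --> flag_act g x.
Proof.
move=> ug /cvg_flagP[x1 x2]; apply/cvg_flagP.
have cact (V_ : T -> grass K d) V : V_ t @[t --> F] --> V ->
    grass_act g (V_ t) @[t --> F] --> grass_act g V.
  move=> VV; have [l lV] : exists l, \dim V = l by exists (\dim V).
  have [N_ [N [rN -> NN nN]]] := cvg_grass_lift_ex lV VV.
  rewrite grass_act_column_space.
  have E : \forall t \near F, column_space (g *m N_ t) = grass_act g (V_ t).
    by apply: filterS nN => t [_ ->]; rewrite grass_act_column_space.
  apply: cvg_trans (near_eq_cvg E) _; apply: cvg_column_space.
    by rewrite -mxrank_tr trmx_mul mxrankMfree ?mxrank_tr// row_free_unit unitmx_tr.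
  by apply: cvg_mulmx => //; exact: cvg_cst.
rewrite flag_act_val//; under eq_fun do rewrite flag_act_val//.
by split; [exact: cact|under eq_fun do rewrite flag_act_val//; exact: cact].
Qed.

End Flags.

(** * Transversality is open and dense *)

Section Transversality.
Variable K : numFieldType.
Hypothesis hK : real_complex_like K.
Variables (d k : nat).
Hypothesis hkd : (2 * k <= d)%N.
Implicit Types x y : flag K d k.

Lemma complementaryP (V W : grass K d) : (\dim V + \dim W = d)%N ->
  complementary V W <-> (V + W)%VS = fullv.
Proof.
move=> dVW; split=> [[]//|VW]; split=> //.
apply/eqP; rewrite -dimv_eq0 -(eqn_add2l (\dim (V + W)%VS)) dimv_sum_cap dVW VW addn0.
by rewrite dimvf /dim /= muln1.
Qed.

Lemma transverseP x y : transverse x y <->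
  ((val x).1 + (val y).2)%VS = fullv /\ ((val y).1 + (val x).2)%VS = fullv.
Proof.
have dk : (k + (d - k) = d)%N by lia.
by rewrite /transverse !complementaryP ?flag_dim1 ?flag_dim2.
Qed.

Lemma near_full (T : Type) (F : set_system T) {FF : Filter F}
    (V_ W_ : T -> grass K d) (V W : grass K d) :
  V_ t @[t --> F] --> V -> W_ t @[t --> F] --> W -> (V + W)%VS = fullv ->
  \forall t \near F, (V_ t + W_ t)%VS = fullv.
Proof.
move=> VV WW.
have [l lV] : exists l, \dim V = l by exists (\dim V).
have [m mW] : exists m, \dim W = m by exists (\dim W).
have [N_ [N [_ -> NN nN]]] := cvg_grass_lift_ex lV VV.
have [M_ [M [_ -> MM nM]]] := cvg_grass_lift_ex mW WW.
rewrite -column_space_row => /column_space_full rNM.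
have nr : \forall t \near F, \rank (row_mx (N_ t) (M_ t)) = d.
  by apply: (near_rank_row rNM); exact: cvg_row_mx.
apply: filterS3 nN nM nr => t [_ ->] [_ ->] rt.
by rewrite -column_space_row; apply/column_space_full.
Qed.

Lemma near_transverse (T : Type) (F : set_system T) {FF : Filter F}
    (x_ y_ : T -> flag K d k) x y :
  x_ t @[t --> F] --> x -> y_ t @[t --> F] --> y -> transverse x y ->
  \forall t \near F, transverse (x_ t) (y_ t).
Proof.
move=> /cvg_flagP[x1 x2] /cvg_flagP[y1 y2] /transverseP[h1 h2].
by apply: filterS2 (near_full x1 y2 h1) (near_full y1 x2 h2) => t t1 t2; apply/transverseP.
Qed.

Lemma flag_frame x : exists (N : 'M[K]_(d, k)) (C : 'M[K]_(d, d - k - k)),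
  (val x).1 = column_space N /\ (val x).2 = column_space (row_mx N C).
Proof.
have [N rN NE] := grass_frame_dim (flag_dim1 x).
have Vcap : ((val x).2 :&: (val x).1)%VS = (val x).1.
  by apply/capv_idPr; exact: flag_sub.
have dC : \dim ((val x).2 :\: (val x).1)%VS = (d - k - k)%N.
  by have := dimv_cap_compl (val x).2 (val x).1; rewrite Vcap flag_dim1 flag_dim2; lia.
have [C rC CE] := grass_frame_dim dC.
exists N, C; split=> //; rewrite column_space_row NE CE addvC.
by rewrite -[in X in (_ + X)%VS]Vcap addv_diff_cap.
Qed.

(** [V] is a complement in [W] of the intersection of [W] with the larger space of [f]. That
    intersection has dimension [d - 2k], which leaves [k] for [V]. *)
Lemma ex_transverse f : exists y : flag K d k, transverse y f.
Proof.
pose W : grass K d := ((val f).1^C)%VS.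
pose V : grass K d := (W :\: (val f).2)%VS.
have df : \dim {:'cV[K]_d} = d by rewrite dimvf /dim /= muln1.
have dW : \dim W = (d - k)%N by rewrite dimv_compl flag_dim1 df.
have fW : ((val f).1 + W)%VS = fullv by exact: addv_complf.
have f2W : ((val f).2 + W)%VS = fullv.
  apply/eqP; rewrite eqEsubv subvf -fW addvS ?subvv//; exact: flag_sub.
have dcap := dimv_sum_cap (val f).2 W.
rewrite f2W df dW flag_dim2 in dcap.
have dV : \dim V = k.
  by have := dimv_cap_compl W (val f).2; rewrite capvC dW -/V; lia.
have VW : flag_set k (V, W) by split=> //=; exact: diffvSl.
exists (insubd f (V, W)); apply/transverseP; rewrite val_flag_insubd//=; split=> //.
apply/eqP; rewrite eqEsubv subvf -fW subv_add.
rewrite (subv_trans (flag_sub f) (addvSr _ _)) /=.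
by rewrite -[X in (X <= _)%VS](addv_diff_cap W (val f).2) addvS// capvSr.
Qed.

Lemma det_affine_poly n (A B : 'M[K]_n) :
  exists p : {poly K}, forall t, p.[t] = \det (A + t *: B).
Proof.
exists (\det (map_mx polyC A + 'X *: map_mx polyC B)) => t.
rewrite -[LHS]/(horner_eval t _) -det_map_mx; congr (\det _).
by apply/matrixP => i j; rewrite !mxE /= /horner_eval hornerD hornerM hornerX !hornerC.
Qed.

Lemma inv_nat_cvg0 : (n.+1%:R^-1 : K) @[n --> \oo] --> (0 : K).
Proof.
apply/cvgrPdist_lt => e e0; have [N Ne] := inv_lt hK e0.
exists N => // n /= Nn; rewrite sub0r normrN ger0_norm ?invr_ge0//.
by apply: le_lt_trans Ne; rewrite lef_pV2 ?posrE// ler_nat.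
Qed.

Lemma nonroot_inv_nat (p : {poly K}) N : p != 0 ->
  exists2 n, (N <= n)%N & p.[n.+1%:R^-1] != 0.
Proof.
move=> p0; apply: contrapT => H.
have inj_inv : injective (fun n : nat => n.+1%:R^-1 : K).
  by move=> m n /invr_inj/eqP; rewrite eqr_nat => /eqP[].
pose rs := [seq n.+1%:R^-1 : K | n <- iota N (size p)].
have : (size rs < size p)%N.
  apply: max_poly_roots => //; last by rewrite map_inj_uniq ?iota_uniq.
  apply/allP => x /mapP[n]; rewrite mem_iota => /andP[Nn _] ->.
  by apply/negPn/negP => h; apply: H; exists n.
by rewrite size_map size_iota ltnn.
Qed.

(** Frames of [x] and of a flag transverse to [f] are joined by a segment;
    transversality to [f] is the non-vanishing of a polynomial along it. *)
Lemma transverse_dense x f (U : set (flag K d k)) : nbhs x U ->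
  exists2 y, U y & transverse y f.
Proof.
move=> nU; have [y /transverseP[y1 y2]] := ex_transverse f.
have [N [C [xN xC]]] := flag_frame x; have [N' [C' [yN yC]]] := flag_frame y.
have [M1 rM1 f1] := grass_frame_dim (flag_dim1 f).
have [M2 rM2 f2] := grass_frame_dim (flag_dim2 f).
pose W := row_mx N C; pose W' := row_mx N' C'.
have path_poly l m (A B : 'M[K]_(d, l)) (M : 'M[K]_(d, m)) :
    (column_space B + column_space M)%VS = fullv ->
    exists2 p : {poly K}, p != 0 & forall t, p.[t] != 0 ->
      \rank (row_mx (A + t *: (B - A)) M) = d.
  rewrite -column_space_row => /column_space_full rB.
  have fB : row_free (row_mx B M) by rewrite /row_free rB.
  have [Q BQ] := row_freeP fB.
  (* [Q] is a right inverse of the matrix at parameter 1, so [p.[1] = 1] and [p] is nonzero; where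
     [p] does not vanish, the rank is full. *)
  have [p pE] := det_affine_poly (row_mx A M *m Q) (row_mx (B - A) 0 *m Q).
  have pE' t : p.[t] = \det (row_mx (A + t *: (B - A)) M *m Q).
    by rewrite pE scalemxAl -mulmxDl scale_row_mx scaler0 add_row_mx addr0.
  exists p => [|t].
    apply: contraTneq (oner_neq0 K) => p0; have := pE' 1.
    by rewrite p0 horner0 scale1r addrC subrK BQ det1 => <-; rewrite eqxx.
  rewrite pE' -unitfE -unitmxE => /mulmxV.
  by rewrite -mulmxA => h; apply/eqP; apply/row_freeP; eexists; exact: h.
have [p1 p10 P1] : exists2 p : {poly K}, p != 0 & forall t, p.[t] != 0 ->
    \rank (row_mx (N + t *: (N' - N)) M2) = d.
  by apply: path_poly; rewrite -yN f2.
have [p2 p20 P2] : exists2 p : {poly K}, p != 0 & forall t, p.[t] != 0 ->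
    \rank (row_mx (W + t *: (W' - W)) M1) = d.
  by apply: path_poly; rewrite -yC f1 addvC.
have p12 : p1 * p2 != 0 by rewrite mulf_neq0.
have [phi hphi phiP] := subsequence_choose (fun _ N => nonroot_inv_nat N p12).
pose t n : K := (phi n).+1%:R^-1.
have t0 : t n @[n --> \oo] --> (0 : K) by exact: cvg_subsequence hphi inv_nat_cvg0.
have cpath l (A B : 'M[K]_(d, l)) : A + t n *: (B - A) @[n --> \oo] --> A.
  apply/cvg_mxP => i j; under eq_fun do rewrite !mxE.
  have h : A i j + t n * (B i j - A i j) @[n --> \oo] --> A i j + 0 * (B i j - A i j).
    by apply: cvgD; [exact: cvg_cst|apply: cvgM => //; exact: cvg_cst].
  by rewrite mul0r addr0 in h.
pose N_ n := N + t n *: (N' - N); pose W_ n := W + t n *: (W' - W).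
have WE n : W_ n = row_mx (N_ n) (C + t n *: (C' - C)).
  by rewrite /W_ /W /W' opp_row_mx add_row_mx scale_row_mx add_row_mx.
have tP n : \rank (row_mx (N_ n) M2) = d /\ \rank (row_mx (W_ n) M1) = d.
  by have := phiP n; rewrite hornerM mulf_eq0 negb_or => /andP[h1 h2]; split; [exact: P1|exact: P2].
have rank_full l m (A : 'M[K]_(d, l)) (M : 'M[K]_(d, m)) : \rank (row_mx A M) = d ->
    (l + m = d)%N -> \rank A = l.
  move=> rAM lm; apply/eqP; rewrite eqn_leq rank_leq_col /= -(leq_add2r m) lm -{1}rAM.
  by apply: leq_trans (mxrank_row_mx_le _ _) _; rewrite leq_add2l rank_leq_col.
have rN n : \rank (N_ n) = k by apply: (rank_full _ _ _ _ (tP n).1); lia.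
have rW n : \rank (W_ n) = (k + (d - k - k))%N by apply: (rank_full _ _ _ _ (tP n).2); lia.
pose y_ n : flag K d k := insubd x (column_space (N_ n), column_space (W_ n)).
have y_E n : val (y_ n) = (column_space (N_ n), column_space (W_ n)).
  apply: val_flag_insubd; split; rewrite /= ?dim_column_space ?rN// ?rW; first by lia.
  by rewrite WE column_space_row addvSl.
have rN0 : \rank N = k by rewrite -dim_column_space -xN flag_dim1.
have rW0 : \rank W = (k + (d - k - k))%N.
  by rewrite -dim_column_space -xC flag_dim2; lia.
have yx : y_ n @[n --> \oo] --> x.
  apply/cvg_flagP; rewrite xN xC.
  have -> : (fun n => (val (y_ n)).1) = fun n => column_space (N_ n).
    by apply/funext => n; rewrite y_E.
  have -> : (fun n => (val (y_ n)).2) = fun n => column_space (W_ n).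
    by apply/funext => n; rewrite y_E.
  by split; apply: cvg_column_space => //; exact: cpath.
have [n _ Un] := yx _ nU; exists (y_ n); first exact: (Un n (leqnn n)).
apply/transverseP; rewrite y_E /= -f1 -f2 [X in _ /\ X = _]addvC.
rewrite -!column_space_row; by split; apply/column_space_full; [exact: (tP n).1|exact: (tP n).2].
Qed.

End Transversality.

(** * Dynamics of divergent sequences on flags *)

Section SVDDynamics.
Variable K : numFieldType.
Hypothesis hK : real_complex_like K.
Variable d : nat.
Implicit Types (g U V : 'M[K]_d) (s : seq K).

(** The order-reversing permutation matrix, which puts the singular values of an inverse back in
    decreasing order. *)
Definition rev_mx : 'M[K]_d := \matrix_(i, j) (i == rev_ord j)%:R.

Lemma rev_mxM m (A : 'M[K]_(d, m)) i j : (rev_mx *m A) i j = A (rev_ord i) j.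
Proof.
rewrite mxE (bigD1 (rev_ord i))//= big1 ?addr0 => [|l li].
  by rewrite mxE rev_ordK eqxx mul1r.
rewrite mxE (_ : _ == _ = false) ?mul0r//; apply: contraNF li => /eqP ->.
by rewrite rev_ordK.
Qed.

Lemma rev_mxK : rev_mx *m rev_mx = 1%:M.
Proof.
by apply/matrixP => i j; rewrite rev_mxM !mxE (inj_eq rev_ord_inj).
Qed.

Lemma ctrmx_rev_mx : ctrmx rev_mx = rev_mx.
Proof.
apply/matrixP => i j; rewrite !mxE conjK_ge0 ?ler0n//.
by congr (nat_of_bool _)%:R; apply/eqP/eqP => ->; rewrite rev_ordK.
Qed.

Lemma svd_gt0 g U V s i : g \in unitmx -> svd g U V s -> (i < d)%N -> 0 < s`_i.
Proof.
move=> ug [_ _ sz ss s0 gE] id.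
rewrite lt_neqAle seq_ge0// andbT eq_sym.
move: ug; rewrite gE !unitmx_mul => /andP[/andP[_ uD] _].
move: uD; rewrite unitmxE det_diag unitfE => /prodf_neq0/(_ (Ordinal id) isT).
by rewrite mxE.
Qed.

Lemma rev_inv_nth s i : size s = d -> (i < d)%N ->
  (rev (map (fun x => x^-1) s))`_i = (s`_(d - i.+1))^-1.
Proof.
move=> sz id; rewrite nth_rev ?size_map sz// (nth_map 0)// sz.
by rewrite ltn_subrL (leq_ltn_trans _ id).
Qed.

Lemma svd_inv g U V s : g \in unitmx -> svd g U V s ->
  svd (invmx g) (ctrmx V *m rev_mx) (rev_mx *m ctrmx U) (rev (map (fun x => x^-1) s)).
Proof.
move=> ug gs; have [UU VV sz ss s0 gE] := gs.
have spos i : (i < d)%N -> 0 < s`_i by exact: svd_gt0 gs.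
have VV' := mulmx1C VV; have UU' := mulmx1C UU.
split.
- by rewrite (ctrmxM hK) (ctrmxK hK) ctrmx_rev_mx !mulmxA -[_ *m V *m _]mulmxA VV mulmx1 rev_mxK.
- by rewrite (ctrmxM hK) (ctrmxK hK) ctrmx_rev_mx !mulmxA -[_ *m ctrmx U *m _]mulmxA UU mulmx1 rev_mxK.
- by rewrite size_rev size_map.
- rewrite rev_sorted; apply: (homo_sorted_in (P := [pred x : K | 0 < x])) _ _ ss.
    by move=> x y /= x0 y0 xy; rewrite lef_pV2.
  by apply/allP => x xs /=; rewrite -(nth_index 0 xs) spos// -sz index_mem.
- rewrite all_rev all_map; apply/allP => x xs /=; rewrite invr_ge0.
  exact: (allP s0).
have DD : seq_diag d s *m (rev_mx *m seq_diag d (rev (map (fun x => x^-1) s)) *m rev_mx) = 1%:M.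
  apply/matrixP => i j; rewrite /seq_diag mul_diag_mx -mulmxA mxE rev_mxM mul_diag_mx !mxE.
  rewrite rev_inv_nth// (_ : (d - (rev_ord i).+1)%N = i); last by rewrite /=; have := ltn_ord i; lia.
  by rewrite mulrA mulfV ?mul1r ?(inj_eq rev_ord_inj)// gt_eqF ?spos.
have e : g *m (ctrmx V *m rev_mx *m seq_diag d (rev (map (fun x => x^-1) s)) *m (rev_mx *m ctrmx U)) = 1%:M.
  rewrite gE !mulmxA -[_ *m V *m ctrmx V]mulmxA VV mulmx1.
  by move: DD; rewrite !mulmxA => DD; rewrite -!(mulmxA U) DD mul1mx.
by rewrite -[RHS]mul1mx -(mulVmx ug) -[RHS]mulmxA e mulmx1.
Qed.

Lemma pid_mxM m j (jd : (j <= d)%N) (A : 'M[K]_(d, m)) i l :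
  ((pid_mx j : 'M_(j, d)) *m A) i l = A (widen_ord jd i) l.
Proof.
rewrite mxE (bigD1 (widen_ord jd i))//= big1 ?addr0 => [|i' ii'].
  by rewrite mxE /= eqxx ltn_ord mul1r.
rewrite mxE (_ : (i == i' :> nat) = false) ?mul0r//.
by apply: contraNF ii' => /eqP ii'; apply/eqP/val_inj.
Qed.

Lemma rank_unitary_pid U j : (j <= d)%N -> ctrmx U *m U = 1%:M ->
  \rank (U *m (pid_mx j : 'M_(d, j))) = j.
Proof.
move=> jd UU; apply: (@left_inverse_rank _ _ _ _ ((pid_mx j : 'M_(j, d)) *m ctrmx U)).
by rewrite mulmxA -[_ *m ctrmx U *m U]mulmxA UU mulmx1 pid_mx_id// pid_mx_1.
Qed.

(** Expanding directions: on a frame [M] transverse to the contracted subspace,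
    [g] acts as [U D V] with the first [j] rows [B] of [V M] invertible, and
    [D V M B^-1 D1^-1] tends to the first [j] columns of the identity. *)
Lemma grass_svd_dynamics (g_ U_ V_ : nat -> 'M[K]_d) (s_ : nat -> seq K) (U V : 'M[K]_d)
    j (S_ : nat -> grass K d) (S : grass K d) :
  (0 < j < d)%N -> (forall n, g_ n \in unitmx) ->
  (forall n, svd (g_ n) (U_ n) (V_ n) (s_ n)) ->
  (s_ n)`_j / (s_ n)`_j.-1 @[n --> \oo] --> (0 : K) ->
  U_ n @[n --> \oo] --> U -> V_ n @[n --> \oo] --> V ->
  ctrmx U *m U = 1%:M -> ctrmx V *m V = 1%:M ->
  \dim S = j -> S_ n @[n --> \oo] --> S ->
  (S + column_space (ctrmx V *m rev_mx *m (pid_mx (d - j) : 'M_(d, d - j))))%VS = fullv ->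
  grass_act (g_ n) (S_ n) @[n --> \oo] --> column_space (U *m (pid_mx j : 'M_(d, j))).
Proof.
move=> /andP[j0 jd] ug gs ratio UU VV cU cV dS SS; have [M_ [M [rM -> MM nM]]] := cvg_grass_lift_ex dS SS.
have VcV := mulmx1C cV; have jled := ltnW jd.
rewrite -column_space_row => /column_space_full rfull.
pose p : 'M[K]_(j, d) := pid_mx j.
(* The first [j] rows of [V] kill the contracted subspace, so the full rank of the joint frame is
   carried by [p V M]. *)
have uB : p *m V *m M \in unitmx.
  have e : p *m (V *m row_mx M (ctrmx V *m rev_mx *m (pid_mx (d - j) : 'M_(d, d - j)))) =
      p *m V *m M *m row_mx 1%:M 0.
    have pV : p *m V *m ctrmx V = p by rewrite -mulmxA VcV mulmx1.
    rewrite !mul_mx_row !mulmxA mulmx1 mulmx0 pV; congr row_mx.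
    apply/matrixP => l m; rewrite -mulmxA pid_mxM rev_mxM !mxE.
    by case: eqP => //= lm; have := ltn_ord l; have := ltn_ord m; lia.
  have : \rank (p *m V *m M *m row_mx 1%:M (0 : 'M_(j, d - j))) = j.
    rewrite -e mulmxA mxrankMfree; last by rewrite /row_free rfull.
    by rewrite mxrankMfree ?row_free_unit ?rank_pid_mx ?(ltnW jd)//; have [] := mulmx1_unit VcV.
  move=> h; rewrite -row_free_unit /row_free eqn_leq rank_leq_row /= -{1}h.
  exact: mxrankM_maxl.
have cB : p *m V_ n *m M_ n @[n --> \oo] --> p *m V *m M.
  by apply: cvg_mulmx => //; apply: cvg_mulmx => //; exact: cvg_cst.
pose Y_ n := V_ n *m M_ n *m invmx (p *m V_ n *m M_ n).
have cY : Y_ n @[n --> \oo] --> V *m M *m invmx (p *m V *m M).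
  by apply: cvg_mulmx; [exact: cvg_mulmx|exact: cvg_invmx].
pose D1_ n : 'M[K]_j := diag_mx (\row_i (s_ n)`_i).
have spos n i : (i < d)%N -> 0 < (s_ n)`_i by apply: svd_gt0 (gs n).
have uD1 n : D1_ n \in unitmx.
  rewrite unitmxE det_diag unitfE; apply/prodf_neq0 => i _.
  by rewrite mxE gt_eqF// spos// (leq_trans (ltn_ord i)).
pose X_ n := seq_diag d (s_ n) *m Y_ n *m invmx (D1_ n).
have D1inv n : invmx (D1_ n) = diag_mx (\row_i ((s_ n)`_i)^-1).
  rewrite -[RHS]mul1mx -(mulVmx (uD1 n)) -mulmxA mulmx_diag.
  rewrite (_ : diag_mx _ = 1%:M) ?mulmx1// -diag_const_mx; congr diag_mx; apply/rowP => i.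
  by rewrite !mxE mulfV// gt_eqF// spos// (leq_trans (ltn_ord i)).
have cX : X_ n @[n --> \oo] --> (pid_mx j : 'M[K]_(d, j)).
  apply/cvg_mxP => l m.
  have XE n : X_ n l m = (s_ n)`_l / (s_ n)`_m * Y_ n l m.
    by rewrite /X_ D1inv; move: (Y_ n) => Y; rewrite mul_mx_diag mul_diag_mx !mxE mulrAC.
  have sm n : 0 < (s_ n)`_m by rewrite spos// (leq_trans (ltn_ord m)).
  under eq_fun do rewrite XE.
  (* The first [j] rows of [Y_ n] form the identity as soon as [p V_n M_n] is invertible, so these
     entries are eventually constant. In the other rows the quotient of singular values is at most
     the quotient at the gap, which tends to 0. *)
  have [lj|jl] := ltnP l j.
    have E : \forall n \near \oo, (pid_mx j : 'M[K]_(d, j)) l m =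
        (s_ n)`_l / (s_ n)`_m * Y_ n l m.
      apply: filterS (near_unitmx uB cB) => n uBn.
      have : (p *m Y_ n) (Ordinal lj) m = (1%:M : 'M[K]_j) (Ordinal lj) m.
        by rewrite /Y_ !mulmxA mulmxV.
      rewrite (pid_mxM jled) (_ : widen_ord _ _ = l); last exact: val_inj.
      move=> ->; rewrite !mxE lj andbT -val_eqE /=.
      by case: eqP => [->|_]; rewrite ?mulr0// mulr1 mulfV ?gt_eqF.
    apply: cvg_trans (near_eq_cvg E) _; exact: cvg_cst.
  have -> : (pid_mx j : 'M[K]_(d, j)) l m = 0 by rewrite mxE [(_ < j)%N]ltnNge jl andbF.
  suff h0 : (s_ n)`_l / (s_ n)`_m @[n --> \oo] --> (0 : K).
    have hY : Y_ n l m @[n --> \oo] --> (V *m M *m invmx (p *m V *m M)) l m.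
      by move/cvg_mxP: cY => /(_ l m).
    have h : (s_ n)`_l / (s_ n)`_m * Y_ n l m @[n --> \oo] -->
      0 * (V *m M *m invmx (p *m V *m M)) l m by exact: cvgM.
    by rewrite mul0r in h.
  apply/cvgrPdist_lt => e e0; move/cvgrPdist_lt: ratio => /(_ e e0).
  apply: filterS => n; rewrite !sub0r !normrN; apply: le_lt_trans.
  have s0 := svd_ge0 (gs n); have ss := svd_sorted (gs n).
  have sj1 : 0 < (s_ n)`_j.-1 by apply: spos; lia.
  rewrite !ger0_norm ?divr_ge0 ?seq_ge0//.
  apply: ler_pM; rewrite ?invr_ge0 ?seq_ge0//; first exact: sorted_ge.
  by rewrite lef_pV2 ?posrE// sorted_ge//; have := ltn_ord m; lia.
have near_eq : \forall n \near \oo,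
    column_space (U_ n *m X_ n) = grass_act (g_ n) (S_ n).
  apply: filterS2 nM (near_unitmx uB cB) => n [_ ->] uBn.
  rewrite grass_act_column_space (svd_eq (gs n)) /X_ /Y_.
  rewrite -!mulmxA !(mulmxA (U_ n)) !mulmxA column_space_mulr ?unitmx_inv//.
  by rewrite column_space_mulr// unitmx_inv.
apply: cvg_trans (near_eq_cvg near_eq) _; apply: cvg_column_space.
  exact: rank_unitary_pid.
exact: cvg_mulmx.
Qed.

End SVDDynamics.

(** * Contraction by divergent sequences of the representation *)

Section DivergentRepresentation.
Variable K : numFieldType.
Hypothesis hK : real_complex_like K.
Variables (G : groupType) (d k : nat) (rho : G -> 'M[K]_d).
Hypotheses (hk : (1 <= k)%N) (hkd : (2 * k <= d)%N).
Hypotheses (hrho : SL_representation rho) (hdiv : divergent k rho).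
Implicit Types (gamma : nat -> G) (x y : flag K d k).

Lemma rho_unit g : rho g \in unitmx.
Proof. by rewrite unitmxE hrho.1 unitr1. Qed.

Lemma rhoM g h : rho (g * h)%g = rho g *m rho h. Proof. exact: hrho.2. Qed.

Lemma rho1 : rho 1%g = 1%:M.
Proof. by rewrite -(mulVmx (rho_unit 1%g)) -{3}(mulg1 1%g) rhoM mulKmx ?rho_unit. Qed.

Lemma rhoV g : rho g^-1%g = invmx (rho g).
Proof.
by rewrite -[RHS]mulmx1 -rho1 -(mulgV g) rhoM mulKmx ?rho_unit.
Qed.

Lemma flag_act_rhoM g h x : flag_act (rho (g * h)%g) x = flag_act (rho g) (flag_act (rho h) x).
Proof. by rewrite rhoM flag_actM ?rho_unit. Qed.

Lemma flag_act_rho1 x : flag_act (rho 1%g) x = x.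
Proof. by rewrite rho1 flag_act1. Qed.

Let sv g := singular_values (rho g).

(** The values [sv] are the default [::] when the characteristic polynomial
    does not split with nonnegative roots; a ratio larger than 1 excludes it. *)
Lemma divergent_gap gamma : injective gamma ->
  \forall n \near \oo, exists U V, svd (rho (gamma n)) U V (sv (gamma n)) /\
    (sv (gamma n))`_k < (sv (gamma n))`_k.-1.
Proof.
move=> ginj; have big : nbhs +oo [set x : K | 1 < x].
  by exists 1; split; [exact: real1|].
have near_gap : \forall n \near \oo,
  1 < sigma k (rho (gamma n)) / sigma k.+1 (rho (gamma n)) := hdiv ginj big.
apply: filterS near_gap => n; rewrite /sigma -/(sv _) => gap.
have sn : sv (gamma n) <> [::].
  by move=> sn; move: gap; rewrite sn !nth_nil mul0r ltr10.
have spec : singular_spec (rho (gamma n)) (sv (gamma n)).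
  have [ex|nex] := pselect (exists s, singular_spec (rho (gamma n)) s).
    exact: (xgetPex [::] ex).
  by case: sn; apply: xgetPN => s hs; apply: nex; exists s.
have [U [V gs]] := svd_ex hK (rho_unit _) spec; exists U, V; split=> //.
have s0 : 0 < (sv (gamma n))`_k.
  by apply: (svd_gt0 (rho_unit (gamma n)) gs); lia.
by move: gap; rewrite ltr_pdivlMr// mul1r.
Qed.

Lemma divergent_ratio gamma : injective gamma ->
  (sv (gamma n))`_k / (sv (gamma n))`_k.-1 @[n --> \oo] --> (0 : K).
Proof.
move=> ginj; apply/cvgrPdist_lt => e e0.
have big : nbhs +oo [set x : K | e^-1 < x].
  by exists e^-1; split; [rewrite realV gtr0_real|].
have near_gap : \forall n \near \oo,
  e^-1 < sigma k (rho (gamma n)) / sigma k.+1 (rho (gamma n)) := hdiv ginj big.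
apply: filterS2 (divergent_gap ginj) near_gap => n [U [V [gs _]]].
rewrite /sigma -/(sv _) sub0r normrN => gap.
have ug := rho_unit (gamma n).
have s0 : 0 < (sv (gamma n))`_k by apply: (svd_gt0 ug gs); lia.
have s1 : 0 < (sv (gamma n))`_k.-1 by apply: (svd_gt0 ug gs); lia.
rewrite ger0_norm ?divr_ge0 ?ltW// ltr_pdivrMr//.
by move: gap; rewrite ltr_pdivlMr// mulrC ltr_pdivrMr// mulrC.
Qed.

Lemma svV gamma n U V : svd (rho (gamma n)) U V (sv (gamma n)) ->
  (sv (gamma n)^-1%g)`_k = ((sv (gamma n))`_(d - k).-1)^-1 /\
  (sv (gamma n)^-1%g)`_k.-1 = ((sv (gamma n))`_(d - k))^-1.
Proof.
move=> gs; have ug := rho_unit (gamma n).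
have := svd_inv hK ug gs; rewrite -rhoV => /(singular_valuesE hK); rewrite -/(sv _) => ->.
have sz := svd_size gs; split; rewrite (rev_inv_nth sz); try lia.
  by congr ((sv _)`_ _)^-1; lia.
by congr ((sv _)`_ _)^-1; lia.
Qed.

(** Inversion reverses the singular values, so the gap at [d - k] for [gamma] is the gap at [k] for
    the inverse sequence, which also consists of distinct elements. *)
Lemma divergent_svd gamma : injective gamma ->
  (\forall n \near \oo, exists U V, [/\ svd (rho (gamma n)) U V (sv (gamma n)),
    (sv (gamma n))`_k < (sv (gamma n))`_k.-1 &
    (sv (gamma n))`_(d - k) < (sv (gamma n))`_(d - k).-1]) /\
  (sv (gamma n))`_(d - k) / (sv (gamma n))`_(d - k).-1 @[n --> \oo] --> (0 : K).
Proof.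
move=> ginj; have ginjV : injective (fun n => (gamma n)^-1%g) by move=> m n /invg_inj/ginj.
have g1 := divergent_gap ginj; have g2 := divergent_gap ginjV.
split.
  apply: filterS2 g1 g2 => n [U [V [gs gap]]] [U' [V' [gs' gap']]]; exists U, V; split=> //.
  have ug := rho_unit (gamma n); have [e1 e2] := svV gs.
  have dk1d : ((d - k).-1 < d)%N by clear -hk hkd; lia.
  have dkd : (d - k < d)%N by clear -hk hkd; lia.
  have s1 := svd_gt0 ug gs dk1d; have s2 := svd_gt0 ug gs dkd.
  move: e1 e2 gap' s1 s2; move: (sv (gamma n)^-1%g) (sv (gamma n)) => s' s -> -> gap' s1 s2.
  by rewrite ltf_pV2 in gap'.
have r2 := divergent_ratio ginjV.
apply: cvg_trans (near_eq_cvg _) r2; apply: filterS g1 => n [U [V [gs gap]]].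
have [] := svV gs; move: (sv (gamma n)^-1%g) (sv (gamma n)) => s' s -> ->.
by rewrite invrK mulrC.
Qed.

(** [grass_svd_dynamics] is applied with [j = k] and with [j = d - k]; each component is repelled by
    the other component of [Fm], which is transversality. The moving points [x_ n] encode local
    uniformity, and [psi] makes the property stable under extraction. *)
Lemma divergent_dynamics (x0 : flag K d k) gamma : injective gamma ->
  exists phi (Fp Fm : flag K d k), [/\ subsequence phi,
    limit_flag rho (gamma \o phi) Fp,
    limit_flag rho (fun n => (gamma (phi n))^-1%g) Fm &
    forall psi (x_ : nat -> flag K d k) x, subsequence psi -> x_ n @[n --> \oo] --> x -> transverse x Fm ->
      flag_act (rho (gamma (phi (psi n)))) (x_ n) @[n --> \oo] --> Fp].
Proof.
move=> ginj; have [gsv ratio2] := divergent_svd ginj; have ratio1 := divergent_ratio ginj.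
have /near_ooP[N NP] := gsv.
pose phi0 n := (n + N)%N.
have hphi0 : subsequence phi0 by move=> m n mn; rewrite ltn_add2r.
have /choice[UV UVP] n : exists UV : 'M[K]_d * 'M[K]_d,
    [/\ svd (rho (gamma (phi0 n))) UV.1 UV.2 (sv (gamma (phi0 n))),
    (sv (gamma (phi0 n)))`_k < (sv (gamma (phi0 n)))`_k.-1 &
    (sv (gamma (phi0 n)))`_(d - k) < (sv (gamma (phi0 n)))`_(d - k).-1].
  by have [U [V H]] := NP (phi0 n) (leq_addl _ _); exists (U, V).
have [|phi1 [U [hphi1 UU]]] := @mx_bolzano_weierstrass _ hK _ _ (fun n => (UV n).1) 1.
  move=> n i j; apply: orthonormal_norm_le.
  by have [gs _ _] := UVP n; exact: svd_left gs.
have [|phi2 [V [hphi2 VV]]] := @mx_bolzano_weierstrass _ hK _ _ (fun n => (UV (phi1 n)).2) 1.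
  move=> n i j; apply: orthonormal_norm_le.
  by have [gs _ _] := UVP (phi1 n); exact: mulmx1C (svd_right gs).
pose phi := phi0 \o (phi1 \o phi2).
have hphi : subsequence phi by apply: subsequence_comp => //; exact: subsequence_comp.
pose U_ n := (UV (phi1 (phi2 n))).1; pose V_ n := (UV (phi1 (phi2 n))).2.
have {}UU : U_ n @[n --> \oo] --> U by exact: cvg_subsequence hphi2 UU.
have {}VV : V_ n @[n --> \oo] --> V by [].
pose s_ n := sv (gamma (phi n)).
have gs n : svd (rho (gamma (phi n))) (U_ n) (V_ n) (s_ n) by have [] := UVP (phi1 (phi2 n)).
have gap1 n : (s_ n)`_k < (s_ n)`_k.-1 by have [] := UVP (phi1 (phi2 n)).
have gap2 n : (s_ n)`_(d - k) < (s_ n)`_(d - k).-1 by have [] := UVP (phi1 (phi2 n)).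
have unitary_lim (W_ : nat -> 'M[K]_d) W : W_ n @[n --> \oo] --> W ->
    (forall n, ctrmx (W_ n) *m W_ n = 1%:M) -> ctrmx W *m W = 1%:M.
  move=> WW Wn.
  have h : ctrmx (W_ n) *m W_ n @[n --> \oo] --> ctrmx W *m W.
    by apply: cvg_mulmx => //; apply: cvg_ctrmx.
  rewrite (_ : (fun n => _) = fun=> 1%:M) in h; last by apply/funext => n; exact: Wn.
  apply/matrixP => i j; move/cvg_mxP: h => /(_ i j) h.
  exact: (cvg_unique (@norm_hausdorff K K) h (cvg_cst _)).
have cU : ctrmx U *m U = 1%:M by apply: (unitary_lim _ _ UU) => n; exact: svd_left (gs n).
have cV : ctrmx V *m V = 1%:M.
  by apply: (unitary_lim _ _ VV) => n; apply: mulmx1C; exact: svd_right (gs n).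
(* The limit of the left unitary factors of the inverses, see [svd_inv]; its leading columns span
   the repelling flag. *)
pose Vm := ctrmx V *m rev_mx K d.
have cVm : ctrmx Vm *m Vm = 1%:M.
  rewrite /Vm (ctrmxM hK) (ctrmxK hK) ctrmx_rev_mx !mulmxA -[_ *m V *m _]mulmxA.
  by rewrite (mulmx1C cV) mulmx1 rev_mxK.
pose Vm_ n := ctrmx (V_ n) *m rev_mx K d.
have VVm : Vm_ n @[n --> \oo] --> Vm.
  by apply: cvg_mulmx; [exact: cvg_ctrmx|exact: cvg_cst].
have flagP (W : 'M[K]_d) : ctrmx W *m W = 1%:M ->
    flag_set k (column_space (W *m (pid_mx k : 'M_(d, k))),
                column_space (W *m (pid_mx (d - k) : 'M_(d, d - k)))).
  move=> cW; split; rewrite /= ?dim_column_space ?rank_unitary_pid//; try lia.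
  apply/column_spaceS; exists (pid_mx k : 'M_(d - k, k)).
  by rewrite -mulmxA mul_pid_mx; congr (_ *m pid_mx _); lia.
pose mkflag W : flag K d k := insubd x0 (column_space (W *m (pid_mx k : 'M_(d, k))),
                column_space (W *m (pid_mx (d - k) : 'M_(d, d - k)))).
have mkflagE W : ctrmx W *m W = 1%:M -> val (mkflag W) = _ :=
  fun cW => val_flag_insubd x0 (flagP W cW).
have cvgW (W_ : nat -> 'M[K]_d) W j : ctrmx W *m W = 1%:M -> (j <= d)%N ->
    W_ n @[n --> \oo] --> W ->
    column_space (W_ n *m (pid_mx j : 'M_(d, j))) @[n --> \oo] -->
    column_space (W *m (pid_mx j : 'M_(d, j))).
  move=> cW jd WW; apply: cvg_column_space; first exact: rank_unitary_pid.
  by apply: cvg_mulmx => //; exact: cvg_cst.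
have pairW (W_ : nat -> 'M[K]_d) W : ctrmx W *m W = 1%:M -> W_ n @[n --> \oo] --> W ->
    (column_space (W_ n *m (pid_mx k : 'M_(d, k))),
     column_space (W_ n *m (pid_mx (d - k) : 'M_(d, d - k)))) @[n --> \oo] -->
    (column_space (W *m (pid_mx k : 'M_(d, k))),
     column_space (W *m (pid_mx (d - k) : 'M_(d, d - k)))).
  move=> cW WW; have kd : (k <= d)%N by lia.
  have h1 := cvgW _ _ _ cW kd WW; have h2 := cvgW _ _ _ cW (leq_subr k d) WW.
  exact: (cvg_pair h1 h2).
exists phi, (mkflag U), (mkflag Vm); split=> //.
- rewrite /limit_flag mkflagE//.
  rewrite (_ : (fun n => _) = fun n => (column_space (U_ n *m (pid_mx k : 'M_(d, k))),
      column_space (U_ n *m (pid_mx (d - k) : 'M_(d, d - k))))).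
    exact: pairW.
  apply/funext => n; rewrite /Uflag /=.
  have kd : (k < d)%N by clear -hk hkd; lia.
  have dk0 : (0 < d - k)%N by clear -hk hkd; lia.
  have dkd : (d - k < d)%N by clear -hk hkd; lia.
  by rewrite (Uspace_svd hK (gs n) hk kd (gap1 n)) (Uspace_svd hK (gs n) dk0 dkd (gap2 n)).
- rewrite /limit_flag mkflagE//.
  rewrite (_ : (fun n => _) = fun n => (column_space (Vm_ n *m (pid_mx k : 'M_(d, k))),
      column_space (Vm_ n *m (pid_mx (d - k) : 'M_(d, d - k))))).
    exact: pairW.
  apply/funext => n; have gsV := svd_inv hK (rho_unit (gamma (phi n))) (gs n).
  have sz := svd_size (gs n).
  have spos i : (i < d)%N -> 0 < (s_ n)`_i by apply: (svd_gt0 (rho_unit _) (gs n)).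
  have [kd dkd k1d dk1d dk0] : [/\ k < d, d - k < d, k.-1 < d, (d - k).-1 < d & 0 < d - k]%N.
    by clear -hk hkd; split; lia.
  have e1 : (d - (d - k).+1)%N = k.-1 by clear -hk hkd; lia.
  have e2 : (d - (d - k).-1.+1)%N = k by clear -hk hkd; lia.
  have e3 : (d - k.+1)%N = (d - k).-1 by clear -hk hkd; lia.
  have e4 : (d - k.-1.+1)%N = (d - k)%N by clear -hk hkd; lia.
  have g1 : (rev (map (fun t => t^-1) (s_ n)))`_k < (rev (map (fun t => t^-1) (s_ n)))`_k.-1.
    by rewrite (rev_inv_nth sz kd) (rev_inv_nth sz k1d) e3 e4 ltf_pV2 ?posrE ?spos.
  have g2 : (rev (map (fun t => t^-1) (s_ n)))`_(d - k) <
      (rev (map (fun t => t^-1) (s_ n)))`_(d - k).-1.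
    by rewrite (rev_inv_nth sz dkd) (rev_inv_nth sz dk1d) e1 e2 ltf_pV2 ?posrE ?spos.
  rewrite /Uflag rhoV (Uspace_svd hK gsV hk kd g1) (Uspace_svd hK gsV dk0 dkd g2).
  by [].
move=> psi x_ x hpsi xx /(transverseP hkd); rewrite mkflagE//= => -[h1 h2].
have /cvg_flagP[x1 x2] := xx; rewrite addvC in h2.
have dyn j (S_ : nat -> grass K d) (S : grass K d) : (0 < j < d)%N ->
    (sv (gamma n))`_j / (sv (gamma n))`_j.-1 @[n --> \oo] --> (0 : K) ->
    \dim S = j -> S_ n @[n --> \oo] --> S ->
    (S + column_space (Vm *m (pid_mx (d - j) : 'M_(d, d - j))))%VS = fullv ->
    grass_act (rho (gamma (phi (psi n)))) (S_ n) @[n --> \oo] -->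
    column_space (U *m (pid_mx j : 'M_(d, j))).
  move=> hj ratio dS SS full.
  have hphipsi := subsequence_comp hphi hpsi.
  have ug n : rho (gamma (phi (psi n))) \in unitmx by exact: rho_unit.
  have ratio' : (s_ (psi n))`_j / (s_ (psi n))`_j.-1 @[n --> \oo] --> (0 : K).
    exact: (cvg_subsequence hphipsi ratio).
  have UU' := cvg_subsequence hpsi UU; have VV' := cvg_subsequence hpsi VV.
  have H := grass_svd_dynamics hj ug (fun n => gs (psi n)) ratio' UU' VV' cU cV dS SS full.
  exact: H.
have [kd dkd] : (0 < k < d /\ 0 < d - k < d)%N by clear -hk hkd; lia.
have dkk : (d - (d - k) = k)%N by clear -hk hkd; lia.
have h2' : ((val x).2 + column_space (Vm *m (pid_mx (d - (d - k)) : 'M_(d, d - (d - k)))))%VS = fullv.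
  by rewrite dkk.
apply/cvg_flagP; rewrite mkflagE//; split.
  rewrite (_ : (fun n => _) = fun n => grass_act (rho (gamma (phi (psi n)))) (val (x_ n)).1).
    exact: dyn kd ratio1 (flag_dim1 x) x1 h1.
  by apply/funext => n; rewrite flag_act_val// rho_unit.
rewrite (_ : (fun n => _) = fun n => grass_act (rho (gamma (phi (psi n)))) (val (x_ n)).2).
  exact: dyn dkd ratio2 (flag_dim2 x) x2 h2'.
by apply/funext => n; rewrite flag_act_val// rho_unit.
Qed.

End DivergentRepresentation.

(** * Extended geometrically finite representations *)

Section ExtendedGeometricallyFinite.
Context {R : realType} {K : numFieldType}.
Hypothesis hK : real_complex_like K.
Context {k d : nat}.
Hypotheses (hk : (1 <= k)%N) (hkd : (2 * k <= d)%N).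
Context {G : groupType} {P : set (set G)}.
Hypothesis hP : peripheral_structure P.
Context {X : metricType R} {a : isometric_action G X} {B : set G -> set X}.
Hypothesis hX : gromov_model a P B.
Variable rho : G -> 'M[K]_d.
Hypotheses (hrho : SL_representation rho) (hdiv : divergent k rho).
Variables (Lambda : set (flag K d k)) (zeta : flag K d k -> boundary X).
Hypothesis hEGF : EGF_with rho a Lambda zeta.
Implicit Types (gamma eta : nat -> G) (x y z : flag K d k) (p q r s b c : boundary X).

Let hext := hEGF.1.
Local Notation L := (limit_set k rho).
Local Notation ract g := (flag_act (rho g)).

Lemma flag_hausdorff : hausdorff_space (flag K d k).
Proof.
move=> x y xy; have [Bx nBx BxP] := flag_first_countable hK x.
have [By nBy ByP] := flag_first_countable hK y.
have /choice[z zP] n : exists z, Bx n z /\ By n z by exact: xy.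
have zx := BxP z (fun n => (zP n).1); have zy := ByP z (fun n => (zP n).2).
exact: flag_cvg_unique zx zy.
Qed.

Lemma boundary_uniq (q_ : nat -> boundary X) p q :
  q_ n @[n --> \oo] --> p -> q_ n @[n --> \oo] --> q -> p = q.
Proof. by have [delta hyp] := model_hyperbolic hX; exact: (cvg_boundary_uniq hyp). Qed.

Lemma tends_uniq gamma p q : tends_to a gamma p -> tends_to a gamma q -> p = q.
Proof. by have [delta hyp] := model_hyperbolic hX; exact: (tends_to_uniq hyp). Qed.

Lemma boundary_two_points : exists p q : boundary X, p <> q.
Proof.
have [delta hyp] := model_hyperbolic hX.
exact: (taut_boundary hyp (model_nonempty hX) (model_taut hX)).
Qed.

Lemma boundary_other p : exists q : boundary X, q <> p.
Proof.
have [q1 [q2 q12]] := boundary_two_points.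
by have [q1p|] := pselect (q1 = p); [exists q2; rewrite -q1p; exact: nesym|exists q1].
Qed.

Lemma boundary_dynamics gamma c s b :
  tends_to a gamma c -> tends_to a (fun n => (gamma n)^-1%g) s -> b <> s ->
  boundary_act a (gamma n) b @[n --> \oo] --> c.
Proof. by have [delta hyp] := model_hyperbolic hX; exact: (convergence_dynamics hyp). Qed.

Lemma ext_fiber p : exists x, fiber Lambda zeta p x.
Proof.
have : [set: boundary X] p by [].
by rewrite -(ext_surjective hext) => -[x Lx xp]; exists x.
Qed.

Lemma ext_cvg (x_ : nat -> flag K d k) x : (forall n, Lambda (x_ n)) ->
  x_ n @[n --> \oo] --> x -> Lambda x /\ zeta (x_ n) @[n --> \oo] --> zeta x.
Proof.
move=> Lx xx; have {}Lxx : Lambda x.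
  have nL : \forall n \near \oo, Lambda (x_ n) by exists 0%N.
  exact: (closed_cvg Lambda (ext_closed hext) nL x xx).
split=> // U nU; have /subspace_continuousP/(_ x Lxx U nU) nW := ext_continuous hext.
have near_U : \forall n \near \oo, Lambda (x_ n) -> U (zeta (x_ n)) := xx _ nW.
by apply: filterS near_U => n; apply; exact: Lx.
Qed.

Lemma fiber_cvg p (x_ : nat -> flag K d k) x : (forall n, fiber Lambda zeta p (x_ n)) ->
  x_ n @[n --> \oo] --> x -> fiber Lambda zeta p x.
Proof.
move=> xp xx; have [Lx zx] := ext_cvg (fun n => (xp n).1) xx; split=> //=.
rewrite (_ : (fun n => _) = fun=> p) in zx; last by apply/funext => n; have [_ ->] := xp n.
exact: boundary_uniq zx (cvg_cst p).
Qed.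

Record good_seq gamma p q Fp Fm : Prop := {
  good_inj : injective gamma;
  good_p : tends_to a gamma p;
  good_q : tends_to a (fun n => (gamma n)^-1%g) q;
  good_Fp : limit_flag rho gamma Fp;
  good_Fm : limit_flag rho (fun n => (gamma n)^-1%g) Fm;
  good_dyn : forall psi (x_ : nat -> flag K d k) x,
    subsequence psi -> x_ n @[n --> \oo] --> x -> transverse x Fm ->
    ract (gamma (psi n)) (x_ n) @[n --> \oo] --> Fp }.

Lemma limit_flag_subsequence gamma x phi :
  subsequence phi -> limit_flag rho gamma x -> limit_flag rho (gamma \o phi) x.
Proof. by move=> hphi; exact: cvg_subsequence. Qed.

Lemma limit_flagP gamma x : limit_flag rho gamma x <->
  Uspace k (rho (gamma n)) @[n --> \oo] --> (val x).1 /\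
  Uspace (d - k) (rho (gamma n)) @[n --> \oo] --> (val x).2.
Proof.
split=> [gx|[g1 g2]]; first by split; [exact: cvg_comp gx cvg_fst|exact: cvg_comp gx cvg_snd].
by rewrite /limit_flag /Uflag (surjective_pairing (val x)); exact: (cvg_pair g1 g2).
Qed.

Lemma limit_flag_uniq gamma x y : limit_flag rho gamma x -> limit_flag rho gamma y -> x = y.
Proof.
move=> /limit_flagP[x1 x2] /limit_flagP[y1 y2]; apply: val_inj.
rewrite [val x]surjective_pairing [val y]surjective_pairing.
by rewrite (cvg_grass_unique x1 y1) (cvg_grass_unique x2 y2).
Qed.

Lemma good_seq_subsequence gamma p q Fp Fm phi : subsequence phi ->
  good_seq gamma p q Fp Fm -> good_seq (gamma \o phi) p q Fp Fm.
Proof.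
move=> hphi [ginj gp gq gFp gFm gdyn]; split.
- by move=> m n /ginj/(subsequence_inj hphi).
- exact: tends_to_subsequence.
- exact: (tends_to_subsequence hphi gq).
- exact: limit_flag_subsequence.
- exact: (limit_flag_subsequence hphi gFm).
- move=> psi x_ x hpsi xx xF.
  exact: (gdyn (phi \o psi) x_ x (subsequence_comp hphi hpsi) xx xF).
Qed.

Lemma good_subsequence gamma : injective gamma -> exists phi p q Fp Fm,
  subsequence phi /\ good_seq (gamma \o phi) p q Fp Fm.
Proof.
move=> ginj; have [delta hyp] := model_hyperbolic hX.
have tend := injective_tends_to (model_geodesic hX) (model_proper hX)
  (model_properly_discontinuous hX).
have [o _] := model_nonempty hX; have [p0 _] := boundary_two_points.
have [x0 _] := ext_fiber p0.
have [phi1 h1 [p gp]] := tend o _ ginj.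
have ginj1 : injective (gamma \o phi1) by move=> m n /ginj/(subsequence_inj h1).
have [phi2 h2 [q gq]] := tend o (fun n => (gamma (phi1 n))^-1%g) (fun m n => ginj1 m n \o @invg_inj _ _ _).
have ginj2 : injective (gamma \o phi1 \o phi2).
  by move=> m n /ginj1/(subsequence_inj h2).
have [phi3 [Fp [Fm [h3 gFp gFm gdyn]]]] := divergent_dynamics hK hk hkd hrho hdiv x0 ginj2.
exists (phi1 \o (phi2 \o phi3)), p, q, Fp, Fm; split.
  exact: (subsequence_comp h1 (subsequence_comp h2 h3)).
split=> //.
- by move=> m n /ginj2/(subsequence_inj h3).
- exact: (tends_to_subsequence h3 (tends_to_subsequence h2 gp)).
- exact: (tends_to_subsequence h3 gq).
Qed.

Lemma ex_transverse_near x0 F (U : set (flag K d k)) : nbhs x0 U ->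
  exists2 y, U y & transverse y F.
Proof. exact: transverse_dense. Qed.

Lemma near_transverse1 x F : transverse x F -> \forall y \near x, transverse y F.
Proof.
move=> xF; have cx : y @[y --> x] --> x by move=> A nA.
have cF : F @[y --> x] --> F by exact: (@cvg_cst _ F _ (nbhs x) _).
exact: (near_transverse hkd cx cF xF).
Qed.

Lemma ex_transverse2 F1 F2 : exists y, transverse y F1 /\ transverse y F2.
Proof.
have [y1 _ y1F] := ex_transverse_near F1 (filterT : nbhs F1 setT).
have [y yF1 yF2] := ex_transverse_near F2 (near_transverse1 y1F).
by exists y.
Qed.

(** The open set [C q] contains the fibre over another point, so by density it contains some [y]
    transverse to [Fm]. Then [gamma_n y] tends to [Fp], while the contraction property draws it into
    every neighbourhood of the fibre over [p]. *)
Lemma attract_in_fiber gamma p q Fp Fm :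
  good_seq gamma p q Fp Fm -> fiber Lambda zeta p Fp.
Proof.
move=> gg; have [_ [C [oC LC dynC]]] := hEGF.
have [p' p'q] := boundary_other q; have [x0 [Lx0 x0p']] := ext_fiber p'.
have Cx0 : C q x0 by apply: LC; split=> // -[_ x0q]; apply: p'q; rewrite -x0p'.
have [|y Cy yF] := @ex_transverse_near x0 Fm (C q).
  by apply: open_nbhs_nbhs; split.
have yFp : ract (gamma n) y @[n --> \oo] --> Fp.
  have id_extr : subsequence id by [].
  exact: (good_dyn gg id_extr (cvg_cst y) yF).
apply: contrapT => nFp.
(* Fibres are sequentially closed, so returning to the fibre infinitely often would place [Fp] in
   it. *)
have near_out : \forall n \near \oo, ~ fiber Lambda zeta p (ract (gamma n) y).
  apply: contrapT => /not_near_subsequence[phi hphi phiP]; apply: nFp.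
  have fy n : fiber Lambda zeta p (ract (gamma (phi n)) y) by exact: contrapT (phiP n).
  exact: (fiber_cvg fy (cvg_subsequence hphi yFp)).
have /near_ooP[N NP] := near_out.
have hN : subsequence (fun n => n + N)%N by move=> m n mn; rewrite ltn_add2r.
(* The complement of the tail of the orbit and its limit is then an open neighbourhood of the fibre
   which the orbit never enters. *)
have cS := closed_cvg_range flag_hausdorff (cvg_subsequence hN yFp).
set S := (X in closed X) in cS.
have SF : fiber Lambda zeta p `<=` ~` S.
  move=> w wp [[n _ ynw]|wFp]; last by apply: nFp; rewrite -wFp.
  by apply: (NP (n + N)%N (leq_addl _ _)); rewrite ynw.
have Ly : [set y] `<=` C q by move=> _ ->.
have /near_ooP[M MP] := dynC gamma p q (good_p gg) (good_q gg) [set y] (~` S)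
  (compact_set1 (x := y)) Ly (closed_openC cS) SF.
have yS : (~` S) (ract (gamma (M + N)%N) y).
  by apply: (MP _ (leq_addr _ _)); exists y.
by apply: yS; left; exists M.
Qed.

(** [good_dyn] concerns only the forward sequence. A further extraction makes the inverses good as
    well, and uniqueness of limits keeps the four limits. *)
Lemma good_seqV gamma p q Fp Fm : good_seq gamma p q Fp Fm ->
  exists2 phi, subsequence phi & good_seq (fun n => (gamma (phi n))^-1%g) q p Fm Fp.
Proof.
move=> gg; have ginj := good_inj gg.
have ginjV : injective (fun n => (gamma n)^-1%g) by move=> m n /invg_inj/ginj.
have [phi [q' [p' [Fm' [Fp' [hphi gg']]]]]] := good_subsequence ginjV; exists phi; first exact: hphi.
have invK : (fun n => ((gamma (phi n))^-1)^-1%g) = gamma \o phi.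
  by apply/funext => n /=; rewrite invgK.
have E1 : q' = q := tends_uniq (good_p gg') (tends_to_subsequence hphi (good_q gg)).
have E2 : Fm' = Fm := limit_flag_uniq (good_Fp gg') (limit_flag_subsequence hphi (good_Fm gg)).
have gq' : tends_to a (gamma \o phi) p' by rewrite -invK; exact: (good_q gg').
have gF' : limit_flag rho (gamma \o phi) Fp' by rewrite -invK; exact: (good_Fm gg').
have E3 : p' = p := tends_uniq gq' (tends_to_subsequence hphi (good_p gg)).
have E4 : Fp' = Fp := limit_flag_uniq gF' (limit_flag_subsequence hphi (good_Fp gg)).
by move: gg'; rewrite E1 E2 E3 E4.
Qed.

Lemma repel_in_fiber gamma p q Fp Fm :
  good_seq gamma p q Fp Fm -> fiber Lambda zeta q Fm.
Proof. by move=> /good_seqV[phi _ /attract_in_fiber]. Qed.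

Lemma good_limit_set gamma p q Fp Fm : good_seq gamma p q Fp Fm -> L Fp.
Proof. by move=> gg; exists gamma; [exact: good_inj gg|exact: good_Fp gg]. Qed.

Lemma limit_set_good x gamma : injective gamma -> limit_flag rho gamma x ->
  exists phi p q Fm, subsequence phi /\ good_seq (gamma \o phi) p q x Fm.
Proof.
move=> ginj gx; have [phi [p [q [Fp [Fm [hphi gg]]]]]] := good_subsequence ginj.
have -> := limit_flag_uniq (limit_flag_subsequence hphi gx) (good_Fp gg).
by exists phi, p, q, Fm.
Qed.

Lemma limit_set_sub : L `<=` Lambda.
Proof.
move=> x [gamma ginj gx]; have [phi [p [q [Fm [_ gg]]]]] := limit_set_good ginj gx.
by have [] := attract_in_fiber gg.
Qed.

Lemma limit_fiber gamma p q x Fm : good_seq gamma p q x Fm -> fiber L zeta p x.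
Proof.
move=> gg; have [_ xp] := attract_in_fiber gg; split=> //; exact: good_limit_set gg.
Qed.

Lemma limit_set_closed : closed L.
Proof.
have fcf : first_countable (flag K d k) := @flag_first_countable K hK d k.
apply: (@seq_closed _ fcf L) => y_ y Ly yy.
have [o _] := model_nonempty hX.
have [b1 nb1 b1P] := grass_first_countable hK (val y).1.
have [b2 nb2 b2P] := grass_first_countable hK (val y).2.
have /cvg_flagP[y1 y2] := yy.
(* A diagonal choice need not consist of distinct elements; the growing displacement rules out a
   constant subsequence. *)
have /choice[g gP] i : exists g : G, [/\ b1 i (Uspace k (rho g)),
    b2 i (Uspace (d - k) (rho g)) & i%:R <= mdist o (a g o)].
  have n1 : \forall n \near \oo, (b1 i)^° (val (y_ n)).1.
    by apply: y1; apply: open_nbhs_nbhs; split; [exact: open_interior|exact: nb1].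
  have n2 : \forall n \near \oo, (b2 i)^° (val (y_ n)).2.
    by apply: y2; apply: open_nbhs_nbhs; split; [exact: open_interior|exact: nb2].
  have [m [m1 m2]] := filter_ex (filterI n1 n2).
  have [gamma ginj /limit_flagP[g1 g2]] := Ly m.
  have n3 : \forall n \near \oo, b1 i (Uspace k (rho (gamma n))) := g1 _ m1.
  have n4 : \forall n \near \oo, b2 i (Uspace (d - k) (rho (gamma n))) := g2 _ m2.
  have n5 : \forall n \near \oo, i%:R <= mdist o (a (gamma n) o).
    by apply/near_ooP; exact: (injective_dist (model_proper hX)
      (model_properly_discontinuous hX) o i%:R ginj).
  by have [n [[h3 h4] h5]] := filter_ex (filterI (filterI n3 n4) n5); exists (gamma n).
have gy : limit_flag rho g y.
  by apply/limit_flagP; split; [apply: b1P|apply: b2P] => n; have [] := gP n.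
have [[phi hphi ginj]|[phi [c [hphi gc]]]] := const_or_injective g.
  exists (g \o phi); first exact: ginj.
  exact: (limit_flag_subsequence hphi gy).
exfalso; have [N NP] := exists_natr_ge (mdist o (a c o) + 1).
have [_ _] := gP (phi N); rewrite gc => h.
have : N%:R <= (phi N)%:R :> R by rewrite ler_nat; exact: subsequence_ge.
lra.
Qed.

(** [Uspace] does not commute with left multiplication by [g]. A flag [y] transverse to the
    repelling flags of both sequences is sent to [ract g x] and to a limit flag of the translated
    sequence, which must agree. *)
Lemma limit_set_invariant g x : L x -> L (ract g x).
Proof.
move=> [gamma ginj gx]; have [phi [p [q [Fm [hphi gg]]]]] := limit_set_good ginj gx.
pose gamma' n := (g * gamma (phi n))%g.
have ginj' : injective gamma' by move=> m n /mulgI/(good_inj gg).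
have [psi [p' [q' [F' [Fm' [hpsi gg']]]]]] := good_subsequence ginj'.
have [y [yFm yFm']] := ex_transverse2 Fm Fm'.
have id_extr : subsequence id by [].
have c1 : ract (gamma (phi (psi n))) y @[n --> \oo] --> x.
  exact: (good_dyn gg hpsi (cvg_cst y) yFm).
have c2 : ract (gamma' (psi n)) y @[n --> \oo] --> F'.
  exact: (good_dyn gg' id_extr (cvg_cst y) yFm').
have c3 : ract (gamma' (psi n)) y @[n --> \oo] --> ract g x.
  have -> : (fun n => ract (gamma' (psi n)) y) =
      fun n => ract g (ract (gamma (phi (psi n))) y).
    by apply/funext => n; rewrite /gamma' (flag_act_rhoM hrho).
  exact: (cvg_flag_act (rho_unit hrho g) c1).
by rewrite (flag_cvg_unique c3 c2); exact: good_limit_set gg'.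
Qed.

Lemma limit_set_surjective p : exists x, fiber L zeta p x.
Proof.
have [gamma gp] := boundary_is_limit hP hX p.
have [phi hphi ginj] := tends_to_injective gp.
have [psi [p' [q [Fp [Fm [hpsi gg]]]]]] := good_subsequence ginj.
exists Fp; have := limit_fiber gg.
by rewrite (tends_uniq (good_p gg) (tends_to_subsequence hpsi (tends_to_subsequence hphi gp))).
Qed.

Lemma limit_set_extension : transverse_boundary_extension rho a L zeta.
Proof.
split.
- exact: limit_set_closed.
- by move=> g x; exact: limit_set_invariant.
- exact: continuous_subspaceW limit_set_sub (ext_continuous hext).
- by move=> g x /limit_set_sub; exact: (ext_equivariant hext).
- rewrite -subTset => p _; have [x [Lx xp]] := limit_set_surjective p.
  by exists x.
- move=> p q pq x y [/limit_set_sub Lx xp] [/limit_set_sub Ly yq].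
  exact: (ext_transverse hext pq (conj Lx xp) (conj Ly yq)).
Qed.

Lemma limit_fiber_cvg p (x_ : nat -> flag K d k) x : (forall n, fiber L zeta p (x_ n)) ->
  x_ n @[n --> \oo] --> x -> fiber L zeta p x.
Proof.
move=> xp xx; have Lx n : L (x_ n) by have [] := xp n.
have nL : \forall n \near \oo, L (x_ n) by exists 0%N.
have {}Lx' := closed_cvg L limit_set_closed nL x xx.
have fx n : fiber Lambda zeta p (x_ n) 
  by have [h h'] := xp n; exact: (conj (limit_set_sub h) h').
by have [_ zx] := fiber_cvg fx xx; split; [exact: Lx'|exact: zx].
Qed.

Lemma limit_set_EGF : EGF_with rho a L zeta.
Proof.
split; first exact: limit_set_extension.
have fcf : first_countable (flag K d k) := @flag_first_countable K hK d k.
exists (fun p => [set y | forall x, fiber L zeta p x -> transverse y x]); split.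
(* Non-transverse partners of a convergent sequence subconverge inside the fibre, and transversality
   is an open condition on pairs. *)
- move=> p; rewrite -closedC; apply: (@seq_closed _ fcf) => y_ y ny yy yC.
  have /choice[x_ xP] n : exists x, fiber L zeta p x /\ ~ transverse (y_ n) x.
    apply: contrapT => nx; apply: (ny n) => x xp; apply: contrapT => nt.
    by apply: nx; exists x.
  have [phi [x [hphi xx]]] := flag_subsequence hK x_.
  have xp : fiber L zeta p x.
    have fx n : fiber L zeta p (x_ (phi n)) by have [] := xP (phi n).
    exact: limit_fiber_cvg fx xx.
  have nt : \forall n \near \oo, transverse (y_ (phi n)) (x_ (phi n)).
    exact: (near_transverse hkd (cvg_subsequence hphi yy) xx (yC x xp)).
  by have [n tn] := filter_ex nt; have [_] := xP (phi n).
- move=> p y [Ly nyp] x xp.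
  have yy : fiber L zeta (zeta y) y by split.
  by apply: (ext_transverse limit_set_extension _ yy xp) => yp; apply: nyp; split.
(* Points of [L0] violating the conclusion subconverge in [L0] to a flag transverse to [Fm]; their
   images then tend to [Fp], which lies in the fibre and hence in [U]. *)
- move=> gamma p q gp gq L0 U cL0 L0C oU pU; apply: contrapT => /not_near_subsequence[phi1 h1 phi1P].
  have /choice[l lP] n : exists l, L0 l /\ ~ U (ract (gamma (phi1 n)) l).
    apply: contrapT => nl; apply: (phi1P n) => _ [l L0l <-].
    by apply: contrapT => nU; apply: nl; exists l.
  have gp1 := tends_to_subsequence h1 gp.
  have [phi2 h2 ginj] := tends_to_injective gp1.
  have [phi3 [p' [q' [Fp [Fm [h3 gg]]]]]] := good_subsequence ginj.
  have h123 := subsequence_comp h1 (subsequence_comp h2 h3).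
  have h23 := subsequence_comp h2 h3.
  have pE := tends_uniq (good_p gg) (tends_to_subsequence h123 gp).
  have qE := tends_uniq (good_q gg) (tends_to_subsequence h123 gq).
  have [phi4 [l0 [h4 L0l0 ll0]]] := compact_subsequence fcf cL0
    (fun n => (lP (phi2 (phi3 n))).1).
  have Fpp : fiber L zeta p Fp by rewrite -pE; exact: limit_fiber gg.
  have [psi _ ggV] := good_seqV gg.
  have Fmq : fiber L zeta q Fm by rewrite -qE; exact: limit_fiber ggV.
  have lF := L0C _ L0l0 _ Fmq.
  have cU := good_dyn gg h4 ll0 lF.
  have nU : \forall n \near \oo,
      U (ract (gamma (phi1 (phi2 (phi3 (phi4 n))))) (l (phi2 (phi3 (phi4 n))))).
    by apply: cU; apply: open_nbhs_nbhs; split=> //; exact: pU.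
  by have [n Un] := filter_ex nU; have [_] := lP (phi2 (phi3 (phi4 n))).
Qed.

(** The conical condition with distinct elements and explicit orbit limits; it is the inverse
    sequence that tends to [q]. *)
Record conical_seq eta c q b : Prop := {
  conical_inj : injective eta;
  conical_c : tends_to a eta c;
  conical_q : tends_to a (fun n => (eta n)^-1%g) q;
  conical_b : boundary_act a (eta n) q @[n --> \oo] --> b;
  conical_neq : b <> c }.

(** A flag over [q] is moved by [eta] to flags staying transverse to the
    repelling flag of [eta^-1]; pulling back, it is the attracting one. *)
Lemma conical_fiber eta c q b : conical_seq eta c q b ->
  exists x, forall y, fiber Lambda zeta q y -> y = x.
Proof.
move=> [einj ec eq_ eb bc].
have einjV : injective (fun n => (eta n)^-1%g) by move=> m n /invg_inj/einj.
have [phi [q' [c' [x [Fm [hphi gg]]]]]] := good_subsequence einjV.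
exists x => y [Ly yq].
have [psi [z [hpsi yz]]] := flag_subsequence hK (fun n => ract (eta (phi n)) y).
have Lz n : Lambda (ract (eta (phi (psi n))) y) by exact: (ext_invariant hext).
have [{}Lz zz] := ext_cvg Lz yz.
have zb : zeta z = b.
  have hpp := subsequence_comp hphi hpsi.
  apply: (boundary_uniq zz).
  rewrite (_ : (fun n => zeta _) = fun n => boundary_act a (eta (phi (psi n))) q).
    exact: (cvg_subsequence hpp eb).
  by apply/funext => n; rewrite (ext_equivariant hext)// yq.
have cE : c' = c.
  apply: (tends_uniq (good_q gg)).
  rewrite (_ : (fun n => _) = eta \o phi); first exact: (tends_to_subsequence hphi ec).
  by apply/funext => n /=; rewrite invgK.
have Fmc : fiber Lambda zeta c Fm by rewrite -cE; exact: repel_in_fiber gg.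
have zF : transverse z Fm by exact: (ext_transverse hext bc (conj Lz zb) Fmc).
have cx := good_dyn gg hpsi yz zF.
have cy : y @[n --> \oo] --> x.
  move: cx; rewrite (_ : (fun n => _) = fun=> y)//.
  apply/funext => n /=; rewrite -(flag_act_rhoM hrho) mulVg.
  exact: (flag_act_rho1 hrho).
exact: (cvg_unique flag_hausdorff (cvg_cst y) cy).
Qed.

(** Extraction on the boundary: a lift of [p] is moved inside the compact [Lambda], and the limit is
    projected by [zeta]. *)
Lemma subseq_boundary_cvg gamma p : exists phi b, subsequence phi /\
  boundary_act a (gamma (phi n)) p @[n --> \oo] --> b.
Proof.
have [x [Lx xp]] := ext_fiber p.
have [phi [z [hphi yz]]] := flag_subsequence hK (fun n => ract (gamma n) x).
have Lz n : Lambda (ract (gamma (phi n)) x) by exact: (ext_invariant hext).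
have [_ zz] := ext_cvg Lz yz.
exists phi, (zeta z); split; first exact: hphi.
rewrite (_ : (fun n => _) = fun n => zeta (ract (gamma (phi n)) x)); first exact: zz.
by apply/funext => n; rewrite (ext_equivariant hext)// xp.
Qed.

Lemma two_points_conical q q' : q' <> q -> (forall r, r = q \/ r = q') ->
  exists eta c b, conical_seq eta c q b.
Proof.
move=> q'q two; have [gamma gq] := boundary_is_limit hP hX q.
have [phi1 h1 ginj] := tends_to_injective gq.
have [phi2 [q1 [c [Fp [Fm [h2 gg]]]]]] := good_subsequence ginj.
have q1E : q1 = q := tends_uniq (good_p gg) (tends_to_subsequence (subsequence_comp h1 h2) gq).
pose eta n := (gamma (phi1 (phi2 n)))^-1%g.
have einj : injective eta by move=> m n /invg_inj/(good_inj gg).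
have eq_ : tends_to a (fun n => (eta n)^-1%g) q.
  rewrite (_ : (fun n => _) = gamma \o phi1 \o phi2); first by rewrite -q1E; exact: good_p gg.
  by apply/funext => n; rewrite /eta invgK.
have [phi3 [b [h3 eb]]] := subseq_boundary_cvg eta q.
have einj3 : injective (eta \o phi3) by move=> m n /einj/(subsequence_inj h3).
have ec3 := tends_to_subsequence h3 (good_q gg).
have eq3 := tends_to_subsequence h3 eq_.
exists (eta \o phi3), c, b; split; [exact: einj3|exact: ec3|exact: eq3|exact: eb|].
move=> bc; rewrite {}bc in eb.
have eq'c : boundary_act a (eta (phi3 n)) q' @[n --> \oo] --> c.
  exact: (boundary_dynamics ec3 eq3).
(* With only two boundary points, convergence to [c] is eventual equality. If [q] and [q'] both
   converged to [c], some element would send both to [c], against injectivity. *)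
have stuck r : boundary_act a (eta (phi3 n)) r @[n --> \oo] --> c ->
    \forall n \near \oo, boundary_act a (eta (phi3 n)) r = c.
  move=> rc; apply: contrapT => /not_near_subsequence[psi hpsi psiP].
  have [c' c'c c'P] : exists2 c', c' <> c & forall r, r = c \/ r = c'.
    by case: (two c) => ->; [exists q'|exists q => [|r0]; [exact: nesym|case: (two r0); auto]].
  have E n : boundary_act a (eta (phi3 (psi n))) r = c' by case: (c'P (boundary_act a (eta (phi3 (psi n))) r)) => // /psiP.
  apply: c'c; apply: boundary_uniq (cvg_subsequence hpsi rc).
  by rewrite (_ : (fun n => _) = fun=> c'); [exact: cvg_cst|apply/funext].
have [n [e1 e2]] := filter_ex (filterI (stuck q eb) (stuck q' eq'c)).
by apply: q'q; rewrite -(boundary_actK a (eta (phi3 n)) q') e2 -e1 boundary_actK.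
Qed.

(** If the given sequence is constant along a subsequence, one element sends all points other than
    [q] to [c], so the boundary has two points. Otherwise a good subsequence has a repelling point
    [q1]. If [q1 <> q], then [q] and any third point are attracted to the same point, which gives
    [b = c], so again only two points exist. *)
Lemma conical_ex q : conical_limit_point a q -> exists eta c b, conical_seq eta c q b.
Proof.
move=> [gamma [b [c [bc gb gc]]]].
have [q' q'q] := boundary_other q.
have [[phi1 h1 ginj]|[phi [g [hphi gE]]]] := const_or_injective gamma; last first.
  apply: (two_points_conical q'q) => r.
  have gr s : s <> q -> boundary_act a g s = c.
    move=> /gc gsc; apply: boundary_uniq (cvg_subsequence hphi gsc).
    by rewrite (_ : (fun n => _) = fun=> boundary_act a g s); [exact: cvg_cst|apply/funext => n; rewrite gE].
  have [->|rq] := pselect (r = q); [by left|right].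
  by rewrite -(boundary_actK a g r) (gr r rq) -(gr q' q'q) boundary_actK.
have [phi2 [c' [q1 [Fp [Fm [h2 gg]]]]]] := good_subsequence ginj.
have h12 := subsequence_comp h1 h2.
have dyn r : r <> q1 -> boundary_act a (gamma (phi1 (phi2 n))) r @[n --> \oo] --> c'.
  exact: boundary_dynamics (good_p gg) (good_q gg).
have [q1E|q1q] := pselect (q1 = q).
  exists (gamma \o phi1 \o phi2), c, b.
  have cE : c' = c.
    apply: (boundary_uniq (dyn q' _) (cvg_subsequence h12 (gc q' q'q))).
    by rewrite q1E.
  rewrite -cE -q1E; split; [exact: good_inj gg|exact: good_p gg|exact: good_q gg| |by rewrite cE].
  by rewrite q1E; exact: (cvg_subsequence h12 gb).
apply: (two_points_conical q1q) => r.
have [->|rq] := pselect (r = q); [by left|right].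
apply: contrapT => rq1; apply: bc.
rewrite (boundary_uniq (cvg_subsequence h12 gb) (dyn q (nesym q1q))).
exact: (boundary_uniq (dyn r rq1) (cvg_subsequence h12 (gc r rq))).
Qed.

(** Each subsequence has a further one whose flags converge to a point of the fibre. As the fibre is
    a singleton, the whole sequence converges. *)
Lemma conical_limit_flag gamma q : tends_to a gamma q -> conical_limit_point a q ->
  exists2 x, limit_flag rho gamma x & fiber L zeta q = [set x].
Proof.
move=> gq /conical_ex[eta [c [b /conical_fiber[x xP]]]].
have [x' x'q] := limit_set_surjective q.
have LP y : fiber L zeta q y -> y = x.
  by move=> [/limit_set_sub Ly yq]; apply: xP; split.
have x'E := LP _ x'q; rewrite {}x'E in x'q.
exists x; last by apply/seteqP; split=> [y /LP//|_ ->].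
move=> U nU; apply: contrapT => /not_near_subsequence[phi1 h1 phi1P].
have gq1 := tends_to_subsequence h1 gq.
have [phi2 h2 ginj] := tends_to_injective gq1.
have [phi3 [q1 [r [Fp [Fm [h3 gg]]]]]] := good_subsequence ginj.
have q1E : q1 = q.
  exact: tends_uniq (good_p gg) (tends_to_subsequence (subsequence_comp h2 h3) gq1).
have Fq := limit_fiber gg; rewrite q1E in Fq.
have FU : nbhs (val Fp) U by rewrite (LP _ Fq).
have nearU : \forall n \near \oo, U (Uflag k (rho (gamma (phi1 (phi2 (phi3 n)))))).
  by have := good_Fp gg; rewrite /limit_flag => /(_ U FU).
by have [n Un] := filter_ex nearU; exact: (phi1P (phi2 (phi3 n))).
Qed.

(** * Fibres over bounded parabolic points *)

Section Parabolic.
Variable p : boundary X.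
Hypothesis par : bounded_parabolic_point a p.
Local Notation H := (boundary_stab a p).

Lemma stab_tends gamma r : (forall n, H (gamma n)) -> tends_to a gamma r -> r = p.
Proof.
have [delta hyp] := model_hyperbolic hX; have [_ nolox _] := par.
exact: (stab_tends_to hyp (model_geodesic hX) (model_proper hX)
  (model_properly_discontinuous hX) nolox).
Qed.

Lemma stab_good gamma : injective gamma -> (forall n, H (gamma n)) ->
  exists phi Fp Fm, subsequence phi /\ good_seq (gamma \o phi) p p Fp Fm.
Proof.
move=> ginj gH; have [phi [r [s [Fp [Fm [hphi gg]]]]]] := good_subsequence ginj.
have rp : r = p by apply: (stab_tends _ (good_p gg)) => n; exact: gH.
have sp : s = p.
  by apply: (stab_tends _ (good_q gg)) => n; apply: boundary_stabV; exact: gH.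
by exists phi, Fp, Fm; rewrite -{1}rp -sp.
Qed.

Lemma stab_limit_fiber gamma x : injective gamma -> (forall n, H (gamma n)) ->
  limit_flag rho gamma x -> fiber L zeta p x.
Proof.
move=> ginj gH gx; have [phi [Fp [Fm [hphi gg]]]] := stab_good ginj gH.
rewrite (limit_flag_uniq (limit_flag_subsequence hphi gx) (good_Fp gg)).
exact: limit_fiber gg.
Qed.

(** A sequence tending to [p] factors through the stabilizer of [p], up to
    elements moving a chosen boundary point into a compact set avoiding [p]. *)
Lemma parabolic_fiber_limit x : fiber L zeta p x ->
  exists gamma, [/\ injective gamma, forall n, H (gamma n) & limit_flag rho gamma x].
Proof.
move=> [Lx xp]; have [gamma0 ginj0 gx0] := Lx.
have [phi0 [p' [q [Fm [h0 gg0]]]]] := limit_set_good ginj0 gx0.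
have p'p : p' = p by have [_ <-] := limit_fiber gg0.
rewrite {}p'p in gg0.
have [phi1 [b [h1 gb]]] := subseq_boundary_cvg (fun n => (gamma0 (phi0 n))^-1%g) p.
(* Avoiding [b] ensures [gamma_n z <> p] for large [n], so that the stabilizer can bring [gamma_n z]
   back to [C]; it later also makes [p] conical in the case [r = p]. *)
have [z zb] := boundary_other b.
have near_z : \forall n \near \oo, boundary_act a (gamma0 (phi0 (phi1 n)))^-1%g p <> z.
  apply: contrapT => /not_near_subsequence[psi hpsi psiP]; apply: zb.
  apply: boundary_uniq (cvg_subsequence hpsi gb).
  rewrite (_ : (fun n => _) = fun=> z); first exact: cvg_cst.
  by apply/funext => n; exact: contrapT (psiP n).
have /near_ooP[N NP] := near_z.
have hN : subsequence (fun n => n + N)%N by move=> m n mn; rewrite ltn_add2r.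
pose gamma n := gamma0 (phi0 (phi1 (n + N)%N)).
have gg : good_seq gamma p q x Fm.
  exact: good_seq_subsequence hN (good_seq_subsequence h1 gg0).
have {}gb : boundary_act a (gamma n)^-1%g p @[n --> \oo] --> b.
  exact: (cvg_subsequence hN gb).
have gz n : boundary_act a (gamma n) z <> p.
  by move=> zp; apply: (NP (n + N)%N (leq_addl _ _)); rewrite -zp boundary_actK.
have [Hinf _ [C cC CE]] := par.
have /choice[h hP_] n : exists h, H h /\ C (boundary_act a (h^-1 * gamma n)%g z).
  have : (~` [set p]) (boundary_act a (gamma n) z) by exact: gz.
  rewrite -CE => -[h Hh [c Cc cz]]; exists h; split; first exact: Hh.
  by rewrite boundary_actM -cz boundary_actK.
have Hh n : H (h n) by have [] := hP_ n.
pose g n := ((h n)^-1 * gamma n)%g.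
have Cg n : C (boundary_act a (g n) z) by have [] := hP_ n.
have hg n : (h n * g n)%g = gamma n by rewrite /g mulVKg.
have id_extr : subsequence id by [].
(* If [g] is constantly [c] along a subsequence, [h] and [gamma] differ by right translation by [c].
   Their limit flags are compared on some [w] transverse to [F2] with [c^-1 w] transverse to
   [Fm]. *)
have [[phi hphi ginj]|[phi [c [hphi gc]]]] := const_or_injective g; last first.
  have hE n : h (phi n) = (gamma (phi n) * c^-1)%g by rewrite -hg gc mulgK.
  have hinj : injective (h \o phi).
    by move=> m n /=; rewrite !hE => /mulIg/(good_inj gg)/(subsequence_inj hphi).
  have [psi [F1 [F2 [hpsi hh]]]] := stab_good hinj (fun n => Hh (phi n)).
  exists (h \o phi \o psi); split; [exact: good_inj hh|by move=> n; exact: Hh|].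
  suff -> : x = F1 by exact: good_Fp hh.
  have [y1 y1F] := ex_transverse2 Fm Fm.
  have {}y1F : transverse (ract c^-1%g (ract c y1)) Fm.
    by rewrite -(flag_act_rhoM hrho) mulVg (flag_act_rho1 hrho); case: y1F.
  have nw : \forall w \near ract c y1, transverse (ract c^-1%g w) Fm.
    have cc : ract c^-1%g w @[w --> ract c y1] --> ract c^-1%g (ract c y1).
      have uc := rho_unit hrho c^-1%g.
      have ci : w @[w --> ract c y1] --> ract c y1 by move=> A nA.
      exact: (cvg_flag_act uc ci).
    exact: (cc _ (near_transverse1 y1F)).
  have [w wF wF2] := ex_transverse_near F2 nw.
  have c1 : ract (h (phi (psi n))) w @[n --> \oo] --> F1.
    exact: (good_dyn hh id_extr (cvg_cst w) wF2).
  have c2 : ract (gamma ((phi \o psi) n)) (ract c^-1%g w) @[n --> \oo] --> x.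
    exact: (good_dyn gg (subsequence_comp hphi hpsi) (cvg_cst (ract c^-1%g w)) wF).
  have hE' n : ract (gamma ((phi \o psi) n)) (ract c^-1%g w) = ract (h (phi (psi n))) w.
    by rewrite hE (flag_act_rhoM hrho).
  have c3 : ract (h (phi (psi n))) w @[n --> \oo] --> x.
    by move: c2; have -> := funext hE'.
  exact: (flag_cvg_unique c3 c1).
have [psi [r [s [Gp [Gm [hpsi gr]]]]]] := good_subsequence ginj.
pose chi := phi \o psi; have hchi : subsequence chi := subsequence_comp hphi hpsi.
have [rp|rp] := pselect (r = p).
  (* Otherwise [g_n z] tends to [r = p], which the closed set [C] excludes. The inverses of [g_n]
     thus tend to [z] but send [p] to [gamma_n^-1 p], which tends to [b <> z]: [p] is conical. *)
  have sz : s = z.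
    apply: contrapT => sz.
    have gzr := boundary_dynamics (good_p gr) (good_q gr) (nesym sz).
    have [delta hyp] := model_hyperbolic hX.
    have clC : closed C by apply: compact_closed => //; exact: boundary_hausdorff hyp.
    have nC : \forall n \near \oo, C (boundary_act a (g (chi n)) z) by exists 0%N.
    have Cr : C r by exact: (closed_cvg C clC nC r gzr).
    have : (~` [set p]) r.
      rewrite -CE; exists 1%g; first exact: boundary_act1.
      by exists r => //; exact: boundary_act1.
    exact.
  have con : conical_seq (fun n => (g (chi n))^-1%g) s p b.
    split.
    - by move=> m n /invg_inj/(good_inj gr).
    - exact: good_q gr.
    - rewrite (_ : (fun n => _) = g \o phi \o psi); first by rewrite -rp; exact: good_p gr.
      by apply/funext => n; rewrite invgK.
    - rewrite (_ : (fun n => _) = fun n => boundary_act a (gamma (chi n))^-1%g p).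
        exact: (cvg_subsequence hchi gb).
      apply/funext => n; rewrite /g invgM invgK boundary_actM.
      by have -> : boundary_act a (h (chi n)) p = p by exact: Hh.
    - by rewrite sz; exact: nesym.
  have [x' x'P] := conical_fiber con.
  have [f finj fH] := infinite_injective Hinf.
  have [om [F1 [F2 [hom hh]]]] := stab_good finj fH.
  exists (f \o om); split; [exact: good_inj hh|by move=> n; exact: fH|].
  rewrite (x'P x); last exact: (conj (limit_set_sub Lx) xp).
  rewrite -(x'P F1); last exact: attract_in_fiber hh.
  exact: good_Fp hh.
(* A constant value [c] of [h] fixes [p] and would send [r] to [p], so [r = p]. *)
have [[om hom hinj]|[om [c [hom hc]]]] := const_or_injective (h \o chi); last first.
  exfalso; apply: rp.
  have Hc : H c by rewrite -(hc 0%N); exact: Hh.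
  have t1 := tends_to_mull c (tends_to_subsequence hom (good_p gr)).
  have t2 : tends_to a (fun n => c * g (chi (om n)))%g p.
    rewrite (_ : (fun n => _) = gamma \o (chi \o om)).
      exact: (tends_to_subsequence (subsequence_comp hchi hom) (good_p gg)).
    by apply/funext => n; rewrite -(hc n) hg.
  have cr : boundary_act a c r = p := tends_uniq t1 t2.
  have cp : boundary_act a c p = p by exact: Hc.
  by rewrite -(boundary_actK a c r) cr -{1}cp boundary_actK.
have [tau [F1 [F2 [htau hh]]]] := stab_good hinj (fun n => Hh (chi (om n))).
exists (h \o chi \o om \o tau); split; [exact: good_inj hh|by move=> n; exact: Hh|].
suff -> : x = F1 by exact: good_Fp hh.
have hot := subsequence_comp hom htau.
have [y [yG yF]] := ex_transverse2 Gm Fm.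
have c1 : ract (g (chi ((om \o tau) n))) y @[n --> \oo] --> Gp.
  exact: (good_dyn gr hot (cvg_cst y) yG).
(* [Gp] lies over [r] and the repelling flag [F2] of [h] over [p]. As [r <> p] they are transverse,
   so [h] contracts [g_n y] to [F1], whereas [h_n g_n y = gamma_n y] tends to [x]. *)
have GF : transverse Gp F2.
  exact: (ext_transverse hext rp (attract_in_fiber gr) (repel_in_fiber hh)).
have c2 : ract (h (chi (om (tau n)))) (ract (g (chi (om (tau n)))) y) @[n --> \oo] --> F1.
  exact: (good_dyn hh id_extr c1 GF).
have c3 : ract (gamma (chi (om (tau n)))) y @[n --> \oo] --> x.
  exact: (good_dyn gg (subsequence_comp hchi hot) (cvg_cst y) yF).
have hE n : ract (h (chi (om (tau n)))) (ract (g (chi (om (tau n)))) y) =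
    ract (gamma (chi (om (tau n)))) y by rewrite -(flag_act_rhoM hrho) hg.
have {}c2 : ract (gamma (chi (om (tau n)))) y @[n --> \oo] --> F1.
  by move: c2; have -> := funext hE.
exact: (flag_cvg_unique c3 c2).
Qed.

End Parabolic.

End ExtendedGeometricallyFinite.

Theorem theorem1p3 (R : realType) (K : numFieldType)
    (hK : real_or_complex R K) (k d : nat) (hk : (1 <= k)%N)
    (hkd : (2 * k <= d)%N) (G : groupType) (P : set (set G))
    (hP : peripheral_structure P) (X : metricType R)
    (a : isometric_action G X) (B : set G -> set X)
    (hX : gromov_model a P B) (rho : G -> 'M[K]_d)
    (hrho : SL_representation rho) (hdiv : divergent k rho)
    (hEGF : extended_geometrically_finite k rho a) :
  exists zeta : flag K d k -> boundary X,
    [/\ EGF_with rho a (limit_set k rho) zeta,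
        forall (gamma : nat -> G) (q : boundary X),
          tends_to a gamma q -> conical_limit_point a q ->
          exists2 x : flag K d k, limit_flag rho gamma x &
            fiber (limit_set k rho) zeta q = [set x] &
        forall p : boundary X, bounded_parabolic_point a p ->
          fiber (limit_set k rho) zeta p =
          [set x | exists gamma : nat -> G,
             [/\ injective gamma, forall n, boundary_stab a p (gamma n) &
                 limit_flag rho gamma x]]].
Proof.
have hK' := real_or_complex_like hK; have [Lambda [zeta hE]] := hEGF.
exists zeta; split.
- exact: (limit_set_EGF hK' hk hkd hP hX hrho hdiv hE).
- exact: (conical_limit_flag hK' hk hkd hP hX hrho hdiv hE).
- move=> p par; apply/seteqP; split=> x.
    exact: (parabolic_fiber_limit hK' hk hkd hX hrho hdiv hE par).
  move=> [gamma [ginj gp gx]].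
  exact: (stab_limit_fiber hK' hk hkd hX hrho hdiv hE par ginj gp gx).
Qed.
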